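(* Let $r>1$ and $q>2$ be such that $\frac1r+\frac2q<1$ and $W$ is continuously embedded in $L^q(\Omega)$. Let $(\bar u,\bar w)\in K$ be a local solution of $$\min_{(u,w)\in K}\; \Phi_0(u,w):=f(u)+\frac{\alpha}{2}\|u\|_U^2+\frac{\beta}{2}\|w\|_W^2+\gamma\int_\Omega |w|^p\,dx$$ such that the map $x\mapsto\|f'(\bar u)(\cdot,x)\|_{L^1(I)}$ is in $L^r(\Omega)$. Then $\bar w\in L^\infty(\Omega)$ and $\bar u\in L^\infty(I\times\Omega)$.
   Context: Setting. $\Omega\subset\mathbb{R}^d$ is a bounded Lipschitz domain, $I=(0,T)$ with $T>0$, and $U:=L^2(I\times\Omega)$. The dual of $U$ is identified with $U$, and $f'(\bar u)\in U^*$ is identified with its Riesz representative $f'(\bar u)\in U=L^2(I\times\Omega)$. All functions are real valued. The space $W$ is one of the Hilbert spaces $H^s(\Omega)$, $H^s_0(\Omega)$, $\tilde H^s(\Omega)$, $\mathbb{H}^s(\Omega)$ for some $s\in(0,1)$, where: (1) $H^s(\Omega)$ is the set of $w\in L^2(\Omega)$ with $\int_\Omega\int_\Omega \frac{|w(x)-w(y)|^2}{|x-y|^{d+2s}}\,dy\,dx<\infty$, with inner product $(u,w)_{H^s(\Omega)}=\int_\Omega uw\,dx+\frac{c_{d,s}}{2}\int_\Omega\int_\Omega\frac{(u(x)-u(y))(w(x)-w(y))}{|x-y|^{d+2s}}\,dy\,dx$, $c_{d,s}=\frac{s2^{2s}\Gamma(s+d/2)}{\pi^{d/2}\Gamma(1-s)}$;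 (2) $H^s_0(\Omega)$ is the closure of $C_c^\infty(\Omega)$ in $H^s(\Omega)$, with the $H^s(\Omega)$-inner product; (3) $\tilde H^s(\Omega)=\{w\in H^s(\mathbb{R}^d): w=0 \text{ on } \mathbb{R}^d\setminus\Omega\}$, with the $H^s(\mathbb{R}^d)$-inner product (same formula as in (1) with $\mathbb{R}^d$ in place of $\Omega$); (4) $\mathbb{H}^s(\Omega)=\{w=\sum_n w_n\phi_n\in L^2(\Omega): \|w\|^2_{\mathbb{H}^s}=\sum_n\lambda_n^s w_n^2<\infty\}$, where $w_n=\int_\Omega w\phi_n\,dx$ and $(\phi_n,\lambda_n)$ are the ($L^2$-orthonormal) eigenfunctions and eigenvalues of the Laplacian with zero Dirichlet boundary conditions, with inner product $\sum_n\lambda_n^s u_nw_n$. The admissible set is $K:=\{(u,w)\in U\times W: |u(t,x)|\le w(x) \text{ for a.a. } (t,x)\in I\times\Omega\}$. A local solution is a pair $(\bar u,\bar w)\in K$ for which there is $\rho>0$ with $\Phi_0(\bar u,\bar w)\le\Phi_0(u,w)$ for all $(u,w)\in K$ with $\|u-\bar u\|_U\le\rho$, $\|w-\bar w\|_W\le\rho$. Standing assumptions. $f:U\to\mathbb{R}$ is weakly lower semicontinuous, bounded from below by an affine function (there are $g\in U^*$, $c\in\mathbb{R}$ with $f(u)\ge g(u)+c$ for all $u\in U$), and continuously Fréchet differentiable. $\alpha,\beta,\gamma>0$ and $p\in(0,1)$. *)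

(* Defs.v *)
From HB Require Import structures.
From mathcomp Require Import all_boot all_order all_algebra.
From mathcomp Require Import all_classical all_reals all_analysis.
From mathcomp Require Import measurable_realfun.

Set Implicit Arguments.
Unset Strict Implicit.
Unset Printing Implicit Defensive.

Import Order.TTheory GRing.Theory Num.Theory.
Import numFieldNormedType.Exports.

Local Open Scope classical_set_scope.
Local Open Scope ring_scope.

(* Borel sigma-algebra on matrices, hence on R^n = 'rV[R]_n. *)
HB.instance Definition _ (R : realType) (m n : nat) :=
  Measurable.copy 'M[R]_(m, n) (g_sigma_algebraType (@open 'M[R]_(m, n))).

Section borel_rV.
Context {R : realType}.

Lemma open_measurable_mx m n (A : set 'M[R]_(m, n)) : open A -> measurable A.
Proof. exact: sub_sigma_algebra. Qed.

Lemma open_bigcup_ball m n (A : set 'M[R]_(m, n)) : open A ->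
  A = \bigcup_(q in [set q : 'M[rat]_(m, n) * nat |
         ball (map_mx (@ratr R) q.1) q.2.+1%:R^-1 `<=` A])
       ball (map_mx (@ratr R) q.1) q.2.+1%:R^-1.
Proof.
move=> oA; rewrite eqEsubset; split; last by move=> x [q /= qA]; exact: qA.
move=> x Ax.
have /nbhs_ballP[e /= e0 eA] : nbhs x A by exact: open_nbhs_nbhs.
have [k ke] : exists k : nat, k.+1%:R^-1 < e / 2.
  have e20 : 0 < e / 2 by rewrite divr_gt0.
  by have [k _ /(_ k)/= kk] := near_infty_natSinv_lt (PosNum e20); exists k; exact: kk.
have [q qx] : exists q : 'M[rat]_(m, n), ball x k.+1%:R^-1 (map_mx (@ratr R) q).
  have qx (i : 'I_m) (j : 'I_n) : exists r : rat,
      ball (x i j) (k.+1%:R^-1 : R) (ratr r).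
    have /rat_in_itvoo[r] : x i j < x i j + k.+1%:R^-1 by rewrite ltrDl invr_gt0.
    rewrite in_itv/= => /andP[r1 r2]; exists r.
    by rewrite /ball/= ltr_distlC; apply/andP; split=> //; rewrite (lt_trans _ r1)// gtrBl invr_gt0.
  exists (\matrix_(i, j) projT1 (cid (qx i j))).
  split; first by rewrite invr_gt0.
  by move=> i j; rewrite !mxE; case: cid.
exists (q, k) => /=; last exact: ball_sym.
move=> y qy; apply: eA.
rewrite [e]splitr; apply: (ball_triangle (y := map_mx (@ratr R) q)).
  exact: le_ball (ltW ke) _ qx.
exact: le_ball (ltW ke) _ qy.
Qed.

(* R x R^n -> R^(n+1), prepending a coordinate. *)
Definition row_cons n (z : measurableTypeR R * 'rV[R]_n) : 'rV[R]_n.+1 :=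
  row_mx (z.1%:M : 'rV_1) z.2.

Definition row_uncons n (x : 'rV[R]_n.+1) : measurableTypeR R * 'rV[R]_n :=
  (x 0 0, rsubmx (x : 'rV_(1 + n))).

Lemma row_consE0 n (z : measurableTypeR R * 'rV[R]_n) i : row_cons z i 0 = z.1.
Proof.
have -> : (0 : 'I_n.+1) = lshift n (0 : 'I_1) by exact: val_inj.
by apply: etrans (row_mxEl _ _ _ _) _; rewrite mxE !ord1.
Qed.

Lemma row_consES n (z : measurableTypeR R * 'rV[R]_n) i j : row_cons z i (rshift 1 j) = z.2 i j.
Proof. exact: row_mxEr. Qed.

Lemma row_consK n : cancel (@row_cons n) (@row_uncons n).
Proof.
by move=> [a v]; rewrite /row_uncons row_consE0 /row_cons row_mxKr.
Qed.

Lemma row_cons_ball n (x : 'rV[R]_n.+1) (e : R) :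
  @row_cons n @^-1` ball x e =
  ball (row_uncons x).1 e `*` ball (row_uncons x).2 e.
Proof.
apply/seteqP; split=> -[a v].
  move=> [e0 xe]; split=> /=.
    by have := xe 0 0; rewrite row_consE0.
  split=> // i j; have := xe i (rshift 1 j).
  by rewrite row_consES mxE.
move=> [/= xa [e0 xv]]; split => // i j; rewrite ord1.
case: (split_ordP (j : 'I_(1 + n))) => k ->.
  have -> : lshift n k = 0 :> 'I_n.+1 by rewrite ord1; exact: val_inj.
  by rewrite row_consE0.
by rewrite row_consES; have := xv 0 k; rewrite mxE.
Qed.

Lemma measurable_row_cons n : measurable_fun setT (@row_cons n).
Proof.
apply: measurability => //.
move=> _ [A oA <-]; rewrite setTI (open_bigcup_ball oA) preimage_bigcup.
rewrite bigcup_mkcond; apply: countable_bigcupT_measurable => // q.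
case: ifPn => // _; rewrite row_cons_ball.
by apply: measurableX; [apply: open_measurable|apply: open_measurable_mx];
  exact: ball_open.
Qed.

Lemma measurable_coord n (i : 'I_n) :
  measurable_fun setT (fun x : 'rV[R]_n => x 0 i).
Proof.
apply: (measurability _ (RGenOpens.measurableE R)).
move=> _ [_ [a [b ->] <-]]; rewrite setTI; apply: open_measurable_mx.
by apply: open_comp => [x _|]; [exact: coord_continuous|exact: interval_open].
Qed.

Lemma measurable_row_uncons n : measurable_fun setT (@row_uncons n).
Proof.
apply/measurable_fun_pairP; split; first exact: measurable_coord.
apply: measurability => //.
move=> _ [A oA <-]; rewrite setTI; apply: open_measurable_mx.
apply: open_comp => // x _ /= P /nbhs_ballP[e /= e0 eP].
apply/nbhs_ballP; exists e => //= y [_ xy]; apply: eP.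
by split=> // i j; rewrite !mxE.
Qed.

End borel_rV.

Section lebesgue_cons.
Context {R : realType} (n : nat).
Variable m : {sigma_finite_measure set 'rV[R]_n -> \bar R}.

Definition lebesgue_cons : set 'rV[R]_n.+1 -> \bar R :=
  pushforward (@lebesgue_measure R \x m)%E (@row_cons R n).

Let lebesgue_cons0 : lebesgue_cons set0 = 0%E.
Proof. by rewrite /lebesgue_cons /pushforward preimage_set0 measure0. Qed.

Let lebesgue_cons_ge0 A : (0 <= lebesgue_cons A)%E.
Proof. by rewrite /lebesgue_cons /pushforward measure_ge0. Qed.

Let lebesgue_cons_sigma_additive : semi_sigma_additive lebesgue_cons.
Proof.
have mf A : measurable A -> measurable (@row_cons R n @^-1` A).
  by move=> mA; rewrite -[X in measurable X]setTI; exact: measurable_row_cons.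
move=> F mF tF mUF; rewrite /lebesgue_cons /pushforward preimage_bigcup.
apply: measure_semi_sigma_additive => [k||].
- exact: mf.
- apply/trivIsetP => /= i j _ _ ij; rewrite -preimage_setI.
  by move/trivIsetP : tF => /(_ _ _ _ _ ij) ->//; rewrite preimage_set0.
- by rewrite -preimage_bigcup; exact: mf.
Qed.

HB.instance Definition _ := isMeasure.Build _ _ _ lebesgue_cons
  lebesgue_cons0 lebesgue_cons_ge0 lebesgue_cons_sigma_additive.

Let lebesgue_cons_sigma_finite : sigma_finite setT lebesgue_cons.
Proof.
have [F TF Foo] : sigma_finite setT (@lebesgue_measure R \x m)%E.
  exact: isSigmaFinite.sigma_finiteT
    (lebesgue_integral_fubini.measure_function_Measure_isSigmaFinite__to__measure_function_isSigmaFinite _ m).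
exists (fun k => @row_uncons R n @^-1` F k).
  by rewrite -preimage_bigcup -TF preimage_setT.
move=> k; have [mF Fk] := Foo k; split.
  by rewrite -[X in measurable X]setTI; exact: measurable_row_uncons.
rewrite /lebesgue_cons /pushforward -comp_preimage (_ : _ \o _ = id)//.
by apply/funext => z /=; rewrite row_consK.
Qed.

HB.instance Definition _ := Measure_isSigmaFinite.Build _ _ _ lebesgue_cons
  lebesgue_cons_sigma_finite.

End lebesgue_cons.

(* Lebesgue measure on the Borel sets of R^n, as an iterated product. *)
Fixpoint lebesgue_measure_rV (R : realType) (n : nat) :
    {sigma_finite_measure set 'rV[R]_n -> \bar R} :=
  if n is n'.+1 then lebesgue_cons (lebesgue_measure_rV R n')
  else dirac (0 : 'rV[R]_0).

Lemma lebesgue_measure_rV_box (R : realType) (n : nat) (a b : 'rV[R]_n) :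
  (forall i, a 0 i <= b 0 i) ->
  lebesgue_measure_rV R n [set x | forall i, x 0 i \in `[a 0 i, b 0 i]] =
  (\prod_i (b 0 i - a 0 i))%:E.
Proof.
elim: n a b => [|n IHn] a b ab.
  by rewrite big_ord0 /= diracE mem_set// => -[].
have mB : measurable [set x : 'rV[R]_n |
    forall i, x 0 i \in `[a 0 (rshift 1 i), b 0 (rshift 1 i)]].
  rewrite [X in measurable X](_ : _ = \bigcap_(i in [set: 'I_n])
      ((fun x : 'rV[R]_n => x 0 i) @^-1`
       [set` `[a 0 (rshift 1 i), b 0 (rshift 1 i)]])); last first.
    by apply/seteqP; split => [x xi i _|x xi i]; [exact: xi|exact: (xi i I)].
  apply: fin_bigcap_measurable; first exact: finite_finset.
  move=> i _; rewrite -[X in measurable X]setTI.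
  by apply: measurable_coord => //; exact: measurable_itv.
have E : @row_cons R n @^-1` [set x | forall i, x 0 i \in `[a 0 i, b 0 i]] =
    [set` `[a 0 0, b 0 0]] `*` [set x : 'rV[R]_n |
      forall i, x 0 i \in `[a 0 (rshift 1 i), b 0 (rshift 1 i)]].
  apply/seteqP; split => [[t v] tv|[t v] [/= t0 vi] i].
    split=> [|i] /=; first by have := tv 0; rewrite row_consE0.
    by have := tv (rshift 1 i); rewrite row_consES.
  case: (split_ordP (i : 'I_(1 + n))) => k ->; last by rewrite row_consES.
  have -> : lshift n k = 0 :> 'I_n.+1 by rewrite ord1; exact: val_inj.
  by rewrite row_consE0.
rewrite /= /lebesgue_cons /pushforward E product_measure1E//.
rewrite big_ord_recl EFinM; congr (_ * _)%E.
  apply: etrans (lebesgue_measure_itv _) _; rewrite /= lte_fin.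
  have := ab 0; rewrite le_eqVlt => /predU1P[->|->//].
  by rewrite ltxx subrr.
pose a' := \row_i a 0 (rshift 1 i); pose b' := \row_i b 0 (rshift 1 i).
have -> : [set x : 'rV[R]_n |
      forall i, x 0 i \in `[a 0 (rshift 1 i), b 0 (rshift 1 i)]] =
    [set x | forall i, x 0 i \in `[a' 0 i, b' 0 i]].
  by apply/seteqP; split => x xi i; have := xi i; rewrite !mxE.
rewrite IHn => [|i]; last by rewrite !mxE.
congr (_%:E); apply: eq_bigr => i _; rewrite !mxE.
by have -> : rshift 1 i = lift ord0 i by exact: val_inj.
Qed.

Section domains.
Context {R : realType} {d : nat}.
Local Notation E := 'rV[R]_d.
Local Notation leb := (lebesgue_measure_rV R d).

(* The library norm on 'rV[R]_d is the max norm. *)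
Definition enorm (x : E) : R := Num.sqrt (\sum_i x 0 i ^+ 2).

(* Near every boundary point, in suitable orthonormal coordinates y *m Q, the
   set is the strict epigraph, in the i0-th coordinate, of a Lipschitz function
   of the d - 1 other coordinates. *)
Definition lipschitz_boundary (D : set E) : Prop :=
  forall x, (closure D `&` closure (~` D)) x ->
  exists (Q : 'M[R]_d) (i0 : 'I_d) (g : 'rV[R]_d.-1 -> R) (r : R),
    [/\ Q *m Q^T = 1%:M, lipschitz g, 0 < r &
      forall y, enorm (y - x) < r ->
        D y <-> g (col' i0 (y *m Q)) < (y *m Q) 0 i0].

Record lipschitz_domain := LipschitzDomain {
  domain :> set E ;
  domain_open : open domain ;
  domain_connected : connected domain ;
  domain_nonempty : domain !=set0 ;
  domain_bounded : bounded_set domain ;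
  domain_lipschitz : lipschitz_boundary domain }.

Definition leb_on (D : set E) (oD : open D) : {measure set E -> \bar R} :=
  mrestr leb (open_measurable_mx oD).

Fixpoint Ck (k : nat) (f : E -> R) : Prop :=
  continuous f /\
  if k is k'.+1 then
    forall i, (forall x, derivable f x (delta_mx 0 i)) /\
              Ck k' ('D_(delta_mx 0 i) f)
  else True.

(* C_c^infty(D). *)
Definition test_function (D : set E) (psi : E -> R) : Prop :=
  [/\ forall k, Ck k psi,
      compact (closure [set x | psi x != 0]) &
      closure [set x | psi x != 0] `<=` D].

End domains.
Arguments lipschitz_domain : clear implicits.
Arguments domain_open {R d} _.

(* Elements of L^2(D), H^s(D), etc. are represented by functions that are Borel
   on the whole of R^d; only their values on D matter (on all of R^d for
   [Hs_tilde] below). *)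
Section sobolev.
Context {R : realType} {d : nat}.
Local Notation E := 'rV[R]_d.
Local Notation leb := (lebesgue_measure_rV R d).

Definition Gamma (z : R) : R :=
  \int[lebesgue_measure]_(t in `]0, +oo[) (t `^ (z - 1) * expR (- t)).

Definition c_ds (s : R) : R :=
  s * 2 `^ (2 * s) * Gamma (s + d%:R / 2) /
  (pi `^ (d%:R / 2) * Gamma (1 - s)).

(* On the diagonal x = y the kernel is 0 / 0 = 0; the diagonal is null. *)
Definition in_Hs (s : R) (D : set E) (oD : open D) (w : E -> R) : Prop :=
  w \in Lfun (leb_on oD) 2%:E /\
  (\int[leb]_(x in D) \int[leb]_(y in D)
     (`|w x - w y| ^+ 2 / enorm (x - y) `^ (d%:R + 2 * s))%:E < +oo)%E.

Definition dot_Hs (s : R) (D : set E) (u w : E -> R) : R :=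
  \int[leb]_(x in D) (u x * w x) +
  c_ds s / 2 * \int[leb]_(x in D) \int[leb]_(y in D)
    ((u x - u y) * (w x - w y) / enorm (x - y) `^ (d%:R + 2 * s)).

(* G is the weak gradient of v on D. *)
Definition weak_gradient (D : set E) (v : E -> R) (G : 'I_d -> E -> R) : Prop :=
  forall i psi, test_function D psi ->
    \int[leb]_(x in D) (v x * 'D_(delta_mx 0 i) psi x) =
    - \int[leb]_(x in D) (G i x * psi x).

(* v is in H^1_0(D), the H^1(D)-closure of C_c^infty(D), with gradient G. *)
Definition in_H10 (D : set E) (oD : open D) (v : E -> R)
    (G : 'I_d -> E -> R) : Prop :=
  [/\ v \in Lfun (leb_on oD) 2%:E,
      forall i, G i \in Lfun (leb_on oD) 2%:E,
      weak_gradient D v G &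
      forall e : R, 0 < e -> exists2 psi, test_function D psi &
        ('N[leb_on oD]_2%:E[EFin \o (v \- psi)%R] +
         \sum_(i < d)
           'N[leb_on oD]_2%:E[EFin \o (G i \- 'D_(delta_mx 0 i) psi)%R] < e%:E)%E].

(* - Laplace v = lam v in D, v = 0 on the boundary of D. *)
Definition dirichlet_eigen (D : set E) (oD : open D) (v : E -> R) (lam : R) :=
  exists2 G, in_H10 oD v G &
    forall psi, test_function D psi ->
      \sum_(i < d) \int[leb]_(x in D) (G i x * 'D_(delta_mx 0 i) psi x) =
      lam * \int[leb]_(x in D) (v x * psi x).

(* Complete L^2(D)-orthonormal system of Dirichlet eigenfunctions. *)
Definition dirichlet_eigenbasis (D : set E) (oD : open D)
    (phi : nat -> E -> R) (lam : nat -> R) : Prop :=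
  [/\ forall n, dirichlet_eigen oD (phi n) (lam n),
      forall m n, \int[leb]_(x in D) (phi m x * phi n x) = (m == n)%:R &
      forall v, v \in Lfun (leb_on oD) 2%:E ->
        (forall n, \int[leb]_(x in D) (v x * phi n x) = 0) ->
        v = cst 0 %[ae leb_on oD]].

Inductive frac_space :=
  | Hs
  | Hs_zero
  | Hs_tilde
  | Hs_spectral of (nat -> E -> R) & (nat -> R).

Variables (s : R) (Omega : lipschitz_domain R d).
Let oO : open Omega := domain_open Omega.

Definition frac_space_wf (W : frac_space) : Prop :=
  if W is Hs_spectral phi lam then dirichlet_eigenbasis oO phi lam else True.

Definition coef (phi : nat -> E -> R) (w : E -> R) (n : nat) : R :=
  \int[leb]_(x in Omega) (w x * phi n x).

Definition dotW (W : frac_space) (u w : E -> R) : R :=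
  match W with
  | Hs | Hs_zero => dot_Hs s Omega u w
  | Hs_tilde => dot_Hs s setT u w
  | Hs_spectral phi lam =>
      limn (series (fun n => lam n `^ s * coef phi u n * coef phi w n))
  end.

Definition normW (W : frac_space) (w : E -> R) : R := Num.sqrt (dotW W w w).

Definition in_W (W : frac_space) (w : E -> R) : Prop :=
  match W with
  | Hs => in_Hs s oO w
  | Hs_zero => in_Hs s oO w /\
      forall e : R, 0 < e ->
        exists2 psi, test_function Omega psi & normW Hs (w \- psi) < e
  | Hs_tilde => in_Hs s openT w /\ {ae leb, forall x, ~ domain Omega x -> w x = 0}
  | Hs_spectral phi lam => w \in Lfun (leb_on oO) 2%:E /\
      (\sum_(0 <= n <oo) (lam n `^ s * coef phi w n ^+ 2)%:E < +oo)%E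
  end.

Definition embedded_in_Lq (W : frac_space) (q : R) : Prop :=
  exists C : R, forall w, in_W W w ->
    w \in Lfun (leb_on oO) q%:E /\
    ('N[leb_on oO]_q%:E[EFin \o w] <= (C * normW W w)%:E)%E.

End sobolev.
Arguments frac_space : clear implicits.

Section control_space.
Context {R : realType} {d : nat} (T : R) (Omega : lipschitz_domain R d).
Local Notation E := 'rV[R]_d.

Definition leb_I : {measure set (measurableTypeR R) -> \bar R} :=
  mrestr lebesgue_measure (measurable_itv `]0, T[).

Definition leb_IO : {measure set (measurableTypeR R * E) -> \bar R} :=
  mrestr (lebesgue_measure \x lebesgue_measure_rV R d)%E
    (measurableX (measurable_itv `]0, T[)
                 (open_measurable_mx (domain_open Omega))).

(* L^2(I x Omega); its elements are functions, not classes. *)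
Definition L2U := LfunType leb_IO (lee1n 2).

Definition dotU (u v : L2U) : R := \int[leb_IO]_z (u z * v z).

Definition normU (u : L2U) : R := fine ('N[leb_IO]_2%:E[EFin \o u])%E.

Definition ae_invariant (f : L2U -> R) : Prop :=
  forall u v : L2U, (u : _ -> _) = v %[ae leb_IO] -> f u = f v.

Definition weakly_lsc (f : L2U -> R) : Prop :=
  forall (v : nat -> L2U) (u : L2U),
    (forall g : L2U, dotU g (v n) @[n --> \oo] --> dotU g u) ->
    ((f u)%:E <= limn_einf (fun n => (f (v n))%:E))%E.

Definition affinely_minorized (f : L2U -> R) : Prop :=
  exists (g : L2U) (c : R), forall u, dotU g u + c <= f u.

(* f is Frechet differentiable on L^2(I x Omega), with f' u the Riesz
   representative of its derivative at u, and f' is continuous. *)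
Definition frechet_C1 (f : L2U -> R) (f' : L2U -> L2U) : Prop :=
  (forall (u : L2U) (e : R), 0 < e -> exists2 delta : R, 0 < delta &
     forall h : L2U, normU h <= delta ->
       `|f (u + h) - f u - dotU (f' u) h| <= e * normU h) /\
  (forall (u : L2U) (e : R), 0 < e -> exists2 delta : R, 0 < delta &
     forall v : L2U, normU (v - u) <= delta -> normU (f' v - f' u) <= e).

End control_space.

Section problem.
Context {R : realType} {d : nat} (T s : R) (Omega : lipschitz_domain R d).
Variables (W : frac_space R d) (f : L2U T Omega -> R) (alpha beta gamma p : R).
Local Notation E := 'rV[R]_d.

Definition admissible (u : L2U T Omega) (w : E -> R) : Prop :=
  in_W s Omega W w /\ {ae leb_IO T Omega, forall z, `|u z| <= w z.2}.

Definition Phi0 (u : L2U T Omega) (w : E -> R) : R :=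
  f u + alpha / 2 * normU u ^+ 2 + beta / 2 * normW s Omega W w ^+ 2 +
  gamma * \int[lebesgue_measure_rV R d]_(x in Omega) (`|w x| `^ p).

Definition local_solution (ubar : L2U T Omega) (wbar : E -> R) : Prop :=
  admissible ubar wbar /\
  exists2 rho : R, 0 < rho &
    forall (u : L2U T Omega) (w : E -> R), admissible u w ->
      normU (u - ubar) <= rho -> normW s Omega W (w \- wbar) <= rho ->
      Phi0 ubar wbar <= Phi0 u w.

End problem.

(* Main.v *)
(* Stampacchia truncation. For k >= 0 let z = (wbar - k)^+ and compare the local
   solution with (ubar - t v, wbar - t z), t -> 0+, where v = (z / wbar) ubar; the
   pair is admissible, and the terms in |u|^2 and |w|^p do not increase. The key
   fact on each of the four spaces is that z belongs to W and
     |wbar - t z|_W^2 + (2 t - t^2) |z|_W^2 <= |wbar|_W^2.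
   Hence beta/2 |z|_W^2 <= |(f'(ubar), v)| <= int z F with F(x) = |f'(ubar)(.,x)|_L1.
   By the embedding into L^q and Hoelder's inequality |z|_q <= C m(k)^(1-1/r-1/q),
   m(k) being the measure of {wbar > k}; with Chebyshev's inequality
   (h - k) m(h)^(1/q) <= C (m(k)^(1/q))^b for h > k, where b = q (1 - 1/r) - 1 > 1,
   and so m vanishes from some level on.

   For the Gagliardo norms the key fact is a pointwise inequality. For the closure
   of the test functions one composes with smooth approximations of (. - k)^+. For
   the spectral norm, lam^s is, up to a constant, the integral over y > 0 of
   lam / (lam + y^(1/s)), and mu sum_n lam_n w_n^2 / (lam_n + mu) is the infimum over
   test functions psi of |grad psi|^2 + mu |w - psi|^2, to which truncation applies. *)

Require Import Defs.
From HB Require Import structures.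
From mathcomp Require Import all_boot all_order all_algebra.
From mathcomp Require Import all_classical all_reals all_analysis.
From mathcomp Require Import measurable_realfun ess_sup_inf ring lra.

Set Implicit Arguments.
Unset Strict Implicit.
Unset Printing Implicit Defensive.

Import Order.TTheory GRing.Theory Num.Theory.
Import numFieldNormedType.Exports.

Local Open Scope classical_set_scope.
Local Open Scope ring_scope.

(** For p < 1 the term |w|^p is neither convex nor differentiable at 0, so no derivative of it may
    enter. This dictates the competitor: ubar and wbar are multiplied by the same factor 1 - t
    z/wbar in [0,1], which keeps the constraint and lowers |u| and |w| pointwise. All the gain then
    has to come from the norm of W. The key fact encodes (wbar, z) >= (z, z), but in squares only:
    the cross term is never formed, and on each space one compares integrals or series of
    nonnegative terms. Since 2t - t^2 >= t for t <= 1, a single small t can be cancelled and leaves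
    beta/2. Truncation acts on values, whereas the spectral norm sees coefficients. The infimum
    formula joins the two: a competitor psi for wbar yields the competitors psi - t (psi - k)^+ for
    wbar - t z and (psi - k)^+ for z, up to smoothing. The exponent 2/q has two sources: one 1/q is
    lost when z is paired with F over {wbar > k}, the other is the Chebyshev exponent. The iteration
    is superlinear when 1 - 1/r - 1/q > 1/q. *)

(** * Integrals against restricted and product measures *)

Section restriction.
Context d (T : measurableType d) (R : realType).
Variables (mu : {measure set T -> \bar R}) (D : set T) (mD : measurable D).
Local Open Scope ereal_scope.

Lemma mrestrC0 : mrestr mu mD (~` D) = 0.
Proof. by rewrite /mrestr setICl measure0. Qed.

(** Off [D] the restricted measure vanishes, and on subsets of [D] it agrees with [mu]. Both forms
    occur: L^p norms are taken against the restricted measure, scalar products integrate over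
    [D]. *)
Lemma integral_mrestr (f : T -> \bar R) : measurable_fun setT f ->
  \int[mrestr mu mD]_x f x = \int[mu]_(x in D) f x.
Proof.
move=> mf.
have ge0E g : measurable_fun setT g -> (forall x, 0 <= g x) ->
    \int[mrestr mu mD]_x g x = \int[mu]_(x in D) g x.
  move=> mg g0.
  rewrite (ge0_negligible_integral (measurableC mD) _ _ _ mrestrC0)//.
  rewrite setTD setCK; apply: eq_measure_integral => A mA AD.
  by rewrite /mrestr; congr (mu _); exact/setIidl.
rewrite [LHS]integralE [RHS]integralE !ge0E//.
- exact: measurable_funeneg.
- exact: measurable_funepos.
Qed.

End restriction.

Section iterated.
Context d1 d2 (T1 : measurableType d1) (T2 : measurableType d2) (R : realType).
Variable m1 : {sigma_finite_measure set T1 -> \bar R}.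
Variable m2 : {sigma_finite_measure set T2 -> \bar R}.
Variables (A : set T1) (B : set T2).
Hypotheses (mA : measurable A) (mB : measurable B).
Variable f : T1 * T2 -> \bar R.
Hypotheses (mf : measurable_fun setT f) (f0 : forall z, (0 <= f z)%E).
Local Open Scope ereal_scope.

Let g := f \_ (A `*` B).

Let mg : measurable_fun setT g.
Proof.
by apply/(measurable_restrictT _ (measurableX mA mB)); exact: measurable_funTS.
Qed.

Let g0 z : 0 <= g z.
Proof. by rewrite /g patchE; case: ifPn. Qed.

Let gE x : (\int[m2]_y g (x, y)) = ((fun x => \int[m2]_(y in B) f (x, y)) \_ A) x.
Proof.
rewrite [RHS]patchE; case: ifPn => xA.
  rewrite [RHS]integral_mkcond; apply: eq_integral => y _.
  by rewrite /g !patchE in_setX xA.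
by apply: integral0_eq => y _; rewrite /g patchE in_setX (negbTE xA).
Qed.

(** Tonelli for the extension of [f] by zero off A x B. It makes the iterated Gagliardo seminorm a
    single integral over a product, where pointwise inequalities can be integrated at once. *)
Lemma iterated_integralE :
  \int[m1]_(x in A) \int[m2]_(y in B) f (x, y) =
  \int[m1 \x m2]_(z in A `*` B) f z.
Proof.
rewrite [RHS]integral_mkcond -/g (fubini_tonelli1 _ mg g0).
by rewrite integral_mkcond; apply: eq_integral => x _; rewrite -gE.
Qed.

Lemma measurable_section_integral :
  measurable_fun A (fun x => \int[m2]_(y in B) f (x, y)).
Proof.
apply/(measurable_restrictT _ mA).
rewrite [X in measurable_fun _ X](_ : _ = fubini_F m2 g).
  exact: measurable_fun_fubini_tonelli_F.
by apply/funext => x; rewrite /fubini_F gE.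
Qed.

End iterated.

Lemma measurable_continuous_mx (R : realType) m n (f : 'M[R]_(m, n) -> R) :
  continuous f -> measurable_fun setT f.
Proof.
move=> cf; apply: (measurability _ (RGenOpens.measurableE R)).
move=> _ [_ [a [b ->] <-]]; rewrite setTI; apply: open_measurable_mx.
by apply: open_comp => [x _|]; [exact: cf|exact: interval_open].
Qed.

Section LfunE.
Context d (T : measurableType d) (R : realType).
Variable mu : {measure set T -> \bar R}.

Lemma LfunE (p : R) (f : T -> R) : p != 0 ->
  f \in Lfun mu p%:E <->
  measurable_fun setT f /\ (\int[mu]_x (`|f x| `^ p)%:E < +oo)%E.
Proof.
move=> p0; rewrite inE /=.
have E : (\int[mu]_x (`|f x| `^ p)%:E = 'N[mu]_p%:E[EFin \o f] `^ p)%E.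
  by rewrite poweR_Lnorm//; apply: eq_integral => x _ /=; rewrite poweR_EFin.
split.
  move=> /andP[mf Nf]; move: mf Nf; rewrite !inE/= /finite_norm => mf Nf; split => //.
  by rewrite E poweR_lty.
move=> [mf fy]; apply/andP; split; rewrite inE//=.
rewrite /finite_norm.
by apply: (lty_poweRy p0); rewrite -E.
Qed.

Lemma Lfun2E (f : T -> R) : f \in Lfun mu 2%:E <->
  measurable_fun setT f /\ (\int[mu]_x (f x ^+ 2)%:E < +oo)%E.
Proof.
rewrite LfunE//; under eq_integral do rewrite powR_mulrn// real_normK ?num_real//.
by [].
Qed.

End LfunE.

Lemma Lnorm2_sqr d (T : measurableType d) (R : realType)
    (mu : {measure set T -> \bar R}) (f : T -> R) :
  ('N[mu]_2%:E[EFin \o f] `^ 2 = \int[mu]_x (f x ^+ 2)%:E)%E.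
Proof.
rewrite poweR_Lnorm//; apply: eq_integral => x _ /=.
by rewrite powR_mulrn// real_normK ?num_real.
Qed.

(** * Truncation of real numbers *)

Definition excess {R : realType} (k x : R) : R := Num.max (x - k) 0.

Section excess.
Context {R : realType}.
Implicit Types k x y t a b : R.

Lemma excess_ge0 k x : 0 <= excess k x.
Proof. by rewrite /excess le_max lexx orbT. Qed.

Lemma excess_le_norm k x : 0 <= k -> excess k x <= `|x|.
Proof.
by move=> k0; rewrite /excess ge_max normr_ge0 andbT; have := ler_norm x; lra.
Qed.

(** The excess is nondecreasing and 1-Lipschitz: its increment has the sign of x - y and is no
    larger. All later truncation estimates rest on this. *)
Lemma excess_sqr_le k x y :
  (excess k x - excess k y) ^+ 2 <= (x - y) * (excess k x - excess k y).
Proof.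
rewrite /excess; case: (leP (x - k) 0) => ?; case: (leP (y - k) 0) => ?; nra.
Qed.

Lemma excess_lipschitz k x y : `|excess k x - excess k y| <= `|x - y|.
Proof.
rewrite /excess; case: (leP (x - k) 0) => ?; case: (leP (y - k) 0) => ?;
  do 2 case: ler0P => ?; lra.
Qed.

(** The left side equals a^2 - 2t (ab - b^2); this is where the coefficient 2t - t^2 comes from. *)
Lemma sqr_sub_excess a b t : 0 <= t -> b ^+ 2 <= a * b ->
  (a - t * b) ^+ 2 + (2 * t - t ^+ 2) * b ^+ 2 <= a ^+ 2.
Proof. move=> t0 ab; nra. Qed.

Lemma measurable_excess d (T : measurableType d) k (f : T -> R) :
  measurable_fun setT f -> measurable_fun setT (fun z => excess k (f z)).
Proof.
move=> mf; apply: measurable_maxr => //; exact: measurable_funB.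
Qed.

End excess.

(** * Weighted squares and the Gagliardo form *)

Section weighted_square.
Context d (T : measurableType d) (R : realType).
Variables (mu : {measure set T -> \bar R}) (D : set T) (mD : measurable D).
Variable kap : T -> R.
Implicit Types a b : T -> R.
Hypotheses (mkap : measurable_fun setT kap) (kap0 : forall x, 0 <= kap x).

(** One notion for both parts of the H^s norm: weight 1 on [D] gives the L^2 part, and the singular
    kernel on D x D, applied to u x - u y, gives the seminorm. *)
Definition wsq (a : T -> R) : \bar R := (\int[mu]_(x in D) (a x ^+ 2 * kap x)%:E)%E.

Lemma wsq_ge0 a : (0 <= wsq a)%E.
Proof. by apply: integral_ge0 => x _; rewrite lee_fin mulr_ge0// sqr_ge0. Qed.

Lemma measurable_wsq a : measurable_fun setT a ->
  measurable_fun setT (fun x => (a x ^+ 2 * kap x)%:E).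
Proof.
move=> ma; apply/measurable_EFinP; apply: measurable_funM => //.
exact: measurable_funX.
Qed.

Lemma le_wsq a b : measurable_fun setT a -> measurable_fun setT b ->
  (forall x, a x ^+ 2 <= b x ^+ 2) -> (wsq a <= wsq b)%E.
Proof.
move=> ma mb ab; apply: ge0_le_integral => //.
- by move=> x _; rewrite lee_fin mulr_ge0// sqr_ge0.
- exact/measurable_funTS/measurable_wsq.
- exact/measurable_funTS/measurable_wsq.
- by move=> x _; rewrite lee_fin ler_wpM2r.
Qed.

Lemma wsqZ c a : measurable_fun setT a ->
  wsq (fun x => c * a x) = ((c ^+ 2)%:E * wsq a)%E.
Proof.
move=> ma; rewrite /wsq -ge0_integralZl_EFin ?sqr_ge0//.
- by apply: eq_integral => x _; rewrite -EFinM mulrA exprMn.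
- by move=> x _; rewrite lee_fin mulr_ge0// sqr_ge0.
- exact/measurable_funTS/measurable_wsq.
Qed.

Lemma wsqDl a b c : measurable_fun setT a -> measurable_fun setT b ->
  0 <= c ->
  (wsq a + c%:E * wsq b =
   \int[mu]_(x in D) ((a x ^+ 2 + c * b x ^+ 2) * kap x)%:E)%E.
Proof.
move=> ma mb c0; rewrite /wsq -ge0_integralZl_EFin//; last 2 first.
  by move=> x _; rewrite lee_fin mulr_ge0// sqr_ge0.
  exact/measurable_funTS/measurable_wsq.
rewrite -ge0_integralD//.
- by apply: eq_integral => x _; rewrite -EFinM -EFinD mulrDl mulrA.
- by move=> x _; rewrite lee_fin mulr_ge0// sqr_ge0.
- exact/measurable_funTS/measurable_wsq.
- by move=> x _; rewrite lee_fin mulr_ge0// mulr_ge0// sqr_ge0.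
- apply: measurable_funeM; exact/measurable_funTS/measurable_wsq.
Qed.

Lemma wsqD a b : measurable_fun setT a -> measurable_fun setT b ->
  (wsq (fun x => (a x + b x)%R) <= 2%:E * (wsq a + wsq b))%E.
Proof.
move=> ma mb; rewrite -[X in (_ + X)%E]mul1e (wsqDl ma mb)//.
rewrite -ge0_integralZl_EFin//; last 2 first.
- by move=> x _; rewrite lee_fin mulr_ge0// addr_ge0 ?sqr_ge0// mulr_ge0// sqr_ge0.
- apply: measurable_funTS; apply/measurable_EFinP; apply: measurable_funM => //.
  apply: measurable_funD; first exact: measurable_funX.
  apply: measurable_funM => //; exact: measurable_funX.
apply: ge0_le_integral => //.
- by move=> x _; rewrite lee_fin mulr_ge0// sqr_ge0.
- exact/measurable_funTS/measurable_wsq/measurable_funD.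
- apply: measurable_funTS; apply/measurable_EFinP; apply: measurable_funM => //.
  apply: measurable_funM => //.
  apply: measurable_funD; first exact: measurable_funX.
  apply: measurable_funM => //; exact: measurable_funX.
- move=> x _; rewrite -EFinM lee_fin mulrA ler_wpM2r//.
  by have := sqr_ge0 (a x - b x); nra.
Qed.

(** [sqr_sub_excess] integrated. Both squares stay on the left, with a coefficient that is
    nonnegative for t in [0,1], so that no extended reals are subtracted. *)
Lemma wsq_excess a b t : measurable_fun setT a -> measurable_fun setT b ->
  0 <= t <= 1 -> (forall x, b x ^+ 2 <= a x * b x) ->
  (wsq (fun x => (a x - t * b x)%R) + (2 * t - t ^+ 2)%:E * wsq b <= wsq a)%E.
Proof.
move=> ma mb /andP[t0 t1] ab.
have m1 : measurable_fun setT (fun x => a x - t * b x).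
  by apply: measurable_funB => //; apply: measurable_funM.
have t2 : 0 <= 2 * t - t ^+ 2 by nra.
rewrite (wsqDl m1 mb)//; apply: ge0_le_integral => //.
- by move=> x _; rewrite lee_fin mulr_ge0// addr_ge0 ?sqr_ge0// mulr_ge0// sqr_ge0.
- apply: measurable_funTS; apply/measurable_EFinP; apply: measurable_funM => //.
  apply: measurable_funD; first exact: measurable_funX.
  apply: measurable_funM => //; exact: measurable_funX.
- exact/measurable_funTS/measurable_wsq.
- by move=> x _; rewrite lee_fin ler_wpM2r// sqr_sub_excess.
Qed.

End weighted_square.

Section gagliardo.
Context {R : realType} {d : nat} (s : R).
Local Notation E := 'rV[R]_d.
Local Notation leb := (lebesgue_measure_rV R d).
Implicit Types (D : set E) (u w : E -> R).

Definition gker (z : E * E) : R := (enorm (z.1 - z.2) `^ (d%:R + 2 * s))^-1.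

Definition pdiff u (z : E * E) : R := u z.1 - u z.2.

Definition gagl D u : \bar R := wsq (leb \x leb)%E (D `*` D) gker (pdiff u).

Definition sqnorm D u : \bar R := wsq leb D (cst 1) u.

Lemma gker_ge0 z : 0 <= gker z.
Proof. by rewrite invr_ge0 powR_ge0. Qed.

Lemma measurable_gker : measurable_fun setT gker.
Proof.
rewrite /gker; under eq_fun do rewrite -powRN.
apply: (measurableT_comp (measurable_powR _)).
apply: (measurableT_comp (f := @Num.sqrt R)).
  by apply: continuous_measurable_fun; exact: sqrt_continuous.
apply: measurable_sum => i; apply: measurable_funX.
under eq_fun do rewrite !mxE.
by apply: measurable_funB; apply: (measurableT_comp (measurable_coord i)).
Qed.

Lemma measurable_pdiff u : measurable_fun setT u -> measurable_fun setT (pdiff u).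
Proof.
by move=> mu; apply: measurable_funB; apply: measurableT_comp.
Qed.

Hint Resolve gker_ge0 measurable_gker : core.

Lemma gaglE D u : open D -> measurable_fun setT u ->
  (\int[leb]_(x in D) \int[leb]_(y in D)
     (`|u x - u y| ^+ 2 / enorm (x - y) `^ (d%:R + 2 * s))%:E)%E = gagl D u.
Proof.
move=> oD mu.
have mD : measurable D by exact: open_measurable_mx.
rewrite /gagl /wsq -(iterated_integralE _ _ mD mD); last 2 first.
- by apply: measurable_wsq => //; exact: measurable_pdiff.
- by move=> z; rewrite lee_fin mulr_ge0// sqr_ge0.
apply: eq_integral => x _; apply: eq_integral => y _.
by rewrite real_normK// num_real.
Qed.

Lemma in_HsP D (oD : open D) w : in_Hs s oD w <->
  [/\ measurable_fun setT w, (sqnorm D w < +oo)%E & (gagl D w < +oo)%E].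
Proof.
have E2 (mw : measurable_fun setT w) :
    (\int[leb_on oD]_x (w x ^+ 2)%:E)%E = sqnorm D w.
  rewrite integral_mrestr; last first.
    by apply/measurable_EFinP; exact: measurable_funX.
  by apply: eq_integral => x _; rewrite mulr1.
rewrite /in_Hs; split.
  by move=> [/Lfun2E[mw wy]]; rewrite gaglE// => gw; split=> //; rewrite -E2.
by move=> [mw wy gw]; rewrite gaglE//; split => //; apply/Lfun2E; rewrite E2.
Qed.

(** In [dot_Hs] the inner integral is a real number, hence 0 wherever the true one is infinite.
    Finiteness of the seminorm confines this to a null set of x, so the outer integral does not
    change. *)
Lemma dot_HsE D (oD : open D) w : in_Hs s oD w ->
  dot_Hs s D w w = fine (sqnorm D w) + @c_ds R d s / 2 * fine (gagl D w).
Proof.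
move=> /in_HsP[mw wy gw]; congr (_ + _ * _).
  by congr fine; apply: eq_integral => x _; rewrite mulr1.
have mD : measurable D by exact: open_measurable_mx.
pose F x := (\int[leb]_(y in D) (pdiff w (x, y) ^+ 2 * gker (x, y))%:E)%E.
have mz : measurable_fun setT (fun z => (pdiff w z ^+ 2 * gker z)%:E).
  by apply: measurable_wsq => //; exact: measurable_pdiff.
have z0 (z : E * E) : (0 <= (pdiff w z ^+ 2 * gker z)%:E)%E.
  by rewrite lee_fin mulr_ge0// sqr_ge0.
have FE : (\int[leb]_(x in D) F x)%E = gagl D w.
  by rewrite /F (iterated_integralE _ _ mD mD mz).
have mF : measurable_fun D F by exact: (measurable_section_integral _ mD mD mz).
have F0 x : (0 <= F x)%E by exact: integral_ge0.
have Fint : leb.-integrable D F.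
  apply/integrableP; split => //.
  by under eq_integral do rewrite gee0_abs//; rewrite FE.
have Ffin := integrable_ae mD Fint.
rewrite -FE; transitivity (Rintegral leb D (fun x => fine (F x))).
  apply: eq_Rintegral => x _; congr fine; apply: eq_integral => y _.
congr fine.
apply: ae_eq_integral => //.
  by apply/measurable_EFinP; apply: measurableT_comp.
apply: filterS Ffin => x Fx Dx; by rewrite fineK// Fx.
Qed.

Lemma c_ds_ge0 : 0 < s -> 0 <= @c_ds R d s.
Proof.
move=> s0; have G0 z : 0 <= Gamma z :> R.
  by apply: Rintegral_ge0 => t _; rewrite mulr_ge0 ?powR_ge0 ?expR_ge0.
by rewrite /c_ds !mulr_ge0// ?powR_ge0 ?(ltW s0)// invr_ge0 mulr_ge0 ?powR_ge0.
Qed.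

Lemma dot_Hs_ge0 D (oD : open D) w : 0 < s -> in_Hs s oD w -> 0 <= dot_Hs s D w w.
Proof.
move=> s0 Hw; rewrite (dot_HsE Hw).
have c0 : 0 <= @c_ds R d s / 2 by rewrite mulr_ge0 ?c_ds_ge0.
by rewrite addr_ge0// ?(mulr_ge0 c0)//; apply: fine_ge0; apply: wsq_ge0.
Qed.

Section closure.
Variables (D : set E) (oD : open D).
Let mD : measurable D := open_measurable_mx oD.
Let mDD : measurable (D `*` D) := measurableX mD mD.

Lemma sqnorm_fin u : in_Hs s oD u -> sqnorm D u \is a fin_num.
Proof. by case/in_HsP => *; rewrite ge0_fin_numE//; exact: wsq_ge0. Qed.

Lemma gagl_fin u : in_Hs s oD u -> gagl D u \is a fin_num.
Proof. by case/in_HsP => *; rewrite ge0_fin_numE//; exact: wsq_ge0. Qed.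

Lemma in_HsZ c w : in_Hs s oD w -> in_Hs s oD (fun x => c * w x).
Proof.
move=> Hw; have /in_HsP[mw wy gw] := Hw; apply/in_HsP; split.
- exact: measurable_funM.
- by rewrite /sqnorm wsqZ// -/(sqnorm D w) -(fineK (sqnorm_fin Hw)) -EFinM ltry.
- rewrite /gagl (_ : pdiff _ = (fun z => c * pdiff w z)); last first.
    by apply/funext => z; rewrite /pdiff mulrBr.
  rewrite wsqZ//; last exact: measurable_pdiff.
  by rewrite -/(gagl D w) -(fineK (gagl_fin Hw)) -EFinM ltry.
Qed.

Lemma dot_HsZ c w : in_Hs s oD w ->
  dot_Hs s D (fun x => c * w x) (fun x => c * w x) = c ^+ 2 * dot_Hs s D w w.
Proof.
move=> Hw; have /in_HsP[mw wy gw] := Hw.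
rewrite (dot_HsE (in_HsZ c Hw)) (dot_HsE Hw) mulrDr mulrCA; congr (_ + _ * _).
  by rewrite /sqnorm wsqZ// -/(sqnorm D w) -(fineK (sqnorm_fin Hw)).
rewrite /gagl (_ : pdiff _ = (fun z => c * pdiff w z)); last first.
  by apply/funext => z; rewrite /pdiff mulrBr.
rewrite wsqZ//; last exact: measurable_pdiff.
by rewrite -/(gagl D w) -(fineK (gagl_fin Hw)).
Qed.

Lemma in_HsD u w : in_Hs s oD u -> in_Hs s oD w -> in_Hs s oD (fun x => u x + w x).
Proof.
move=> Hu Hw; have /in_HsP[mu uy gu] := Hu; have /in_HsP[mw wy gw] := Hw; apply/in_HsP; split.
- exact: measurable_funD.
- apply: (le_lt_trans (wsqD _ _ _ _ _ _)) => //.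
  by rewrite -/(sqnorm D u) -(fineK (sqnorm_fin Hu)) -/(sqnorm D w) -(fineK (sqnorm_fin Hw)) -EFinD -EFinM ltry.
- rewrite /gagl (_ : pdiff _ = (fun z => pdiff u z + pdiff w z)); last first.
    by apply/funext => z; rewrite /pdiff; ring.
  apply: (le_lt_trans (wsqD _ _ _ _ _ _)) => //; try exact: measurable_pdiff.
  by rewrite -/(gagl D u) -(fineK (gagl_fin Hu)) -/(gagl D w) -(fineK (gagl_fin Hw)) -EFinD -EFinM ltry.
Qed.

(** From (a + b)^2 <= 2 a^2 + 2 b^2 under the integrals. It takes the place of the triangle
    inequality when approximations are added. *)
Lemma dot_HsD u w : 0 < s -> in_Hs s oD u -> in_Hs s oD w ->
  dot_Hs s D (fun x => u x + w x) (fun x => u x + w x) <=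
  2 * (dot_Hs s D u u + dot_Hs s D w w).
Proof.
move=> s0 Hu Hw; have /in_HsP[muw uwy guw] := in_HsD Hu Hw.
have /in_HsP[mu uy gu] := Hu; have /in_HsP[mw wy gw] := Hw.
rewrite (dot_HsE (in_HsD Hu Hw)) (dot_HsE Hu) (dot_HsE Hw).
have c0 : 0 <= @c_ds R d s / 2 by rewrite mulr_ge0 ?c_ds_ge0.
have : (sqnorm D (fun x => u x + w x)%R <= 2%:E * (sqnorm D u + sqnorm D w))%E.
  by apply: wsqD => // ?; exact: ler01.
rewrite -(fineK (sqnorm_fin (in_HsD Hu Hw))) -(fineK (sqnorm_fin Hu)).
rewrite -(fineK (sqnorm_fin Hw)) -EFinD -EFinM lee_fin.
have : (gagl D (fun x => u x + w x)%R <= 2%:E * (gagl D u + gagl D w))%E.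
  rewrite /gagl (_ : pdiff (fun x => u x + w x) = (fun z => pdiff u z + pdiff w z)).
    by apply: wsqD => //; exact: measurable_pdiff.
  by apply/funext => z; rewrite /pdiff; ring.
rewrite -(fineK (gagl_fin (in_HsD Hu Hw))) -(fineK (gagl_fin Hu)).
rewrite -(fineK (gagl_fin Hw)) -EFinD -EFinM lee_fin.
nra.
Qed.

Lemma in_Hs_contraction u w : in_Hs s oD w -> measurable_fun setT u ->
  (forall x, `|u x| <= `|w x|) -> (forall x y, `|u x - u y| <= `|w x - w y|) ->
  in_Hs s oD u.
Proof.
move=> /in_HsP[mw wy gw] mu uw uuww; apply/in_HsP; split => //.
- apply: le_lt_trans wy; apply: le_wsq => // x.
  by rewrite -ler_sqrt ?sqr_ge0// !sqrtr_sqr.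
- apply: le_lt_trans gw; apply: le_wsq => //; try exact: measurable_pdiff.
  by move=> z; rewrite -ler_sqrt ?sqr_ge0// !sqrtr_sqr uuww.
Qed.

Variables (k t : R) (w : E -> R).
Hypotheses (k0 : 0 <= k) (t01 : 0 <= t <= 1) (s0 : 0 < s).
Hypothesis Hw : in_Hs s oD w.
Let z x := excess k (w x).

Lemma in_Hs_excess : in_Hs s oD z.
Proof.
apply: (in_Hs_contraction Hw).
- by apply: measurable_excess; case/in_HsP: Hw.
- by move=> x; rewrite ger0_norm ?excess_ge0// excess_le_norm.
- by move=> x y; exact: excess_lipschitz.
Qed.

Lemma in_Hs_sub_excess : in_Hs s oD (fun x => w x - t * z x).
Proof.
have : in_Hs s oD (fun x => w x + - t * z x).
  exact: in_HsD Hw (in_HsZ _ in_Hs_excess).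
by congr in_Hs; apply/funext => x; rewrite mulNr.
Qed.

Lemma dot_Hs_excess :
  dot_Hs s D (fun x => w x - t * z x) (fun x => w x - t * z x) +
  (2 * t - t ^+ 2) * dot_Hs s D z z <= dot_Hs s D w w.
Proof.
rewrite (dot_HsE in_Hs_sub_excess) (dot_HsE in_Hs_excess) (dot_HsE Hw).
have /in_HsP[m1 f1 g1] := in_Hs_sub_excess.
have /in_HsP[m2 f2 g2] := in_Hs_excess.
have /in_HsP[m3 f3 g3] := Hw.
have c0 : 0 <= @c_ds R d s / 2 by rewrite mulr_ge0 ?c_ds_ge0.
have : (sqnorm D (fun x => w x - t * z x)%R +
    (2 * t - t ^+ 2)%:E * sqnorm D z <= sqnorm D w)%E.
  apply: wsq_excess => // x.
  (* The L^2 part is the case of the increment between w x and 0, as the excess vanishes at 0 for k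
     >= 0. *)
  rewrite /z; have := excess_sqr_le k (w x) 0.
  rewrite (_ : excess k 0 = 0) ?subr0// /excess sub0r.
  by apply/max_idPr; rewrite oppr_le0.
rewrite -(fineK (sqnorm_fin in_Hs_sub_excess)) -(fineK (sqnorm_fin in_Hs_excess)).
rewrite -(fineK (sqnorm_fin Hw)) -EFinM -EFinD lee_fin.
have : (gagl D (fun x => w x - t * z x)%R +
    (2 * t - t ^+ 2)%:E * gagl D z <= gagl D w)%E.
  rewrite /gagl (_ : pdiff (fun x => _ - _) = (fun x => pdiff w x - t * pdiff z x)).
    apply: wsq_excess => //; try exact: measurable_pdiff.
    by move=> x; exact: excess_sqr_le.
  by apply/funext => x; rewrite /pdiff; ring.
rewrite -(fineK (gagl_fin in_Hs_sub_excess)) -(fineK (gagl_fin in_Hs_excess)).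
rewrite -(fineK (gagl_fin Hw)) -EFinM -EFinD lee_fin.
nra.
Qed.

End closure.
End gagliardo.

(** * Test functions composed with smooth functions of one variable *)

Section line_derivative.
Context {R : realType} {V : normedModType R}.

(** The two difference quotients are the same function of h. Directional derivatives thus inherit
    the one-variable chain rule and mean value theorem, without total differentiability of [f]. *)
Lemma is_derive_line (f : V -> R) (x v : V) (a : R) :
  is_derive x v f a <-> is_derive (0 : R) 1 (fun h : R => f (h *: v + x)) a.
Proof.
have E : (fun h : R => h^-1 *: ((f \o shift x) (h *: v) - f x)) =
  (fun h : R => h^-1 *: (((fun h : R => f (h *: v + x)) \o shift 0) (h *: 1)
      - (fun h : R => f (h *: v + x)) 0)).
  apply/funext => h /=; rewrite addr0 scale0r add0r.
  by rewrite /GRing.scale /= mulr1.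
split=> -[D1 D2]; apply: DeriveDef; move: D1 D2; rewrite /derivable /derive E//.
Qed.

Lemma is_derive_comp_real (f : V -> R) (g : R -> R) (x v : V) (a b : R) :
  is_derive (f x) 1 g a -> is_derive x v f b ->
  is_derive x v (g \o f) (a * b).
Proof.
move=> gD /is_derive_line fD; apply/is_derive_line.
apply: (@is_derive1_comp _ g (fun h : R => f (h *: v + x)) 0) => //.
by rewrite scale0r add0r.
Qed.

End line_derivative.

(* A sequence of functions on R each of which is the derivative of the
   preceding one: the first one is then infinitely differentiable. *)
Definition derivative_tower {R : realType} (h : nat -> R -> R) :=
  forall n x, is_derive (x : R) 1 (h n) (h n.+1 x).

Section Ck.
Context {R : realType} {d : nat}.
Local Notation E := 'rV[R]_d.
Implicit Types (f g psi : E -> R) (h : nat -> R -> R).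

Lemma Ck_continuous k f : Ck k f -> continuous f.
Proof. by case: k => [|k] []. Qed.

Lemma Ck_pred k f : Ck k.+1 f -> Ck k f.
Proof.
elim: k f => [|k IH] f [cf Df]; first by split.
by split => // i; have [Dfi Cf] := Df i; split => //; exact: IH.
Qed.

Lemma CkD k f g : Ck k f -> Ck k g -> Ck k (f \+ g).
Proof.
elim: k f g => [|k IH] f g [cf Df] [cg Dg].
  by split => // x; apply: continuousD; [exact: cf|exact: cg].
split; first by move=> x; apply: continuousD; [exact: cf|exact: cg].
move=> i; have [Dfi Cf] := Df i; have [Dgi Cg] := Dg i; split.
  by move=> x; exact: derivableD.
rewrite (_ : (fun x => _) = 'D_(delta_mx 0 i) f \+ 'D_(delta_mx 0 i) g).
  exact: IH.
by apply/funext => x; rewrite /= -deriveD.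
Qed.

Lemma CkM k f g : Ck k f -> Ck k g -> Ck k (f \* g).
Proof.
elim: k f g => [|k IH] f g /[dup] Cf [cf Df] /[dup] Cg [cg Dg].
  by split => // x; apply: continuousM; [exact: cf|exact: cg].
split; first by move=> x; apply: continuousM; [exact: cf|exact: cg].
move=> i; have [Dfi Cfi] := Df i; have [Dgi Cgi] := Dg i; split.
  by move=> x; exact: derivableM.
rewrite (_ : (fun x => _) =
    (f \* 'D_(delta_mx 0 i) g) \+ (g \* 'D_(delta_mx 0 i) f)).
  by apply: CkD; apply: IH => //; exact: Ck_pred.
by apply/funext => x; rewrite /= [LHS]deriveM.
Qed.

Lemma tower_continuous h n : derivative_tower h -> continuous (h n).
Proof.
move=> hh x; apply: differentiable_continuous; apply/derivable1_diffP.
by have [] := hh n x.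
Qed.

Lemma tower_comp h n psi x i : derivative_tower h ->
  derivable psi x (delta_mx 0 i) ->
  is_derive x (delta_mx 0 i) (h n \o psi)
    (h n.+1 (psi x) * 'D_(delta_mx 0 i) psi x).
Proof.
by move=> hh dpsi; apply: is_derive_comp_real; [exact: hh|exact: DeriveDef].
Qed.

(** The induction on [k] runs over all [n] at once, because differentiating h_n o psi moves up to
    h_(n+1) o psi. *)
Lemma Ck_comp h k psi : derivative_tower h -> (forall j, Ck j psi) ->
  forall n, Ck k (h n \o psi).
Proof.
move=> hh Cpsi; have cpsi := Ck_continuous (Cpsi 0).
elim: k => [|k IH] n.
  by split => // x; apply: continuous_comp; [exact: cpsi|exact: tower_continuous].
split.
  by move=> x; apply: continuous_comp; [exact: cpsi|exact: tower_continuous].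
move=> i; have [_ /(_ i)[dpsi _]] := Cpsi 1%N; split.
  by move=> x; have [] := tower_comp n hh (dpsi x).
rewrite (_ : (fun x => _) = (h n.+1 \o psi) \* 'D_(delta_mx 0 i) psi).
  by apply: CkM; [exact: IH|have [_ /(_ i)[]] := Cpsi k.+1].
by apply/funext => x; have [_ ->] := tower_comp n hh (dpsi x).
Qed.

Variable D : set E.

Lemma test_function_derivable psi x i : test_function D psi ->
  derivable psi x (delta_mx 0 i).
Proof. by case=> C _ _; have [_ /(_ i)[]] := C 1%N. Qed.

Lemma test_function_continuous psi : test_function D psi -> continuous psi.
Proof. by case=> C _ _; exact: Ck_continuous (C 0%N). Qed.

Lemma test_function_continuousD psi i : test_function D psi ->
  continuous ('D_(delta_mx 0 i) psi).
Proof. by case=> C _ _; have [_ /(_ i)[_ []]] := C 1%N. Qed.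

Lemma test_function_support f psi : (forall k, Ck k f) ->
  test_function D psi -> (forall x, psi x = 0 -> f x = 0) -> test_function D f.
Proof.
move=> Cf [_ cpsi psiD] psif.
have sub : closure [set x | f x != 0] `<=` closure [set x | psi x != 0].
  by apply: closure_subset => x /=; apply: contra_neq => /psif.
split => //; last exact: subset_trans psiD.
apply: (subclosed_compact _ cpsi) => //; exact: closed_closure.
Qed.

Lemma test_functionD f g : test_function D f -> test_function D g ->
  test_function D (f \+ g).
Proof.
move=> [Cf cf fD] [Cg cg gD].
have sub : closure [set x | (f \+ g) x != 0] `<=`
    closure [set x | f x != 0] `|` closure [set x | g x != 0].
  rewrite -closureU; apply: closure_subset => x /= fg.
  have [fx0|] := eqVneq (f x) 0; last by left.
  by right; move: fg; rewrite fx0 add0r.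
split.
- by move=> k; exact: CkD.
- apply: (subclosed_compact _ _ sub); first exact: closed_closure.
  exact: compactU.
- by move=> x /sub[]; [exact: fD|exact: gD].
Qed.

Lemma test_function_comp h psi : derivative_tower h -> h 0%N 0 = 0 ->
  test_function D psi -> test_function D (h 0%N \o psi).
Proof.
move=> hh h0 /[dup] tpsi [Cpsi _ _]; apply: (test_function_support _ tpsi).
  by move=> k; exact: Ck_comp.
by move=> x /= ->.
Qed.

Lemma derive_tower_comp h psi x i : derivative_tower h -> test_function D psi ->
  'D_(delta_mx 0 i) (h 0%N \o psi) x = h 1%N (psi x) * 'D_(delta_mx 0 i) psi x.
Proof.
move=> hh tpsi.
have dpsi : derivable psi x (delta_mx 0 i) by exact: test_function_derivable tpsi.
by have [_ ->] := tower_comp 0 hh dpsi.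
Qed.

End Ck.

Section towers.
Context {R : realType}.
Implicit Types (h : nat -> R -> R) (c x t k e : R).

(** Scalar multiplication seen as a composition, so that the lemmas on towers also yield scalar
    multiples of test functions. *)
Definition linear_tower c (n : nat) x : R :=
  if n is n'.+1 then (if n' is 0%N then c else 0) else c * x.

Lemma linear_towerP c : derivative_tower (linear_tower c).
Proof.
move=> [|[|n]] x /=; last 2 first.
- exact: is_derive_cst.
- exact: is_derive_cst.
rewrite -[X in is_derive _ _ _ X]mulr1.
exact: (is_deriveZ c (is_derive_id x 1)).
Qed.

Section sigmoid.
Variables (k e : R).
Hypothesis e0 : 0 < e.

Definition sigmoid x : R := (1 + expR (- ((x - k) / e)))^-1.
Definition softplus x : R := e * ln (1 + expR ((x - k) / e)).

Lemma sigmoid_itv x : 0 <= sigmoid x <= 1.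
Proof.
have := expR_gt0 (- ((x - k) / e)) => h; rewrite /sigmoid invr_ge0.
by rewrite addr_ge0 ?(ltW h)//= invf_le1 ?ltr_wpDr ?lerDl ?(ltW h)// ltr_wpDr// ltW.
Qed.

Lemma is_derive_affine x : is_derive x 1 (fun y => (y - k) / e) e^-1.
Proof.
rewrite (_ : (fun y => _) = e^-1 \*: (id - cst k)).
  have D1 := is_deriveB (is_derive_id x 1) (is_derive_cst (k : R) x 1).
  apply: (is_derive_eq (is_deriveZ e^-1 D1)).
  by rewrite subr0 /GRing.scale /= mulr1.
by apply/funext => y; rewrite /= mulrC.
Qed.

Lemma is_derive_softplus x : is_derive x 1 softplus (sigmoid x).
Proof.
have eD : is_derive x 1 (fun y => 1 + expR ((y - k) / e))
    (expR ((x - k) / e) * e^-1).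
  have D1 := @is_derive1_comp _ expR (fun y => (y - k) / e) x _ _
    (is_derive_expR _) (is_derive_affine x).
  have D2 := is_deriveD (is_derive_cst (1 : R) x 1) D1.
  by rewrite add0r in D2; exact: D2.
have p0 : 0 < 1 + expR ((x - k) / e) by rewrite addr_gt0 ?expR_gt0.
have lD := @is_derive1_comp _ (@ln R) _ x _ _ (is_derive1_ln p0) eD.
apply: (is_derive_eq (is_deriveZ e lD)).
rewrite /sigmoid expRN /GRing.scale /=.
have := expR_gt0 ((x - k) / e) => h.
by field; rewrite ?gt_eqF// ?addr_gt0.
Qed.

Lemma is_derive_sigmoid x :
  is_derive x 1 sigmoid (e^-1 * (sigmoid x - sigmoid x ^+ 2)).
Proof.
have eD : is_derive x 1 (fun y => 1 + expR (- ((y - k) / e)))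
    (- (expR (- ((x - k) / e)) * e^-1)).
  have D1 := @is_derive1_comp _ expR (fun y => - ((y - k) / e)) x _ _
    (is_derive_expR _) (is_deriveN (is_derive_affine x)).
  have D2 := is_deriveD (is_derive_cst (1 : R) x 1) D1.
  by rewrite add0r mulrN in D2; exact: D2.
have h := expR_gt0 (- ((x - k) / e)).
have p0 : 1 + expR (- ((x - k) / e)) != 0 by rewrite gt_eqF// addr_gt0.
have D2 := @is_deriveV _ (fun y => 1 + expR (- ((y - k) / e))) x _ _ p0 eD.
rewrite (_ : e^-1 * _ = - (1 + expR (- ((x - k) / e))) ^- 2 *:
    - (expR (- ((x - k) / e)) * e^-1)); first exact: D2.
rewrite /sigmoid /GRing.scale /=.
by field; rewrite ?gt_eqF// ?addr_gt0.
Qed.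

(** The logistic function S satisfies S' = (S - S^2) / e, so each of its derivatives is a polynomial
    in S; the recursion is the chain rule for P(S). *)
Fixpoint sigmoid_poly (n : nat) : {poly R} :=
  if n is n'.+1 then (sigmoid_poly n')^`() * (e^-1 *: ('X - 'X^2)) else 'X.

Definition softplus_tower (n : nat) x : R :=
  if n is n'.+1 then (sigmoid_poly n').[sigmoid x] else softplus x - softplus 0.

Lemma softplus_towerP : derivative_tower softplus_tower.
Proof.
move=> [|n] x /=.
  rewrite hornerX.
  apply: (is_derive_eq (is_deriveB (is_derive_softplus x) (is_derive_cst (softplus 0) x 1))).
  by rewrite subr0.
have D1 := @is_derive1_comp _ (horner (sigmoid_poly n)) sigmoid x _ _
  (is_derive_poly _ _) (is_derive_sigmoid x).
apply: (is_derive_eq D1).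
by rewrite hornerM !hornerE.
Qed.

(** The symmetry ln(1 + exp y) = y + ln(1 + exp(-y)) reduces x > k to x <= k, where the excess is 0
    and ln(1 + a) <= a <= 1. *)
Lemma softplus_excess x : 0 <= softplus x - excess k x <= e.
Proof.
have key y : y <= 0 -> 0 <= e * ln (1 + expR (y / e)) <= e.
  move=> y0; have h := expR_gt0 (y / e).
  have h1 : expR (y / e) <= 1 by rewrite -expR0 ler_expR pmulr_lle0 ?invr_gt0.
  apply/andP; split; first by rewrite mulr_ge0 ?ln_ge0 ?lerDl ?ltW.
  by rewrite -[leRHS]mulr1 ler_pM2l// (le_trans _ h1)// le_ln1Dx// (lt_trans _ h)// ltrN10.
rewrite /softplus /excess; case: (leP (x - k) 0) => xk; first by rewrite subr0 key.
suff -> : e * ln (1 + expR ((x - k) / e)) - (x - k) =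
    e * ln (1 + expR (- (x - k) / e)) by rewrite key// oppr_le0 ltW.
have h := expR_gt0 ((x - k) / e); have h' := expR_gt0 (- ((x - k) / e)).
rewrite (_ : 1 + expR ((x - k) / e) =
    expR ((x - k) / e) * (1 + expR (- (x - k) / e))); last first.
  by rewrite mulrDr mulr1 -expRD mulNr subrr expR0 addrC.
rewrite lnM ?posrE ?addr_gt0 ?mulNr// expRK mulrDr.
by rewrite mulrCA divff ?gt_eqF// mulr1 addrAC subrr add0r.
Qed.

End sigmoid.

(* Smooth approximation of [excess k] vanishing at 0, so that composing it with
   a test function does not enlarge the support. *)
Lemma smooth_excess k e : 0 <= k -> 0 < e -> exists h : nat -> R -> R,
  [/\ derivative_tower h, h 0%N 0 = 0, forall x, 0 <= h 1%N x <= 1 &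
      forall x, `|h 0%N x - excess k x| <= e].
Proof.
move=> k0 e0; exists (softplus_tower k e); split => /=.
- exact: softplus_towerP.
- by rewrite subrr.
- by move=> x; rewrite hornerX sigmoid_itv.
(* Normalising by [softplus] at 0 does not spoil the bound: the error becomes a difference of two
   numbers in [0, e]. *)
- move=> x; have := softplus_excess k e0 x; have := softplus_excess k e0 0.
  have -> : excess k 0 = 0 :> R.
    by rewrite /excess sub0r; apply/max_idPr; rewrite oppr_le0.
  rewrite subr0 ler_norml; lra.
Qed.

Lemma tower_lipschitz h x y : derivative_tower h -> (forall x, 0 <= h 1%N x <= 1) ->
  `|h 0%N x - h 0%N y| <= `|x - y|.
Proof.
move=> hh h1; wlog yx : x y / y <= x.
  move=> wl; have [/wl//|/ltW/wl] := leP y x.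
  by rewrite distrC (distrC y x).
have [c _ ->] : exists2 c, c \in `[y, x] & h 0%N x - h 0%N y = h 1%N c * (x - y).
  apply: MVT_segment => //; apply: continuous_subspaceT.
  by move=> z; exact: tower_continuous.
rewrite normrM ler_piMl// ger0_norm; by case/andP: (h1 c).
Qed.

End towers.

(** * Cubes, bounded sets and bounds on test functions *)

Section rV_facts.
Context {R : realType} {d : nat}.
Local Notation E := 'rV[R]_d.
Local Notation leb := (lebesgue_measure_rV R d).

Lemma coord_le_norm (x : E) i : `|x 0 i| <= `|x|.
Proof. by rewrite [leRHS]mx_normrE; exact: (le_bigmax _ _ (0, i)). Qed.

Lemma norm_le_coord (x : E) c : 0 <= c -> (forall i, `|x 0 i| <= c) -> `|x| <= c.
Proof.
by move=> c0 xc; rewrite [leLHS]mx_normrE; apply: bigmax_le => // -[i j] _; rewrite ord1.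
Qed.

Lemma norm_le_enorm (x : E) : `|x| <= enorm x.
Proof.
apply: norm_le_coord => [|i]; first exact: sqrtr_ge0.
rewrite -sqrtr_sqr ler_sqrt; last by apply: sumr_ge0 => *; exact: sqr_ge0.
by rewrite (bigD1 i)//= lerDl; apply: sumr_ge0 => *; exact: sqr_ge0.
Qed.

(** The closed ball of the max norm; being a box, it has a measure given by a plain product. *)
Definition cube (x : E) (c : R) : set E :=
  [set y | forall i, y 0 i \in `[x 0 i - c, x 0 i + c]].

Lemma cubeP (x y : E) c : 0 <= c -> cube x c y <-> `|x - y| <= c.
Proof.
move=> c0; split=> [xy|xy i].
  apply: norm_le_coord => // i; have := xy i; rewrite in_itv/= !mxE ler_norml.
  lra.
have := le_trans (coord_le_norm (x - y) i) xy; rewrite in_itv/= !mxE ler_norml.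
lra.
Qed.

Lemma measurable_cube x c : measurable (cube x c).
Proof.
rewrite [X in measurable X](_ : _ = \bigcap_(i in [set: 'I_d])
    ((fun y : E => y 0 i) @^-1` [set` `[x 0 i - c, x 0 i + c]])); last first.
  by apply/seteqP; split => [y yi i _|y yi i]; [exact: yi|exact: (yi i I)].
apply: fin_bigcap_measurable; first exact: finite_finset.
move=> i _; rewrite -[X in measurable X]setTI.
by apply: measurable_coord => //; exact: measurable_itv.
Qed.

Lemma leb_cube x c : 0 <= c -> leb (cube x c) = ((2 * c) ^+ d)%:E.
Proof.
move=> c0; pose a : E := \row_i (x 0 i - c); pose b : E := \row_i (x 0 i + c).
have -> : cube x c = [set y | forall i, y 0 i \in `[a 0 i, b 0 i]].
  by apply/seteqP; split=> y yi i; have := yi i; rewrite !mxE.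
rewrite lebesgue_measure_rV_box => [|i]; last by rewrite !mxE; lra.
rewrite (eq_bigr (fun=> 2 * c)) => [|i _]; last by rewrite !mxE; ring.
by rewrite prodr_const card_ord.
Qed.

Lemma leb_bounded (D : set E) : measurable D -> bounded_set D -> (leb D < +oo)%E.
Proof.
move=> mD [M [_ DM]].
have M0 : 0 <= `|M| + 1 by rewrite addr_ge0.
have MM : M < `|M| + 1 by rewrite (le_lt_trans (ler_norm _))// ltrDl.
apply: (@le_lt_trans _ _ (leb (cube 0 (`|M| + 1)))); last by rewrite leb_cube// ltry.
apply: le_measure; rewrite ?inE//; try exact: measurable_cube.
by move=> x /(DM _ MM) /= xM; apply/cubeP => //; rewrite sub0r normrN.
Qed.

End rV_facts.

Section test_bounds.
Context {R : realType} {d : nat} (D : set 'rV[R]_d).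
Local Notation E := 'rV[R]_d.
Implicit Types psi : E -> R.

Lemma bounded_off_compact (f : E -> R) (K : set E) : continuous f -> compact K ->
  (forall x, ~ K x -> f x = 0) -> exists2 C : R, 0 <= C & forall x, `|f x| <= C.
Proof.
move=> cf cK f0.
have /compact_bounded[M [_ fM]] : compact (f @` K).
  by apply: continuous_compact => //; exact: continuous_subspaceT.
have MM : M < `|M| + 1 by rewrite (le_lt_trans (ler_norm _))// ltrDl.
exists (`|M| + 1) => [|x]; first by rewrite addr_ge0.
have [Kx|/f0 ->] := pselect (K x); last by rewrite normr0 addr_ge0.
by apply: (fM _ MM (f x)); exists x.
Qed.

Lemma test_function_bounded psi : test_function D psi ->
  exists2 C : R, 0 <= C & forall x, `|psi x| <= C.
Proof.
move=> /[dup] tp [_ cK _]; apply: bounded_off_compact cK _.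
  exact: test_function_continuous tp.
move=> x Kx; apply: contrapT => /eqP px; apply: Kx.
exact: subset_closure.
Qed.

Lemma test_derive_bounded psi i : test_function D psi ->
  exists2 C : R, 0 <= C & forall x, `|'D_(delta_mx 0 i) psi x| <= C.
Proof.
move=> /[dup] tp [_ cK _]; apply: bounded_off_compact cK _.
  exact: test_function_continuousD tp.
move=> x Kx; rewrite (@near_eq_derive _ _ _ psi (cst 0)) ?derive_cst//.
have oK : open (~` closure [set x | psi x != 0]).
  exact/closed_openC/closed_closure.
have : nbhs x (~` closure [set x | psi x != 0]) by apply: open_nbhs_nbhs.
apply: filterS => y /= Ky; apply: contrapT => /eqP py; apply: Ky.
exact: subset_closure.
Qed.

(** Only partial derivatives are at hand, so the segment from y to x is replaced by a staircase that
    changes one coordinate at a time, with the mean value theorem on each stair. The stairs may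
    leave [D], since the derivatives are bounded on the whole space. *)
Lemma test_function_lipschitz psi : test_function D psi ->
  exists2 L : R, 0 <= L & forall x y, `|psi x - psi y| <= L * `|x - y|.
Proof.
move=> tp.
have CE i : exists C : R, 0 <= C /\ forall x, `|'D_(delta_mx 0 i) psi x| <= C.
  by have [C] := test_derive_bounded i tp; exists C.
pose C i := projT1 (cid (CE i)).
have C0 i : 0 <= C i by case: (projT2 (cid (CE i))).
have CP i x : `|'D_(delta_mx 0 i) psi x| <= C i by case: (projT2 (cid (CE i))) => _; exact.
exists (\sum_i C i); first exact: sumr_ge0.
move=> x y.
have step i (z : E) h : `|psi (h *: delta_mx 0 i + z) - psi z| <= C i * `|h|.
  pose g (t : R) := psi (t *: delta_mx 0 i + z).
  have dg (t : R) : is_derive t 1 g ('D_(delta_mx 0 i) psi (t *: delta_mx 0 i + z)).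
    have dp : is_derive (t *: delta_mx 0 i + z) (delta_mx 0 i) psi
        ('D_(delta_mx 0 i) psi (t *: delta_mx 0 i + z)).
      by apply: DeriveDef => //; exact: test_function_derivable tp.
    have /is_derive_line := dp.
    move=> dl; apply/is_derive_line; move: dl.
    rewrite (_ : (fun h : R => psi (h *: _ + _)) = (fun h : R => g (h *: 1 + t)))//.
    by apply/funext => k; rewrite /g addrA -scalerDl /GRing.scale /= mulr1.
  have cg : continuous g.
    by move=> t; apply: differentiable_continuous; apply/derivable1_diffP; have [] := dg t.
  have key (a b : R) : a <= b -> `|g b - g a| <= C i * `|b - a|.
    move=> ab; have [c _ ->] := MVT_segment ab (fun t _ => dg t) (continuous_subspaceT cg).
    by rewrite normrM ler_wpM2r.
  have -> : psi z = g 0 by rewrite /g scale0r add0r.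
  have [h0|/ltW h0] := leP 0 h; first by have := key _ _ h0; rewrite subr0.
  by have := key _ _ h0; rewrite distrC sub0r normrN.
pose p (k : nat) : E := \row_(j < d) if (j < k)%N then x 0 j else y 0 j.
have p0 : p 0%N = y by apply/rowP => j; rewrite mxE.
have pd : p d = x by apply/rowP => j; rewrite mxE ltn_ord.
have pS (i : 'I_d) : p i.+1 = (x 0 i - y 0 i) *: delta_mx 0 i + p i.
  apply/rowP => j; rewrite !mxE eqxx/=; have [->|ji] := eqVneq j i.
    by rewrite ltnSn ltnn mulr1 subrK.
  have /negbTE ji' : (j != i :> nat) by [].
  by rewrite ltnS leq_eqVlt ji' mulr0 add0r.
have -> : psi x - psi y = \sum_(i < d) (psi (p i.+1) - psi (p i)).
  have := @telescope_sumr _ 0 d (fun k => psi (p k)) (leq0n d).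
  by rewrite p0 pd big_mkord.
apply: (le_trans (ler_norm_sum _ _ _)); rewrite mulr_suml; apply: ler_sum => i _.
rewrite pS; apply: (le_trans (step i (p i) _)); apply: ler_wpM2l => //.
by have := coord_le_norm (x - y) i; rewrite !mxE.
Qed.

End test_bounds.

(** * Fractional powers as integrals of lam / (lam + mu) *)

Section power_representation.
Context {R : realType} (s : R).
Hypothesis s01 : 0 < s < 1.
Local Notation mu := (@lebesgue_measure R).

(** The integrand lam / (lam + y^(1/s)) after the substitution y = exp(s x), up to the factor s. On
    the whole line it is continuous, and for 0 < s < 1 it decays exponentially at both ends. *)
Definition power_kernel (lam x : R) : R := expR (s * x) * (lam / (lam + expR x)).

Lemma power_kernel_ge0 lam x : 0 <= lam -> 0 <= power_kernel lam x.
Proof. by move=> l0; rewrite mulr_ge0 ?expR_ge0// divr_ge0// addr_ge0// expR_ge0. Qed.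

Lemma continuous_power_kernel lam : 0 <= lam -> continuous (power_kernel lam).
Proof.
move=> l0 x; rewrite /power_kernel; apply: cvgM.
  apply: (@continuous_comp _ _ _ (fun y => s * y) expR); last exact: continuous_expR.
  by apply: cvgM; [exact: cvg_cst|exact: cvg_id].
apply: cvgM; first exact: cvg_cst.
apply: cvgV; first by rewrite gt_eqF// ltr_wpDl// expR_gt0.
by apply: cvgD; [exact: cvg_cst|exact: continuous_expR].
Qed.

Lemma measurable_power_kernel lam : 0 <= lam ->
  measurable_fun setT (power_kernel lam).
Proof. by move=> l0; apply: continuous_measurable_fun; exact: continuous_power_kernel. Qed.

Lemma integral_power_kernel1_lty :
  (\int[mu]_x (power_kernel 1 x)%:E < +oo)%E.
Proof.
have /andP[s0 s1] := s01.
(* The kernel decays like exp(s x) at -oo and like exp(-(1 - s) x) at +oo; [m] is the slower rate.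
   By symmetry exp(-m |x|) is then compared with an exponential density on a half line. *)
pose m := Num.min s (1 - s).
have m0 : 0 < m by rewrite lt_min s0 subr_gt0.
have ms : m <= s by rewrite ge_min lexx.
have m1s : m <= 1 - s by rewrite ge_min lexx orbT.
pose f (x : R) : R := expR (- (m * `|x|)).
have cf : continuous f.
  move=> x; apply: (@continuous_comp _ _ _ (fun y : R => - (m * `|y|)) expR);
    last exact: continuous_expR.
  apply: cvgN; apply: cvgM; first exact: cvg_cst.
  exact: norm_continuous.
have mf : measurable_fun setT f by exact: continuous_measurable_fun.
have bound x : power_kernel 1 x <= f x.
  rewrite /power_kernel /f mul1r ler_pdivrMr ?addr_gt0 ?expR_gt0//.
  rewrite mulrDr mulr1 -expRD.
  have [x0|x0] := leP 0 x; [rewrite ger0_norm//|rewrite ltr0_norm//].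
    apply: (@le_trans _ _ (expR (- (m * x) + x))).
      by rewrite ler_expR; nra.
    by rewrite lerDr expR_ge0.
  apply: (@le_trans _ _ (expR (- (m * - x)))).
    by rewrite ler_expR; nra.
  by rewrite lerDl expR_ge0.
apply: (@le_lt_trans _ _ (\int[mu]_x (f x)%:E)%E).
  apply: ge0_le_integral => //.
  - by move=> x _; rewrite lee_fin power_kernel_ge0.
  - by apply/measurable_EFinP; exact: measurable_power_kernel.
  - exact/measurable_EFinP.
  - by move=> x _; rewrite lee_fin.
rewrite ge0_symfun_integralT//; last 2 first.
- by move=> x; exact: expR_ge0.
- by move=> x; rewrite /f /= normrN.
have mP : measurable [set x : R | 0 <= x] by rewrite -set_itvcy.
apply: (@le_lt_trans _ _ (2%:E * (m^-1)%:E)%E); last by rewrite -EFinM ltry.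
rewrite lee_pmul2l//.
apply: (@le_trans _ _ (\int[mu]_x ((m^-1)%:E * (exponential_pdf m x)%:E))%E).
  apply: (@le_trans _ _ (\int[mu]_(x in [set x : R | (0 <= x)%R]) ((m^-1)%:E * (exponential_pdf m x)%:E))%E).
    apply: ge0_le_integral => //.
    - by move=> x _; rewrite lee_fin expR_ge0.
    - by apply: measurable_funTS; exact/measurable_EFinP.
    - apply: measurable_funTS; apply: measurable_funeM.
      by apply/measurable_EFinP; exact: measurable_exponential_pdf.
    - move=> x /= x0; rewrite -EFinM lee_fin exponential_pdfE// /f ger0_norm//.
      by rewrite mulrA mulVf ?gt_eqF// mul1r mulNr.
  apply: ge0_subset_integral => //.
  - apply: measurable_funeM; apply/measurable_EFinP; exact: measurable_exponential_pdf.
  - by move=> x _; rewrite -EFinM lee_fin mulr_ge0 ?invr_ge0 ?(ltW m0)// exponential_pdf_ge0// ltW.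
rewrite ge0_integralZl_EFin ?invr_ge0 ?(ltW m0)//.
- by rewrite integral_exponential_pdf// mule1.
- by move=> x _; rewrite lee_fin exponential_pdf_ge0// ltW.
- by apply/measurable_EFinP; exact: measurable_exponential_pdf.
Qed.

(** On [0,1] the kernel is at least 1 / (1 + exp 1). Positivity allows the constant in front of
    lam^s to be cancelled. *)
Lemma integral_power_kernel1_gt0 :
  (0 < \int[mu]_x (power_kernel 1 x)%:E)%E.
Proof.
have /andP[s0 s1] := s01.
have e1 : 0 < (1 + expR 1 : R) by rewrite addr_gt0 ?expR_gt0.
apply: (@lt_le_trans _ _ (\int[mu]_(x in `[0%R, 1%R]) ((1 + expR 1)^-1)%:E)%E).
  rewrite integral_cst// mule_gt0 ?lte_fin ?invr_gt0//; apply: (@lt_le_trans _ _ 1%E) => //; rewrite [leRHS](_ : _ = 1%E)//.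
  by apply: etrans (lebesgue_measure_itv _) _; rewrite /= lte_fin ltr01 sube0.
apply: (@le_trans _ _ (\int[mu]_(x in `[0%R, 1%R]) (power_kernel 1 x)%:E)%E).
  apply: ge0_le_integral => //.
  - apply: measurable_funTS; apply/measurable_EFinP.
    exact: measurable_power_kernel.
  - move=> x /=; rewrite in_itv/= => /andP[x0 x1].
    rewrite lee_fin /power_kernel mul1r.
    apply: (@le_trans _ _ (1 + expR x)^-1).
      by rewrite lef_pV2 ?posrE ?addr_gt0 ?expR_gt0// lerD2l ler_expR.
    rewrite ler_peMl ?invr_ge0 ?addr_ge0 ?expR_ge0//.
    by rewrite -expR0 ler_expR mulr_ge0 ?(ltW s0).
apply: ge0_subset_integral => //.
- by apply/measurable_EFinP; exact: measurable_power_kernel.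
- by move=> x _; rewrite lee_fin power_kernel_ge0.
Qed.

(* Translating by [ln lam] reduces the integral to the case [lam = 1]. *)
Lemma integral_power_kernel : exists2 c : R, 0 < c & forall lam, 0 <= lam ->
  (\int[mu]_x (power_kernel lam x)%:E = (c * lam `^ s)%:E)%E.
Proof.
have /andP[s0 s1] := s01.
have fin1 : (\int[mu]_x (power_kernel 1 x)%:E)%E \is a fin_num.
  by rewrite ge0_fin_numE ?integral_power_kernel1_lty// ltW// integral_power_kernel1_gt0.
exists (fine (\int[mu]_x (power_kernel 1 x)%:E)%E).
  by rewrite fine_gt0// integral_power_kernel1_lty integral_power_kernel1_gt0.
move=> lam; rewrite le_eqVlt => /predU1P[<-|l0].
  rewrite powR0 ?gt_eqF// mulr0; apply: integral0_eq => x _.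
  by rewrite /power_kernel mul0r mulr0.
pose F (x : R) : R := x + ln lam.
have dF (x : R) : is_derive x 1 F 1.
  have := is_deriveD (is_derive_id x 1) (is_derive_cst (ln lam) x 1).
  by rewrite addr0.
have F'E : derive1 F = cst 1.
  by apply/funext => x; rewrite derive1E; have [_ ->] := dF x.
rewrite (increasing_ge0_integration_by_substitutionT (F := F)); last first.
- by move=> x; exact: power_kernel_ge0 (ltW l0).
- exact: continuous_power_kernel (ltW l0).
- exact: cvg_addrr.
- exact: cvg_addrr_Ny.
- by move=> x; have [] := dF x.
- by rewrite F'E; exact: is_cvg_cst.
- by rewrite F'E; exact: is_cvg_cst.
- by rewrite F'E => x; exact: cvg_cst.
- by move=> x y xy; rewrite /F ltrD2r.
rewrite [in RHS]mulrC [in RHS]EFinM [in RHS]fineK// -ge0_integralZl_EFin ?powR_ge0//; last 2 first.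
- by move=> x _; rewrite lee_fin power_kernel_ge0.
- by apply/measurable_EFinP; exact: measurable_power_kernel.
apply: eq_integral => x _; rewrite F'E /= -EFinM; congr EFin.
rewrite fctE mulr1 /power_kernel /F /= mulrDr !expRD lnK ?posrE//.
rewrite /powR gt_eqF// mul1r.
have ex := expR_gt0 x.
rewrite -[X in lam / X](_ : (1 + expR x) * lam = _); last by rewrite mulrDl mul1r.
by field; rewrite ?gt_eqF ?addr_gt0.
Qed.

End power_representation.

(** * Semi-inner products and an abstract Dirichlet form *)

(** Only semidefinite, because elements of L^2 are functions here and one that vanishes almost
    everywhere has square 0. *)
Record semi_inner (R : realType) (V : lmodType R) := SemiInner {
  sip :> V -> V -> R ;
  sipC : forall u v, sip u v = sip v u ;
  sipDl : forall u v x, sip (u + v) x = sip u x + sip v x ;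
  sipZl : forall a u v, sip (a *: u) v = a * sip u v ;
  sip_ge0 : forall u, 0 <= sip u u }.

Arguments sip : simpl never.

Section semi_inner_theory.
Context {R : realType} {V : lmodType R} (ip : semi_inner V).
Implicit Types (u v x : V) (a e : R).

Lemma sipDr u v x : ip x (u + v) = ip x u + ip x v.
Proof. by rewrite sipC sipDl !(sipC _ x). Qed.

Lemma sipZr a u v : ip v (a *: u) = a * ip v u.
Proof. by rewrite sipC sipZl sipC. Qed.

Lemma sipBl u v x : ip (u - v) x = ip u x - ip v x.
Proof. by rewrite sipDl -scaleN1r sipZl mulN1r. Qed.

Lemma sipBr u v x : ip x (u - v) = ip x u - ip x v.
Proof. by rewrite sipC sipBl !(sipC _ x). Qed.

Lemma sip0l x : ip 0 x = 0.
Proof. by rewrite -(scale0r x) sipZl mul0r. Qed.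

Lemma sip_suml (I : Type) (r : seq I) (P : pred I) (F : I -> V) x :
  ip (\sum_(i <- r | P i) F i) x = \sum_(i <- r | P i) ip (F i) x.
Proof.
by apply: (big_morph (fun u => ip u x)) => [u v|]; rewrite ?sipDl ?sip0l.
Qed.

Lemma sip_sumr (I : Type) (r : seq I) (P : pred I) (F : I -> V) x :
  ip x (\sum_(i <- r | P i) F i) = \sum_(i <- r | P i) ip x (F i).
Proof. by rewrite sipC sip_suml; apply: eq_bigr => i _; rewrite sipC. Qed.

Lemma sip_sqrB u v : ip (u - v) (u - v) = ip u u - 2 * ip u v + ip v v.
Proof. rewrite sipBl !sipBr (sipC _ v u); ring. Qed.

Lemma sip_sqrD u v : ip (u + v) (u + v) = ip u u + 2 * ip u v + ip v v.
Proof. rewrite sipDl !sipDr (sipC _ v u); ring. Qed.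

Lemma sip_young a u v : 0 < a -> 2 * `|ip u v| <= a * ip u u + a^-1 * ip v v.
Proof.
move=> a0; have ai : 0 < a^-1 by rewrite invr_gt0.
have a1 : a * a^-1 = 1 by rewrite mulfV// gt_eqF.
have := sip_ge0 ip (a *: u - v); rewrite sip_sqrB !sipZl sipZr => h1.
have := sip_ge0 ip (a *: u + v); rewrite sip_sqrD !sipZl sipZr => h2.
have h1' : 0 <= a^-1 * (a * (a * ip u u) - 2 * (a * ip u v) + ip v v).
  by rewrite mulr_ge0// ltW.
have h2' : 0 <= a^-1 * (a * (a * ip u u) + 2 * (a * ip u v) + ip v v).
  by rewrite mulr_ge0// ltW.
have E1 : a^-1 * (a * (a * ip u u) - 2 * (a * ip u v) + ip v v) =
   a * ip u u - 2 * ip u v + a^-1 * ip v v by field; rewrite gt_eqF.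
have E2 : a^-1 * (a * (a * ip u u) + 2 * (a * ip u v) + ip v v) =
   a * ip u u + 2 * ip u v + a^-1 * ip v v by field; rewrite gt_eqF.
rewrite E1 in h1'; rewrite E2 in h2'.
by case: ler0P => _; lra.
Qed.

Lemma sip_small u e : 0 < e -> exists2 dlt : R, 0 < dlt &
  forall v, ip v v <= dlt -> `|ip u v| <= e /\ ip (u + v) (u + v) <= ip u u + e.
Proof.
move=> e0; have u0 := sip_ge0 ip u.
(* With this weight Young's inequality bounds the cross term by e/2 + e/4, and e/4 remains for the
   square of v. *)
pose a := e / (2 * (ip u u + 1)).
have a0 : 0 < a by rewrite divr_gt0// mulr_gt0// ltr_wpDl.
have au : a * ip u u <= e / 2.
  rewrite /a mulrAC ler_pdivrMr ?mulr_gt0 ?ltr_wpDl//.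
  by have := mulr_ge0 (ltW e0) u0; nra.
exists (Num.min (a * (e / 4)) (e / 4)).
  by rewrite lt_min (mulr_gt0 a0) divr_gt0.
move=> v; rewrite le_min => /andP[v1 v2].
have v1' : a^-1 * ip v v <= e / 4.
  by rewrite ler_pdivrMl.
have y := sip_young u v a0; have n := ler_norm (ip u v).
have n0 := normr_ge0 (ip u v).
split; first by lra.
rewrite sip_sqrD; lra.
Qed.

End semi_inner_theory.

Section dirichlet_form.
Context {R : realType} (V W : lmodType R) (ip : semi_inner V) (dir : semi_inner W).
(* [H] is the graph of the gradient on the smooth functions. *)
Variable H : V -> W -> Prop.
Hypothesis HD : forall u U v VV, H u U -> H v VV -> H (u + v) (U + VV).
Hypothesis HZ : forall a u U, H u U -> H (a *: u) (a *: U).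
Variables (phi : nat -> V) (G : nat -> W) (lam : nat -> R).
Hypothesis approx : forall n e, 0 < e -> exists u U, [/\ H u U,
  ip (phi n - u) (phi n - u) <= e & dir (G n - U) (G n - U) <= e].
Hypothesis eigen : forall n u U, H u U -> dir (G n) U = lam n * ip (phi n) u.
Hypothesis ortho : forall m n, ip (phi m) (phi n) = (m == n)%:R.

Let cls u U := forall e, 0 < e -> exists v VV, [/\ H v VV,
  ip (v - u) (v - u) <= e & dir (VV - U) (VV - U) <= e].

Let H0 : H 0 0.
Proof.
have [u [U [h _ _]]] := approx 0 (@ltr01 R).
by have := HZ 0 h; rewrite !scale0r.
Qed.

Let cls_sum (c : nat -> R) N :
  cls (\sum_(n < N) c n *: phi n) (\sum_(n < N) c n *: G n).
Proof.
elim: N => [|N IH] e e0.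
  exists 0, 0; split; first exact: H0.
  - by rewrite big_ord0 subrr sip0l ltW.
  - by rewrite big_ord0 subrr sip0l ltW.
(* Two errors of e/4 suffice, as |x - y|^2 <= 2 |x|^2 + 2 |y|^2; dividing further by c_N^2 + 1
   absorbs the coefficient of the new term. *)
have e4 : 0 < e / 4 by rewrite divr_gt0.
have [v [VV [h v1 v2]]] := IH _ e4.
have c0 : 0 < (c N ^+ 2 + 1) by rewrite ltr_wpDl ?sqr_ge0.
have [u [U [h' u1 u2]]] := approx N (divr_gt0 e4 c0).
have half (T : lmodType R) (f : semi_inner T) (a b a' b' : T) :
    f (a - a') (a - a') <= e / 4 ->
    f (b' - b) (b' - b) <= e / 4 / (c N ^+ 2 + 1) ->
    f (a + c N *: b - (a' + c N *: b')) (a + c N *: b - (a' + c N *: b')) <= e.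
  move=> A1 A2.
  have -> : a + c N *: b - (a' + c N *: b') = (a - a') - c N *: (b' - b).
    by rewrite scalerBr; rewrite opprB opprD addrACA [in LHS](addrC (c N *: b)) addrC [RHS]addrC addrC [RHS]addrC (addrC (- _)).
  have := sip_young f (a - a') (c N *: (b' - b)) (@ltr01 R).
  have B2 : f (c N *: (b' - b)) (c N *: (b' - b)) <= e / 4.
    rewrite sipZl sipZr mulrA -expr2.
    move: A2; rewrite ler_pdivlMr// => A2.
    have := sip_ge0 f (b' - b); nra.
  rewrite (sip_sqrB f (a - a')) invr1 !mul1r => y.
  have := ler_norm (- f (a - a') (c N *: (b' - b))); rewrite normrN => n.
  lra.
exists (v + c N *: u), (VV + c N *: U); split.
- by apply: HD => //; exact: HZ.
- by rewrite big_ord_recr /=; exact: half.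
- by rewrite big_ord_recr /=; exact: half.
Qed.

(** The eigenvalue equation is tested with smooth functions only. [G n] is a limit of their
    gradients, jointly with [phi n], and both sides of the equation pass to the limit. *)
Lemma dir_eigen m n : dir (G m) (G n) = lam m * (m == n)%:R.
Proof.
apply/eqP; rewrite -subr_eq0 -normr_le0; apply/ler_addgt0Pr => e e0.
rewrite add0r.
have l0 : 0 < e / 2 by rewrite divr_gt0.
have l1 : 0 < `|lam m| + 1 by rewrite ltr_wpDl.
have [d1 d10 Hd1] := sip_small ip (phi m) (divr_gt0 l0 l1).
have [d2 d20 Hd2] := sip_small dir (G m) l0.
have dm : 0 < Num.min d1 d2 by rewrite lt_min d10.
have [u [U [h]]] := approx n dm.
rewrite !le_min => /andP[u1 _] /andP[_ u2].
have [A1 _] := Hd1 _ u1; have [A2 _] := Hd2 _ u2.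
rewrite -ortho (_ : dir (G m) (G n) - _ =
    dir (G m) (G n - U) - lam m * ip (phi m) (phi n - u)); last first.
  by rewrite !sipBr (eigen m h); ring.
apply: (le_trans (ler_normB _ _)); rewrite normrM [leRHS]splitr lerD//.
move: A1; rewrite ler_pdivlMr// => A1.
by have := normr_ge0 (ip (phi m) (phi n - u)); nra.
Qed.

Lemma lam_ge0 n : 0 <= lam n.
Proof. by have := sip_ge0 dir (G n); rewrite dir_eigen eqxx mulr1. Qed.

Let sip_comb (T : lmodType R) (f : semi_inner T) (g : nat -> T) (l : nat -> R)
    (c : nat -> R) N :
  (forall m n, f (g m) (g n) = l m * (m == n)%:R) ->
  f (\sum_(n < N) c n *: g n) (\sum_(n < N) c n *: g n) =
  \sum_(n < N) l n * c n ^+ 2.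
Proof.
move=> fg; rewrite sip_suml; apply: eq_bigr => i _.
rewrite sip_sumr (bigD1 i)//= sipZl sipZr fg eqxx big1 ?addr0.
  by rewrite mulr1; ring.
move=> j ji; rewrite sipZl sipZr fg -val_eqE/= in ji *.
by rewrite eq_sym (negbTE ji) !mulr0.
Qed.

Lemma norm_comb (c : nat -> R) N :
  ip (\sum_(n < N) c n *: phi n) (\sum_(n < N) c n *: phi n) = \sum_(n < N) c n ^+ 2.
Proof.
rewrite (@sip_comb _ _ _ (fun=> 1)) => [|m n]; last by rewrite mul1r ortho.
by apply: eq_bigr => i _; rewrite mul1r.
Qed.

Lemma sip_comb_coef v (c : nat -> R) N :
  ip v (\sum_(n < N) c n *: phi n) = \sum_(n < N) c n * ip v (phi n).
Proof. by rewrite sip_sumr; apply: eq_bigr => i _; rewrite sipZr. Qed.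

Lemma norm_sub_comb v (c : nat -> R) N :
  ip (v - \sum_(n < N) c n *: phi n) (v - \sum_(n < N) c n *: phi n) =
  \sum_(n < N) (ip v (phi n) - c n) ^+ 2 +
  (ip v v - \sum_(n < N) ip v (phi n) ^+ 2).
Proof.
rewrite sip_sqrB norm_comb sip_comb_coef.
rewrite [in RHS](eq_bigr (fun n : 'I_N => ip v (phi n) ^+ 2 +
  (- (2 * (c n * ip v (phi n))) + c n ^+ 2))); last by move=> i _; ring.
by rewrite !big_split /= sumrN -mulr_sumr; ring.
Qed.

Lemma bessel v N : \sum_(n < N) ip v (phi n) ^+ 2 <= ip v v.
Proof.
have := sip_ge0 ip (v - \sum_(n < N) ip v (phi n) *: phi n).
rewrite (norm_sub_comb v (fun n => ip v (phi n))) big1 ?add0r ?subr_ge0//.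
by move=> i _; rewrite subrr expr0n.
Qed.

(** The [G n] are orthogonal with squares lam_n and pair with U as lam_n times the coefficient of u;
    expanding the square of the residual gives the bound, also when some lam_n is 0. *)
Lemma dirichlet_bessel u U M : H u U ->
  \sum_(m < M) lam m * ip u (phi m) ^+ 2 <= dir U U.
Proof.
move=> h; have := sip_ge0 dir (U - \sum_(n < M) ip u (phi n) *: G n).
rewrite sip_sqrB (@sip_comb _ dir G lam (fun n => ip u (phi n)))//; last exact: dir_eigen.
rewrite sip_sumr (eq_bigr (fun n : 'I_M => lam n * ip u (phi n) ^+ 2)); first by lra.
by move=> i _; rewrite sipZr (sipC dir) (eigen _ h) (sipC ip (phi i)); ring.
Qed.

Variable mu : R.
Hypothesis mu0 : 0 < mu.

(** The minimum over b of l b^2 + mu (1 - b)^2, attained at b = mu / (l + mu): the contribution of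
    one mode to the infimum. *)
Definition kfun (l : R) := l * mu / (l + mu).

Let lmu n : 0 < lam n + mu.
Proof. by rewrite ltr_wpDl// lam_ge0. Qed.

Lemma kfun_lower w u U M : H u U ->
  \sum_(m < M) kfun (lam m) * ip w (phi m) ^+ 2 <=
  dir U U + mu * ip (w - u) (w - u).
Proof.
move=> h; have B1 := dirichlet_bessel M h; have B2 := bessel (w - u) M.
have B3 : mu * \sum_(n < M) ip (w - u) (phi n) ^+ 2 <= mu * ip (w - u) (w - u).
  by rewrite ler_pM2l.
apply: le_trans (lerD B1 B3); rewrite mulr_sumr -big_split /=.
apply: ler_sum => m _; rewrite sipBl.
set a := ip w _; set b := ip u _; have l0 := lam_ge0 m; have lm := lmu m.
rewrite /kfun mulrAC ler_pdivrMr//.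
(* This square is (l + mu) (l b^2 + mu (a - b)^2) - l mu a^2. *)
have := sqr_ge0 (lam m * b - mu * (a - b)).
by move: l0 mu0; set l := lam m => l0 m0; nra.
Qed.

(** The first [N] modes receive their optimal coefficients and the others 0, which costs mu times
    the missing mass of w. The combination is not smooth itself but lies in the closure of the
    graph, whence the error [e]. *)
Lemma kfun_attained w N e : 0 < e -> exists u U, H u U /\
  dir U U + mu * ip (w - u) (w - u) <=
  \sum_(n < N) kfun (lam n) * ip w (phi n) ^+ 2 +
  mu * (ip w w - \sum_(n < N) ip w (phi n) ^+ 2) + e.
Proof.
move=> e0; pose c n := mu / (lam n + mu) * ip w (phi n).
pose b := \sum_(n < N) c n *: phi n; pose B := \sum_(n < N) c n *: G n.
have e2 : 0 < e / 2 by rewrite divr_gt0.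
have [d1 d10 Hd1] := sip_small ip (b - w) (divr_gt0 e2 mu0).
have [d2 d20 Hd2] := sip_small dir B e2.
have dm : 0 < Num.min d1 d2 by rewrite lt_min d10.
have [u [U [h]]] := cls_sum c N dm.
rewrite -/b -/B !le_min => /andP[u1 _] /andP[_ u2].
have [_ A1] := Hd1 _ u1; have [_ A2] := Hd2 _ u2.
exists u, U; split => //.
rewrite [B + _]addrC subrK in A2.
have E (x y : V) : ip (x - y) (x - y) = ip (y - x) (y - x).
  by rewrite !sip_sqrB (sipC ip x y); ring.
rewrite (_ : b - w + (u - b) = u - w) in A1; last first.
  by rewrite addrC addrA subrK.
rewrite E (E b w) in A1.
have {}A1 : mu * ip (w - u) (w - u) <= mu * ip (w - b) (w - b) + e / 2.
  by rewrite -(ler_pM2l mu0) mulrDr mulrCA divff ?gt_eqF// mulr1 in A1.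
apply: (le_trans (lerD A2 A1)).
rewrite (@sip_comb _ dir G lam c)//; last exact: dir_eigen.
rewrite norm_sub_comb mulrDr mulr_sumr.
rewrite (eq_bigr (fun n : 'I_N => lam n * c n ^+ 2 + mu * (ip w (phi n) - c n) ^+ 2) (F1 := fun n : 'I_N => kfun (lam n) * _)).
  rewrite big_split/=; lra.
move=> n _; rewrite /kfun /c; field; by rewrite gt_eqF.
Qed.

(** A nearly optimal u for [w] is turned by the hypothesis into competitors for [w1] and [z], and
    the lower bound applies to these. [M] and [N] are independent: for a fixed partial sum on the
    left, [N] may grow until Parseval makes the last term negligible. *)
Lemma kfun_contraction w w1 z tau : 0 <= tau ->
  (forall u U e, H u U -> 0 < e -> exists x X y Y, [/\ H x X, H y Y,
     dir X X + tau * dir Y Y <= dir U U &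
     ip (w1 - x) (w1 - x) + tau * ip (z - y) (z - y) <= ip (w - u) (w - u) + e]) ->
  forall M N,
  \sum_(m < M) kfun (lam m) * (ip w1 (phi m) ^+ 2 + tau * ip z (phi m) ^+ 2) <=
  \sum_(n < N) kfun (lam n) * ip w (phi n) ^+ 2 +
  mu * (ip w w - \sum_(n < N) ip w (phi n) ^+ 2).
Proof.
move=> tau0 contr M N; apply/ler_addgt0Pr => e e0.
have e2 : 0 < e / 2 by rewrite divr_gt0.
have [u [U [h uU]]] := kfun_attained w N e2.
have [x [X [y [Y [hX hY XY xy]]]]] := contr _ _ _ h (divr_gt0 e2 mu0).
have kx := kfun_lower w1 M hX; have ky := kfun_lower z M hY.
rewrite (eq_bigr (fun m : 'I_M => kfun (lam m) * ip w1 (phi m) ^+ 2 +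
  tau * (kfun (lam m) * ip z (phi m) ^+ 2))); last by move=> i _; ring.
rewrite big_split /= -mulr_sumr.
have {}ky := ler_wpM2l tau0 ky.
have {}xy : mu * (ip (w1 - x) (w1 - x) + tau * ip (z - y) (z - y)) <=
    mu * ip (w - u) (w - u) + e / 2.
  by rewrite -(ler_pM2l mu0) [leRHS]mulrDr (mulrCA mu) divff ?gt_eqF// mulr1 in xy.
lra.
Qed.

End dirichlet_form.

(** * Completeness of L^2 and Parseval's identity *)

Lemma limn_einf_ub (R : realType) (u : (\bar R)^nat) (c : \bar R) :
  (forall n, (u n <= c)%E) -> (limn_einf u <= c)%E.
Proof.
move=> uc; rewrite limn_einf_lim; apply: lime_le; first exact: is_cvg_einfs.
apply: nearW => n; apply: le_trans (uc n).
by apply: ereal_inf_lbound; exists n => //=.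
Qed.

Lemma measurable_fun_limn_einf d (T : measurableType d) (R : realType)
    (D : set T) (f : (T -> \bar R)^nat) :
  (forall n, measurable_fun D (f n)) ->
  measurable_fun D (fun x => limn_einf (f ^~ x)).
Proof.
move=> mf; rewrite (_ : (fun x => _) = (fun x => - limn_esup (fun n => - f n x))%E).
  apply: measurableT_comp => //; apply: measurable_fun_limn_esup => n.
  exact: measurableT_comp.
apply/funext => x; rewrite -limn_einfN; congr limn_einf.
by apply/funext => n /=; rewrite oppeK.
Qed.

Section L2_complete.
Context d (T : measurableType d) (R : realType).
Variable mu : {measure set T -> \bar R}.

(** Weighted by 4^j, the squared increments still have integrals at most 4^-j, so their series is
    finite almost everywhere. At such points the increments are bounded by a multiple of 2^-j. *)
Lemma ae_cvg_fast (u : nat -> T -> R) : (forall j, measurable_fun setT (u j)) ->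
  (forall j, (\int[mu]_x ((u j.+1 x - u j x) ^+ 2)%:E <= (16 ^- j)%:E)%E) ->
  {ae mu, forall x, cvgn (u ^~ x)}.
Proof.
move=> mu_ uu.
pose a j x := (4 ^+ j * (u j.+1 x - u j x) ^+ 2)%:E.
pose h x := (\sum_(0 <= j <oo) a j x)%E.
have a0 j x : (0 <= a j x)%E by rewrite lee_fin mulr_ge0 ?sqr_ge0// exprn_ge0.
have msq j : measurable_fun setT (fun x => ((u j.+1 x - u j x) ^+ 2)%:E).
  by apply/measurable_EFinP; apply: measurable_funX; exact: measurable_funB.
have ma j : measurable_fun setT (a j).
  rewrite /a; under eq_fun do rewrite EFinM.
  exact: measurable_funeM.
have mh : measurable_fun setT h.
  by apply: ge0_emeasurable_sum => // *; exact: a0.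
have ih : (\int[mu]_x h x < +oo)%E.
  rewrite integral_nneseries//.
  apply: (@le_lt_trans _ _ (2%:R%:E)); last exact: ltry.
  apply: le_trans (epsilon_trick0 xpredT (ler0n R 2)).
  apply: lee_nneseries => [j _ _|j _]; first exact: integral_ge0.
  rewrite /a; under eq_integral do rewrite EFinM.
  rewrite ge0_integralZl_EFin ?exprn_ge0//; last by move=> x _; rewrite lee_fin sqr_ge0.
  apply: (@le_trans _ _ ((4 ^+ j)%:E * (16 ^- j)%:E)%E).
    by apply: lee_wpmul2l => //; rewrite lee_fin exprn_ge0.
  rewrite -EFinM lee_fin natrX exprS invfM mulrA divff// mul1r.
  rewrite (_ : 16 = 4 * 4); last by rewrite -natrM.
  rewrite exprMn invfM mulrA divff ?expf_neq0// mul1r.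
  by rewrite lef_pV2 ?posrE ?exprn_gt0// lerXn2r ?nnegrE// ler_nat.
have hint : mu.-integrable setT h.
  apply/integrableP; split => //.
  under eq_integral => x _ do rewrite gee0_abs ?nneseries_ge0//.
  exact: ih.
have := integrable_ae measurableT hint; apply: filterS => x /(_ I) hx.
have C0 : 0 <= fine (h x) by rewrite fine_ge0// nneseries_ge0.
have bound j : `|telescope (u ^~ x) j| <= geometric (Num.sqrt (fine (h x))) 2^-1 j.
  rewrite /telescope /geometric /=.
  rewrite -(@ler_pXn2r _ 2)// ?nnegrE ?mulr_ge0 ?sqrtr_ge0 ?exprn_ge0 ?invr_ge0//.
  rewrite real_normK ?num_real// exprMn sqr_sqrtr//.
  have : (a j x <= h x)%E.
    apply: (@le_trans _ _ (\sum_(0 <= i < j.+1) a i x)%E); last exact: nneseries_lim_ge.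
    by rewrite big_nat_recr//= leeDr// sume_ge0.
  rewrite -(fineK hx) lee_fin => ajh.
  rewrite (_ : (2^-1 ^+ j) ^+ 2 = (4 ^+ j)^-1 :> R); last first.
    by rewrite -exprM mulnC exprM exprVn -natrX exprVn.
  by rewrite ler_pdivlMr ?exprn_gt0// mulrC.
have cu : cvgn (series (telescope (u ^~ x))).
  apply: normed_cvg; apply: series_le_cvg bound _ => //.
    by move=> n; rewrite mulr_ge0 ?sqrtr_ge0// exprn_ge0// invr_ge0.
  by apply: is_cvg_geometric_series; rewrite ger0_norm ?invr_ge0// invf_lt1// ltr1n.
move: cu; rewrite telescopeK => /cvg_ex[l ul]; apply/cvg_ex; exists (l + u 0%N x).
rewrite (_ : u ^~ x = (fun n => [sequence u n x - u 0%N x]_n n + u 0%N x)).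
  by apply: cvgD => //; exact: cvg_cst.
by apply/funext => n /=; rewrite subrK.
Qed.

Lemma L2_complete (u : nat -> T -> R) : (forall j, measurable_fun setT (u j)) ->
  (forall i j, (j <= i)%N ->
    (\int[mu]_x ((u i x - u j x) ^+ 2)%:E <= (16 ^- j)%:E)%E) ->
  exists2 g : T -> R, measurable_fun setT g &
    forall j, (\int[mu]_x ((g x - u j x) ^+ 2)%:E <= (16 ^- j)%:E)%E.
Proof.
move=> mu_ uu.
have cu : {ae mu, forall x, cvgn (u ^~ x)}.
  by apply: ae_cvg_fast => // j; exact: uu.
(* The upper limit is measurable on the whole space and equals the limit almost everywhere. *)
pose g x := fine (limn_esup (fun j => (u j x)%:E)).
have mg : measurable_fun setT g.
  apply: measurableT_comp => //; apply: measurable_fun_limn_esup => j.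
  exact/measurable_EFinP.
exists g => // j.
have msq (v : T -> R) : measurable_fun setT v ->
    measurable_fun setT (fun x => ((v x - u j x) ^+ 2)%:E).
  by move=> mv; apply/measurable_EFinP; apply: measurable_funX; exact: measurable_funB.
have mf i : measurable_fun setT (fun x => ((u (i + j)%N x - u j x) ^+ 2)%:E).
  exact: msq.
have f0 i x : (0 <= ((u (i + j)%N x - u j x) ^+ 2)%:E)%E by rewrite lee_fin sqr_ge0.
(* Fatou's lemma for the sequence shifted by [j], so that the assumed bound holds for every term. *)
have := fatou mu measurableT mf (fun n x _ => f0 n x).
move=> /le_trans/(_ (limn_einf_ub _)) -/(_ _ (fun n => uu _ _ (leq_addl n j))).
apply: le_trans; apply: ae_ge0_le_integral => //.
- by move=> x _; rewrite lee_fin sqr_ge0.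
- exact: msq.
- move=> x _; rewrite limn_einf_lim; apply: lime_ge; first exact: is_cvg_einfs.
  by apply: nearW => n; apply: le_ereal_inf_tmp => _ [i _ <-].
- exact: measurable_fun_limn_einf.
- apply: filterS cu => x ux _.
  have gx : u n x @[n --> \oo] --> g x.
    have ue : (u n x)%:E @[n --> \oo] --> (limn (u ^~ x))%:E by apply: cvg_EFin; [exact: nearW|exact: ux].
    by rewrite /g (cvg_limn_einf_sup ue).2.
  have ge : ((u (n + j)%N x - u j x) ^+ 2)%:E @[n --> \oo] --> ((g x - u j x) ^+ 2)%:E.
    apply: cvg_EFin; first exact: nearW.
    have gg : u (n + j)%N x - u j x @[n --> \oo] --> g x - u j x.
      by apply: cvgB; [rewrite (cvg_shiftn j (u ^~ x))|exact: cvg_cst].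
    exact: (cvgM gg gg).
  by rewrite (cvg_limn_einf_sup ge).1.
Qed.

End L2_complete.

Section L2_inner.
Context d (T : measurableType d) (R : realType).
Variable mu : {measure set T -> \bar R}.
Local Notation V := (LfunType mu (lee1n 2)).
Implicit Types u v w : V.

Lemma L2_measurable u : measurable_fun setT u.
Proof. by case/(Lfun2E mu): (LfunP u). Qed.

Lemma L2_integrableM u v : mu.-integrable setT (fun x => (u x * v x)%:E).
Proof. by apply/Lfun1_integrable; apply: Lfun2_mul_Lfun1; exact: LfunP. Qed.

Definition L2form u v : R := \int[mu]_x (u x * v x).

Let L2formC u v : L2form u v = L2form v u.
Proof. by apply: eq_Rintegral => x _; rewrite mulrC. Qed.

Let L2formDl u v w : L2form (u + v) w = L2form u w + L2form v w.
Proof.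
rewrite /L2form -RintegralD//; try exact: L2_integrableM.
by apply: eq_Rintegral => x _; rewrite mulrDl.
Qed.

Let L2formZl a u v : L2form (a *: u) v = a * L2form u v.
Proof.
rewrite /L2form -RintegralZl//; last exact: L2_integrableM.
by apply: eq_Rintegral => x _; rewrite mulrA.
Qed.

Let L2form_ge0 u : 0 <= L2form u u.
Proof. by apply: Rintegral_ge0 => x _; rewrite -expr2 sqr_ge0. Qed.

Definition L2ip : semi_inner V :=
  SemiInner L2formC L2formDl L2formZl L2form_ge0.

Lemma L2ip_sqr u : ((L2ip u u)%:E = \int[mu]_x (u x ^+ 2)%:E)%E.
Proof.
rewrite /sip /= /L2form /Rintegral fineK; first by apply: eq_integral.
exact: integrable_fin_num (L2_integrableM u u).
Qed.

Lemma L2ip_ae u v w : u = v %[ae mu] -> L2ip u w = L2ip v w.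
Proof.
move=> uv; congr fine; apply: ae_eq_integral => //.
- by have /integrableP[] := L2_integrableM u w.
- by have /integrableP[] := L2_integrableM v w.
- by apply: filterS uv => x /= uvx /uvx ->.
Qed.

Lemma L2ip_le (a b c : R) u1 u2 u3 u4 :
  (forall x, u1 x ^+ 2 + a * u2 x ^+ 2 <= b * u3 x ^+ 2 + c * u4 x ^+ 2) ->
  L2ip u1 u1 + a * L2ip u2 u2 <= b * L2ip u3 u3 + c * L2ip u4 u4.
Proof.
move=> h; rewrite /sip /= /L2form -!RintegralZl//; try exact: L2_integrableM.
have iZ (e : R) u : mu.-integrable setT (fun x => (e * (u x * u x))%:E).
  by have := integrableZl measurableT e (L2_integrableM u u).
rewrite -!RintegralD//; try exact: L2_integrableM; try exact: iZ.
apply: le_Rintegral => //.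
- by have := integrableD measurableT (L2_integrableM u1 u1) (iZ a u2).
- by have := integrableD measurableT (iZ b u3) (iZ c u4).
- by move=> x _; rewrite -!expr2.
Qed.

Section parseval.
Variable phi : nat -> V.
Hypothesis ortho : forall m n, L2ip (phi m) (phi n) = (m == n)%:R.
Hypothesis complete : forall v, (forall n, L2ip v (phi n) = 0) ->
  (v : T -> R) = cst 0 %[ae mu].

Let t w N := \sum_(n < N) L2ip w (phi n) ^+ 2.

Let t_nd w : nondecreasing_seq (t w).
Proof.
apply/nondecreasing_seqP => n; rewrite /t big_ord_recr/= lerDl.
exact: sqr_ge0.
Qed.

Let t_cauchy w e : 0 < e -> exists N, forall M, (N <= M)%N -> t w M - t w N <= e.
Proof.
move=> e0.
have tc : cvgn (t w).
  apply: nondecreasing_is_cvgn; first exact: t_nd.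
  by exists (L2ip w w) => _ [n _ <-]; exact: bessel ortho _ _.
have lt0 : limn (t w) - e < limn (t w) by rewrite gtrBl.
have [N _ HN] := cvgr_gt _ tc _ lt0.
exists N => M NM; have := HN N (leqnn N).
have := nondecreasing_cvgn_le (t_nd w) tc M.
by rewrite /=; lra.
Qed.

(** [complete] only says that what is orthogonal to all [phi n] vanishes, so the partial sums need
    an actual limit. That limit has the coefficients of [w], hence equals [w] almost everywhere, and
    the remainder is its distance to a partial sum. *)
Lemma parseval w e : 0 < e -> exists N, L2ip w w - \sum_(n < N) L2ip w (phi n) ^+ 2 <= e.
Proof.
move=> e0.
have p16 j : 0 < (16 ^- j : R) by rewrite invr_gt0 exprn_gt0.
(* From these indices on the coefficients add at most 16^-j, the rate that [L2_complete] asks for.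
   [N] makes them nondecreasing with j <= N j, so that each coefficient is eventually included. *)
pose N0 j := projT1 (cid (t_cauchy w (p16 j))).
have HN0 j M : (N0 j <= M)%N -> t w M - t w (N0 j) <= 16 ^- j.
  exact: (projT2 (cid (t_cauchy w (p16 j)))).
pose N := fix N j := if j is j'.+1 then maxn (N j').+1 (N0 j) else N0 0%N.
have N_ge j : (N0 j <= N j)%N by case: j => [|j] //=; exact: leq_maxr.
have N_id j : (j <= N j)%N.
  elim: j => // j IH; rewrite /= leq_max ltnS IH//.
have N_nd i j : (i <= j)%N -> (N i <= N j)%N.
  move=> /subnK <-; elim: (j - i)%N => // m IH; rewrite addSn /=.
  by rewrite (leq_trans IH)// (leq_trans (leqnSn _))// leq_maxl.
pose u j := \sum_(n < N j) L2ip w (phi n) *: phi n.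
have uE j v : L2ip v (u j) = \sum_(n < N j) L2ip w (phi n) * L2ip v (phi n).
  exact: (sip_comb_coef _ _ v (fun n => L2ip w (phi n))).
have u_phi j m : (m < N j)%N -> L2ip (u j) (phi m) = L2ip w (phi m).
  move=> mN; rewrite sipC uE (bigD1 (Ordinal mN))//= ortho eqxx mulr1 big1 ?addr0//.
  by move=> i; rewrite -val_eqE/= ortho eq_sym => /negbTE ->; rewrite mulr0.
have uu i j : (j <= i)%N -> L2ip (u i - u j) (u i - u j) <= 16 ^- j.
  move=> ji; rewrite sip_sqrB.
  have uij k : (j <= k)%N -> L2ip (u k) (u j) = t w (N j).
    move=> jk; rewrite uE; apply: eq_bigr => n _; rewrite u_phi ?expr2//.
    exact: leq_trans (ltn_ord n) (N_nd _ _ jk).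
  rewrite uij// uij//.
  have -> : L2ip (u i) (u i) = t w (N i).
    by rewrite uE; apply: eq_bigr => n _; rewrite u_phi ?expr2.
  have := HN0 j (N i) (leq_trans (N_ge j) (N_nd _ _ ji)).
  have := t_nd w (N_ge j); lra.
have [g mg gu] : exists2 g : T -> R, measurable_fun setT g &
    forall j, (\int[mu]_x ((g x - u j x) ^+ 2)%:E <= (16 ^- j)%:E)%E.
  apply: L2_complete => [j|i j ji]; first exact: L2_measurable.
  by rewrite -(L2ip_sqr (u i - u j)) lee_fin uu.
have gL : (g \- u 0%N) \in Lfun mu 2%:E.
  apply/Lfun2E; split; first by apply: measurable_funB => //; exact: L2_measurable.
  exact: le_lt_trans (gu 0%N) (ltry _).
(* Only g - u_0 is known to be square integrable, so g is rebuilt from it. *)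
pose gV : V := (Lfun_Sub (lee1n 2) gL : V) + u 0%N.
have gVE x : gV x = g x by exact: subrK.
have gVu j : L2ip (gV - u j) (gV - u j) <= 16 ^- j.
  rewrite -lee_fin L2ip_sqr; apply: le_trans (gu j).
  rewrite le_eqVlt; apply/orP; left; apply/eqP; apply: eq_integral => x _.
  by rewrite -gVE.
have small dlt : 0 < dlt -> \forall j \near \oo, (16 ^- j : R) <= dlt.
  move=> dlt0.
  have : 16^-1 ^+ n @[n --> \oo] --> (0 : R).
    by apply: cvg_expr; rewrite ger0_norm ?invr_ge0// invf_lt1// ltr1n.
  move=> /cvgr0_norm_le/(_ _ dlt0); apply: filterS => n /=.
  by rewrite exprVn ger0_norm// invr_ge0 exprn_ge0.
have gphi m : L2ip gV (phi m) = L2ip w (phi m).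
  apply/eqP; rewrite -subr_eq0 -normr_le0; apply/ler_addgt0Pr => e1 e10.
  rewrite add0r; have [dlt d0 Hd] := sip_small L2ip (phi m) e10.
  have [j0 _ Hj0] := small _ d0.
  pose j := maxn j0 m.+1.
  have [H _] := Hd _ (le_trans (gVu j) (Hj0 j (leq_maxl _ _))).
  by move: H; rewrite sipC sipBl u_phi// (leq_trans _ (N_id j))// leq_maxr.
have wg : (w : T -> R) = gV %[ae mu].
  have : ((w - gV : V) : T -> R) = cst 0 %[ae mu].
    by apply: complete => n; rewrite sipBl gphi subrr.
  by apply: filterS => x /= /[apply] /eqP; rewrite subr_eq0 => /eqP.
have [j0 _ Hj0] := small _ e0; exists (N j0).
have := le_trans (gVu j0) (Hj0 j0 (leqnn _)).
have -> : L2ip (gV - u j0) (gV - u j0) = L2ip (w - u j0) (w - u j0).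
  have E : ((w - u j0 : V) : T -> R) = (gV - u j0 : V) %[ae mu].
    by apply: filterS wg => x /= wx _; rewrite [LHS](_ : _ = w x - u j0 x)// wx.
  by rewrite [RHS](L2ip_ae _ E) [RHS]sipC [RHS](L2ip_ae _ E).
rewrite /u (norm_sub_comb ortho w (fun n => L2ip w (phi n))).
by rewrite big1 ?add0r// => i _; rewrite subrr expr0n.
Qed.

End parseval.
End L2_inner.

(** * Truncation in the spectral norm *)

Section bounded_domain.
Context {R : realType} {d : nat} (Omega : lipschitz_domain R d).
Local Notation E := 'rV[R]_d.
Local Notation leb := (lebesgue_measure_rV R d).
Local Notation oO := (domain_open Omega).
Local Notation mu := (leb_on oO).

Lemma leb_domain_lty : (leb Omega < +oo)%E.
Proof. by apply: leb_bounded; [exact: open_measurable_mx oO|exact: domain_bounded]. Qed.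

Lemma leb_on_lty : (mu setT < +oo)%E.
Proof. by rewrite /leb_on /= /mrestr setTI leb_domain_lty. Qed.

Lemma Lfun2_bounded (f : E -> R) C : measurable_fun setT f ->
  (forall x, `|f x| <= C) -> f \in Lfun mu 2%:E.
Proof.
move=> mf fC; apply/Lfun2E; split => //.
apply: (@le_lt_trans _ _ (\int[mu]_x (C ^+ 2)%:E)%E).
  apply: ge0_le_integral => //.
  - by move=> x _; rewrite lee_fin sqr_ge0.
  - by apply/measurable_EFinP; exact: measurable_funX.
  - move=> x _; rewrite lee_fin -real_normK ?num_real//.
    by rewrite lerXn2r ?nnegrE// (le_trans _ (fC x)).
rewrite integral_cst// lte_mul_pinfty ?lee_fin ?sqr_ge0//.
exact: leb_on_lty.
Qed.

Lemma test_function_Lfun2 psi : test_function Omega psi -> psi \in Lfun mu 2%:E.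
Proof.
move=> tp; have [C _ psiC] := test_function_bounded tp.
apply: Lfun2_bounded psiC; apply: measurable_continuous_mx.
exact: test_function_continuous tp.
Qed.

Lemma test_derive_Lfun2 psi i : test_function Omega psi ->
  'D_(delta_mx 0 i) psi \in Lfun mu 2%:E.
Proof.
move=> tp; have [C _ psiC] := test_derive_bounded i tp.
apply: Lfun2_bounded psiC; apply: measurable_continuous_mx.
exact: test_function_continuousD tp.
Qed.

End bounded_domain.

Section spectral.
Context {R : realType} {d : nat} (s : R) (Omega : lipschitz_domain R d).
Local Notation E := 'rV[R]_d.
Local Notation leb := (lebesgue_measure_rV R d).
Local Notation oO := (domain_open Omega).
Local Notation mu := (leb_on oO).
Local Notation V := (LfunType mu (lee1n 2)).
Local Notation W := {ffun 'I_d -> V}.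

Let toV (f : E -> R) (Hf : f \in Lfun mu 2%:E) : V := Lfun_Sub (lee1n 2) Hf.

Definition dir_form (F G : W) : R := \sum_i L2ip mu (F i) (G i).

Let dirC F G : dir_form F G = dir_form G F.
Proof. by apply: eq_bigr => i _; rewrite sipC. Qed.

Let dirDl F G K : dir_form (F + G) K = dir_form F K + dir_form G K.
Proof.
by rewrite /dir_form -big_split/=; apply: eq_bigr => i _; rewrite ffunE sipDl.
Qed.

Let dirZl a F G : dir_form (a *: F) G = a * dir_form F G.
Proof.
by rewrite /dir_form mulr_sumr; apply: eq_bigr => i _; rewrite ffunE sipZl.
Qed.

Let dir_ge0 F : 0 <= dir_form F F.
Proof. by apply: sumr_ge0 => i _; exact: sip_ge0. Qed.

Definition dir : semi_inner W := SemiInner dirC dirDl dirZl dir_ge0.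

Definition gradient_graph (u : V) (U : W) : Prop :=
  test_function Omega u /\ forall i x, U i x = 'D_(delta_mx 0 i) (u : E -> R) x.

Lemma gradient_graphD u U v VV : gradient_graph u U -> gradient_graph v VV ->
  gradient_graph (u + v) (U + VV).
Proof.
move=> [tu Uu] [tv Vv]; split; first exact: test_functionD.
move=> i x; rewrite ffunE [LHS](_ : _ = U i x + VV i x)// Uu Vv.
by rewrite -deriveD//; [exact: test_function_derivable tu|exact: test_function_derivable tv].
Qed.

Lemma gradient_graph_tower h u U : derivative_tower h -> h 0%N 0 = 0 ->
  gradient_graph u U -> exists (x : V) (X : W), [/\ gradient_graph x X,
    forall y, x y = h 0%N (u y) & forall i y, X i y = h 1%N (u y) * U i y].
Proof.
move=> hh h0 [tu Uu].
have tx := test_function_comp hh h0 tu.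
have DX i := test_derive_Lfun2 i tx.
exists (toV (test_function_Lfun2 tx)), [ffun i => toV (DX i)].
have DE i y : [ffun i => toV (DX i)] i y = h 1%N (u y) * U i y.
  by rewrite ffunE /= Uu -(derive_tower_comp _ _ hh tu).
by split => //; split => // i y; rewrite ffunE.
Qed.

Lemma gradient_graphZ a u U : gradient_graph u U -> gradient_graph (a *: u) (a *: U).
Proof.
move=> gu; have [|x [X [[tx Xx] xE XE]]] := gradient_graph_tower (linear_towerP a) _ gu.
  by rewrite /= mulr0.
have xaE : x = a *: u by apply/LfuneqP => y; rewrite xE.
rewrite -xaE; split => // i y; rewrite -Xx XE /= ffunE.
by rewrite [LHS](_ : _ = a * U i y).
Qed.

Section truncation.
Variables (k t : R).
Hypotheses (k0 : 0 <= k) (t01 : 0 <= t <= 1).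

Lemma excess_Lfun2 w : w \in Lfun mu 2%:E ->
  (fun x => excess k (w x)) \in Lfun mu 2%:E.
Proof.
move=> /Lfun2E[mw wy]; apply/Lfun2E; split; first exact: measurable_excess.
apply: le_lt_trans wy; apply: ge0_le_integral => //.
- by move=> x _; rewrite lee_fin sqr_ge0.
- by apply/measurable_EFinP; apply: measurable_funX; exact: measurable_excess.
- by apply/measurable_EFinP; exact: measurable_funX.
- move=> x _; rewrite lee_fin -[leRHS]real_normK ?num_real//.
  by rewrite lerXn2r ?nnegrE ?excess_ge0// excess_le_norm.
Qed.

(** This is the hypothesis of [kfun_contraction]. The truncation of a test function is not smooth,
    so a smooth [h] close to it is composed with u; its slope in [0,1] controls the gradients
    exactly, and its distance to the excess is paid for by [e]. *)
Lemma gradient_graph_excess (w z : V) :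
  (forall x, z x = excess k (w x)) ->
  forall u U e, gradient_graph u U -> 0 < e -> exists x X y Y,
  [/\ gradient_graph x X, gradient_graph y Y,
     dir X X + (2 * t - t ^+ 2) * dir Y Y <= dir U U &
     L2ip mu (w - t *: z - x) (w - t *: z - x) +
       (2 * t - t ^+ 2) * L2ip mu (z - y) (z - y) <=
     L2ip mu (w - u) (w - u) + e].
Proof.
move=> zE u U e gu e0; case/andP: t01 => t0 t1.
pose N := L2ip mu (w - u) (w - u).
have N0 : 0 <= N by exact: sip_ge0.
have [C1 C1P] : exists one : V, forall x, one x = 1.
  have h1 : cst (1 : R) \in Lfun mu 2%:E.
    by apply: (@Lfun2_bounded _ _ _ _ 1) => // x; rewrite /= normr1.
  by exists (toV h1).
pose M := L2ip mu C1 C1.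
have M0 : 0 <= M by exact: sip_ge0.
(* [c] is the accuracy of the smoothing. The resulting error is at most 2 c N + 4 c M <= e, where
   [M] is the measure of the domain; c <= 1 allows r^2 to be bounded by c. *)
pose c := Num.min 1 (e / (4 * (N + M + 1))).
have K0 : 0 < 4 * (N + M + 1) by rewrite mulr_gt0// ltr_wpDl// addr_ge0.
have c0 : 0 < c by rewrite lt_min ltr01 divr_gt0.
have c1 : c <= 1 by rewrite ge_min lexx.
have ce : c * (4 * (N + M + 1)) <= e.
  by rewrite -ler_pdivlMr// ge_min lexx orbT.
have [h [hh h0 h1 he]] := smooth_excess k0 c0.
have [y [Y [gy yE YE]]] := gradient_graph_tower hh h0 gu.
have gx := gradient_graphD gu (gradient_graphZ (- t) gy).
exists (u - t *: y), (U - t *: Y), y, Y; split => //.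
- by move: gx; rewrite !scaleNr.
- have -> : dir (U - t *: Y) (U - t *: Y) + (2 * t - t ^+ 2) * dir Y Y =
      \sum_i (L2ip mu ((U - t *: Y) i) ((U - t *: Y) i) +
         (2 * t - t ^+ 2) * L2ip mu (Y i) (Y i)).
    by rewrite big_split/= -mulr_sumr.
  apply: ler_sum => i _.
  have := @L2ip_le _ _ _ mu (2 * t - t ^+ 2) 1 0 ((U - t *: Y) i) (Y i) (U i) 0.
  rewrite mul1r mul0r addr0; apply => v.
  have -> : (U - t *: Y) i v = U i v - t * Y i v by rewrite !ffunE.
  rewrite mul1r mul0r addr0 YE.
  have /andP[] := h1 (u v); set a := h 1%N _; set b := U i v => a0 a1.
  (* With slope a, (1 - t a)^2 + (2t - t^2) a^2 = 1 - 2t a (1 - a). *)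
  have : 0 <= (2 * t * (a * (1 - a))) * b ^+ 2.
    by rewrite mulr_ge0 ?sqr_ge0// !mulr_ge0 ?subr_ge0.
  nra.
- have := @L2ip_le _ _ _ mu (2 * t - t ^+ 2) (1 + 2 * c) (4 * c)
     (w - t *: z - (u - t *: y)) (z - y) (w - u) C1.
  move=> /(_ _)/le_trans; apply; last first.
    rewrite -/N -/M; nra.
  move=> v.
  have -> : (w - t *: z - (u - t *: y)) v = (w v - t * z v) - (u v - t * y v) by [].
  have -> : (z - y) v = z v - y v by [].
  have -> : (w - u) v = w v - u v by [].
  rewrite C1P zE yE.
  have B1 := excess_sqr_le k (w v) (u v).
  have := he (u v); rewrite distrC.
  have -> : excess k (w v) - h 0%N (u v) = excess k (w v) - excess k (u v) +
     (excess k (u v) - h 0%N (u v)) by ring.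
  have -> : w v - t * excess k (w v) - (u v - t * h 0%N (u v)) = (w v - u v) -
     t * ((excess k (w v) - excess k (u v)) + (excess k (u v) - h 0%N (u v))) by ring.
  move: B1; set A := w v - u v; set B := excess k (w v) - _; set r := excess k (u v) - _.
  move=> AB rc.
  have S1 := sqr_sub_excess t0 AB.
  have r2 : r ^+ 2 <= c ^+ 2.
    by rewrite -(real_normK (num_real r)) lerXn2r ?nnegrE// ltW.
  (* The smoothing error [r] contributes 2t r (2B - A) + 2t r^2. Since B^2 <= AB gives |2B - A| <=
     |A|, this is at most 3c + c A^2. *)
  have err : (A - t * (B + r)) ^+ 2 + (2 * t - t ^+ 2) * (B + r) ^+ 2 =
    (A - t * B) ^+ 2 + (2 * t - t ^+ 2) * B ^+ 2 +
    (2 * t * (r * (2 * B - A)) + 2 * (t * r ^+ 2)) by ring.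
  have BA : `|2 * B - A| <= `|A|.
    rewrite -ler_sqr ?nnegrE// !real_normK ?num_real//; nra.
  have rA : `|r * (2 * B - A)| <= c * `|A| by rewrite normrM ler_pM.
  have A2 : 2 * `|A| <= 1 + A ^+ 2.
    by rewrite -(real_normK (num_real A)); have := sqr_ge0 (`|A| - 1); nra.
  have := ler_norm (r * (2 * B - A)) => n1.
  have n2 : 2 * t * (r * (2 * B - A)) <= 2 * (c * `|A|).
    have Q0 : 0 <= c * `|A| by rewrite mulr_ge0// ltW.
    have h2 := ler_wpM2l t0 (le_trans n1 rA); have h3 := ler_piMl Q0 t1.
    lra.
  have n3 : t * r ^+ 2 <= c.
    apply: (@le_trans _ _ (r ^+ 2)); first by rewrite ler_piMl// sqr_ge0.
    by apply: (le_trans r2); rewrite expr2 ler_piMl// ltW.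
  have n4 : 2 * (c * `|A|) <= c * (1 + A ^+ 2) by rewrite mulrCA ler_wpM2l// ltW.
  have cA : 0 <= c * A ^+ 2 by rewrite mulr_ge0 ?sqr_ge0// ltW.
  rewrite err expr1n; lra.
Qed.

End truncation.
End spectral.

Lemma L2ip_Lnorm d (T : measurableType d) (R : realType)
    (mu : {measure set T -> \bar R}) (u : LfunType mu (lee1n 2)) (e : R) :
  e <= 1 -> ('N[mu]_2%:E[EFin \o u] < e%:E)%E -> L2ip mu u u <= e.
Proof.
move=> e1 ue; rewrite -lee_fin L2ip_sqr -Lnorm2_sqr.
have N0 := Lnorm_ge0 mu 2%:E (EFin \o u).
have Nfin : ('N[mu]_2%:E[EFin \o u])%E \is a fin_num.
  by rewrite ge0_fin_numE// (lt_trans ue) ?ltry.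
rewrite -(fineK Nfin) in N0 ue *.
rewrite !lee_fin lte_fin in N0 ue *.
rewrite powR_mulrn// expr2.
have e0 := le_lt_trans N0 ue.
by apply: (le_trans (ler_pM N0 N0 (ltW ue) (ltW ue))); rewrite ler_piMl// ltW.
Qed.

Section eigenbasis.
Context {R : realType} {d : nat} (s : R) (Omega : lipschitz_domain R d).
Hypothesis s01 : 0 < s < 1.
Local Notation E := 'rV[R]_d.
Local Notation leb := (lebesgue_measure_rV R d).
Local Notation oO := (domain_open Omega).
Local Notation mu := (leb_on oO).
Local Notation V := (LfunType mu (lee1n 2)).
Local Notation W := {ffun 'I_d -> V}.
Variables (phi : nat -> E -> R) (lam : nat -> R).
Hypothesis basis : dirichlet_eigenbasis oO phi lam.

Lemma coef_L2ip (u : V) (n : nat) (v : V) : (v : E -> R) = phi n ->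
  coef Omega phi u n = L2ip mu u v.
Proof.
move=> vE; rewrite /coef -vE; congr fine; rewrite integral_mrestr//.
by apply/measurable_EFinP; apply: measurable_funM; exact: L2_measurable.
Qed.

(** Carries the eigenbasis into the abstract setting: functions become elements of L^2, and
    membership in H^1_0 becomes joint approximation of function and gradient by test functions. *)
Lemma eigenbasis_data : exists (phiV : nat -> V) (G : nat -> W),
  [/\ forall n, (phiV n : E -> R) = phi n,
      forall n e, 0 < e -> exists u U, [/\ gradient_graph u U,
        L2ip mu (phiV n - u) (phiV n - u) <= e & dir Omega (G n - U) (G n - U) <= e],
      forall n u U, gradient_graph u U ->
        dir Omega (G n) U = lam n * L2ip mu (phiV n) u,
      forall m n, L2ip mu (phiV m) (phiV n) = (m == n)%:R &
      forall v, (forall n, L2ip mu v (phiV n) = 0) ->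
        (v : E -> R) = cst 0 %[ae mu]].
Proof.
have [eig orth compl] := basis.
have phiL n : phi n \in Lfun mu 2%:E by case: (eig n) => G [].
pose phiV n : V := Lfun_Sub (lee1n 2) (phiL n).
have GE n : exists G : W, 
    (forall e, 0 < e -> exists u U, [/\ gradient_graph u U,
        L2ip mu (phiV n - u) (phiV n - u) <= e & dir Omega (G - U) (G - U) <= e]) /\
    forall u U, gradient_graph u U -> dir Omega G U = lam n * L2ip mu (phiV n) u.
  have [G [_ GL _ happ] heig] := eig n.
  pose GV : W := [ffun i => Lfun_Sub (lee1n 2) (GL i) : V].
  exists GV; split.
    move=> e e0.
    (* The bound 1 lets a norm below e1 have a square below e1; the divisor d + 1 is positive and
       covers the d gradient components. *)
    pose e1 := Num.min 1 (e / d.+1%:R).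
    have e10 : 0 < e1 by rewrite lt_min ltr01 divr_gt0.
    have e11 : e1 <= 1 by rewrite ge_min lexx.
    have e1e : e1 * d.+1%:R <= e by rewrite -ler_pdivlMr// ge_min lexx orbT.
    have e1e' : e1 <= e.
      by apply: le_trans e1e; rewrite ler_peMr ?ler1n// ltW.
    have [psi tpsi small] := happ _ e10.
    pose u : V := Lfun_Sub (lee1n 2) (test_function_Lfun2 tpsi).
    pose U : W := [ffun i => Lfun_Sub (lee1n 2) (test_derive_Lfun2 i tpsi) : V].
    have s0 (i : 'I_d) : (0 <= 'N[mu]_2%:E[EFin \o (G i \- 'D_(delta_mx 0 i) psi)%R])%E.
      exact: Lnorm_ge0.
    exists u, U; split.
    - by split => // i x; rewrite ffunE.
    - apply: le_trans e1e'; apply: L2ip_Lnorm => //.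
      by apply: le_lt_trans small; rewrite leeDl// sume_ge0.
    - apply: le_trans e1e; rewrite mulr_natr.
      apply: (@le_trans _ _ (\sum_(i < d) e1)); last first.
        by rewrite sumr_const card_ord ler_wpMn2l// ltW.
      apply: ler_sum => i _; apply: L2ip_Lnorm => //.
      rewrite (_ : _ \o _ = EFin \o (G i \- 'D_(delta_mx 0 i) psi)); last first.
        by apply/funext => x; rewrite /= !ffunE.
      apply: le_lt_trans small; rewrite (bigD1 i)//= addeCA leeDl//.
      by rewrite adde_ge0 ?Lnorm_ge0// sume_ge0.
  move=> u U [tu Uu]; have := heig _ tu.
  rewrite (_ : \int[leb]_(x in Omega) (phi n x * u x) = L2ip mu (phiV n) u).
    move=> <-; apply: eq_bigr => i _.
    congr fine; rewrite integral_mrestr; last first.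
      by apply/measurable_EFinP; apply: measurable_funM; exact: L2_measurable.
    by apply: eq_integral => x _; rewrite ffunE Uu.
  congr fine; rewrite integral_mrestr//.
  by apply/measurable_EFinP; apply: measurable_funM; exact: L2_measurable.
exists phiV, (fun n => projT1 (cid (GE n))); split => //.
- by move=> n; case: (projT2 (cid (GE n))).
- by move=> n; case: (projT2 (cid (GE n))).
- by move=> m n; rewrite -orth -(@coef_L2ip _ n (phiV n))// /coef.
- move=> v v0; apply: compl; first exact: LfunP.
  by move=> n; have := @coef_L2ip v n (phiV n) erefl; rewrite v0.
Qed.

Lemma eigenvalue_ge0 n : 0 <= lam n.
Proof.
have [phiV [G [_ happ heig orth _]]] := eigenbasis_data.
exact: (lam_ge0 happ heig orth).
Qed.

(** For each mu = exp x the infimum formula gives the inequality with lam mu / (lam + mu) in place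
    of lam^s. Integration against exp((s - 1) x) restores lam^s, with one constant on both sides. *)
Lemma spectral_bound (k t : R) (w z : E -> R) M : 0 <= k -> 0 <= t <= 1 ->
  w \in Lfun mu 2%:E -> z = (fun x => excess k (w x)) ->
  ((\sum_(m < M) lam m `^ s * (coef Omega phi (w \- (fun x => t * z x)) m ^+ 2 +
     (2 * t - t ^+ 2) * coef Omega phi z m ^+ 2))%:E <=
   \sum_(0 <= n <oo) (lam n `^ s * coef Omega phi w n ^+ 2)%:E)%E.
Proof.
move=> k0 t01 wL zE.
have [phiV [G [phiE happ heig orth compl]]] := eigenbasis_data.
have zL : z \in Lfun mu 2%:E by rewrite zE; exact: excess_Lfun2.
pose wV : V := Lfun_Sub (lee1n 2) wL; pose zV : V := Lfun_Sub (lee1n 2) zL.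
have cw n : coef Omega phi w n = L2ip mu wV (phiV n) by exact: (@coef_L2ip wV).
have cz n : coef Omega phi z n = L2ip mu zV (phiV n) by exact: (@coef_L2ip zV).
have cwz n : coef Omega phi (w \- (fun x => t * z x)) n =
    L2ip mu (wV - t *: zV) (phiV n) by exact: (@coef_L2ip (wV - t *: zV)).
have tau0 : 0 <= 2 * t - t ^+ 2 by case/andP: t01 => *; nra.
pose a m := L2ip mu (wV - t *: zV) (phiV m) ^+ 2 +
     (2 * t - t ^+ 2) * L2ip mu zV (phiV m) ^+ 2.
have a0 m : 0 <= a m by rewrite addr_ge0 ?sqr_ge0// mulr_ge0// sqr_ge0.
pose b n := L2ip mu wV (phiV n) ^+ 2.
have b0 n : 0 <= b n by exact: sqr_ge0.
have l0 := eigenvalue_ge0.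
under eq_bigr do rewrite cwz cz.
under eq_eseriesr do rewrite cw.
have pk0 n x : 0 <= power_kernel s (lam n) x by exact: power_kernel_ge0.
have step1 x : ((\sum_(m < M) power_kernel s (lam m) x * a m)%:E <=
    \sum_(0 <= n <oo) (power_kernel s (lam n) x * b n)%:E)%E.
  have ex := expR_gt0 x; have es := expR_gt0 (s * x).
  (* Links the integral representation to the infimum with parameter mu = exp x. When l + exp x = 0,
     both sides are 0 by the convention on inverses. *)
  have pkE l : power_kernel s l x = expR (s * x) / expR x * kfun (expR x) l.
    rewrite /power_kernel /kfun.
    have [l0'|l0'] := eqVneq (l + expR x) 0; first by rewrite l0' invr0 !mulr0.
    by field; rewrite l0' gt_eqF.
  apply/lee_addgt0Pr => e e0.
  (* The missing mass will be multiplied by mu exp(s x) / exp x = exp(s x), hence this tolerance. *)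
  have [N tail] := parseval orth compl wV (divr_gt0 e0 es).
  apply: (@le_trans _ _ ((\sum_(n < N) power_kernel s (lam n) x * b n)%:E + e%:E)%E).
    rewrite -EFinD lee_fin.
    have := kfun_contraction (@gradient_graphD _ _ Omega) (@gradient_graphZ _ _ Omega)
      happ heig orth ex tau0
      (gradient_graph_excess k0 t01 (w := wV) (z := zV) _) M N.
    move=> /(_ (fun x => congr1 (fun f => f x) zE)) H.
    have q0 : 0 < expR (s * x) / expR x by rewrite divr_gt0.
    have {}H := ler_wpM2l (ltW q0) H.
    rewrite mulrDr !mulr_sumr in H.
    rewrite (eq_bigr (fun m : 'I_M => expR (s * x) / expR x *
      (kfun (expR x) (lam m) * a m))); last by move=> m _; rewrite pkE mulrA.
    apply: (le_trans H); apply: lerD.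
      by apply: ler_sum => n _; rewrite pkE mulrA.
    by rewrite mulrA divfK ?gt_eqF// mulrC -ler_pdivlMr.
  apply: leeD => //; rewrite -sumEFin -(big_mkord xpredT (fun n => (power_kernel s (lam n) x * b n)%:E)).
  by apply: nneseries_lim_ge => n _ _; rewrite lee_fin mulr_ge0.
have [c c0 cE] := integral_power_kernel s01.
have mpk n (e : R) : measurable_fun setT (fun x => (power_kernel s (lam n) x * e)%:E).
  apply/measurable_EFinP; apply: measurable_funM => //.
  exact: measurable_power_kernel.
have ipk n (e : R) : 0 <= e ->
  (\int[lebesgue_measure]_x (power_kernel s (lam n) x * e)%:E = (c * (lam n `^ s * e))%:E)%E.
  move=> e0; under eq_integral do rewrite mulrC EFinM.
  rewrite ge0_integralZl_EFin//; last 2 first.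
  - by move=> x _; rewrite lee_fin.
  - by apply/measurable_EFinP; exact: measurable_power_kernel.
  by rewrite cE// -EFinM; congr EFin; ring.
have step2 : ((c * \sum_(m < M) lam m `^ s * a m)%:E <=
    c%:E * \sum_(0 <= n <oo) (lam n `^ s * b n)%:E)%E.
  rewrite mulr_sumr -sumEFin -nneseriesZl; last first.
    by move=> n _; rewrite lee_fin mulr_ge0 ?powR_ge0.
  under eq_bigr do rewrite -ipk//.
  under eq_eseriesr do rewrite -EFinM -ipk//.
  rewrite -ge0_integral_sum//; [|by move=> n; exact: mpk|by move=> n x _; rewrite lee_fin mulr_ge0].
  rewrite -integral_nneseries//; [|by move=> n; exact: mpk|by move=> n x _; rewrite lee_fin mulr_ge0].
  apply: ge0_le_integral => //.
  - by move=> x _; apply: sume_ge0 => n _; rewrite lee_fin mulr_ge0.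
  - by apply: emeasurable_sum => n; exact: mpk.
  - apply: ge0_emeasurable_sum => [n x _ _|n _]; last exact: mpk.
    by rewrite lee_fin mulr_ge0.
  - by move=> x _; rewrite sumEFin.
by move: step2; rewrite EFinM lee_pmul2l.
Qed.

End eigenbasis.

(** * Test functions have finite Gagliardo seminorm *)

Lemma geometric_nneseries_lty (R : realType) (a q : R) : 0 <= a -> 0 <= q < 1 ->
  (\sum_(0 <= j <oo) (a * q ^+ j)%:E < +oo)%E.
Proof.
move=> a0 /andP[q0 q1]; have q1' : 0 < 1 - q by rewrite subr_gt0.
apply: (@le_lt_trans _ _ (a / (1 - q))%:E); last exact: ltry.
apply: lime_le.
  by apply: is_cvg_nneseries => n _ _; rewrite lee_fin mulr_ge0// exprn_ge0.
apply: nearW => n; rewrite sumEFin lee_fin.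
have -> : \sum_(0 <= i < n) a * q ^+ i = a * (1 - q ^+ n) / (1 - q).
  have := @geometric_seriesE R a q _; rewrite lt_eqF// => /(_ isT).
  by move=> /(congr1 (fun f => f n)); rewrite /series/= => ->.
rewrite ler_pM2r ?invr_gt0// ler_piMr// gerBl exprn_ge0//.
Qed.

Section singular_integral.
Context {R : realType} {d : nat} (s : R).
Hypothesis s01 : 0 < s < 1.
Local Notation E := 'rV[R]_d.
Local Notation leb := (lebesgue_measure_rV R d).
Variables (psi : E -> R) (L M : R).
Hypotheses (L0 : 0 <= L) (M0 : 0 < M).
Hypothesis psiL : forall x y, `|psi x - psi y| <= L * `|x - y|.
Hypothesis mpsi : measurable_fun setT psi.

Let b : R := 2^-1.
Let al : R := d%:R + 2 * s.
(** Bounds the difference quotient on the shell M b^(j+1) < |x - y| <= M b^j: the Lipschitz estimate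
    is taken at the outer radius, the kernel at the inner one. *)
Let c j : R := (L * (M * b ^+ j)) ^+ 2 / (M * b ^+ j.+1) `^ al.

Let b0 : 0 < b. Proof. by rewrite invr_gt0. Qed.
Let al0 : 0 < al. Proof. by case/andP: s01 => s0 _; rewrite ltr_wpDl// mulr_gt0. Qed.

Let c_ge0 j : 0 <= c j.
Proof. by rewrite divr_ge0 ?sqr_ge0// powR_ge0. Qed.

(** Ratio of consecutive shells: b^2 from the squared increment, b^d from the volume, b^-(d+2s) from
    the kernel. It is below 1 because s < 1. *)
Let rho := b ^+ 2 * b ^+ d / b `^ al.

Let rhoE : rho = b `^ (2 - 2 * s).
Proof.
rewrite /rho -exprD -powR_mulrn; last exact: ltW.
rewrite -powRB; last by apply/implyP => _; rewrite gt_eqF.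
by congr (_ `^ _); rewrite natrD /al; ring.
Qed.

Let rho01 : 0 <= rho < 1.
Proof.
case/andP: s01 => s0 s1; rewrite rhoE powR_ge0/=.
have t0 : 0 < 2 - 2 * s by lra.
rewrite /powR (gt_eqF b0) -[ltRHS]expR0 ltr_expR pmulr_rlt0//.
by rewrite ln_lt0// b0 invf_lt1// ltr1n.
Qed.

Let shell_sum : (\sum_(0 <= j <oo) (c j * (2 * (M * b ^+ j)) ^+ d)%:E < +oo)%E.
Proof.
pose K := (L * M) ^+ 2 * (2 * M) ^+ d / (M * b) `^ al.
have cE j : c j * (2 * (M * b ^+ j)) ^+ d = K * rho ^+ j.
  have bj : (b ^+ j) `^ al = (b `^ al) ^+ j.
    have -> : b ^+ j = b `^ j%:R by rewrite powR_mulrn// ltW.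
    by rewrite powRAC powR_mulrn// powR_ge0.
  have -> : c j = (L * (M * b ^+ j)) ^+ 2 / ((M * b) `^ al * (b `^ al) ^+ j).
    rewrite /c (exprS b j) (mulrA M b) (powRM _ (mulr_ge0 (ltW M0) (ltW b0)) (exprn_ge0 _ (ltW b0))).
    by rewrite bj.
  rewrite /K /rho.
  have p1 : 0 < (M * b) `^ al by rewrite powR_gt0 ?mulr_gt0.
  have p2 : 0 < (b `^ al) ^+ j by rewrite exprn_gt0 ?powR_gt0.
  have bC n : (b ^+ n) ^+ j = (b ^+ j) ^+ n by rewrite -!exprM mulnC.
  rewrite !exprMn [(b `^ al)^-1 ^+ j]exprVn !bC; move: p1 p2 (b ^+ j) => /gt_eqF p1 /gt_eqF p2 B.
  by field; rewrite p1 p2.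
under eq_eseriesr do rewrite cE.
apply: geometric_nneseries_lty rho01.
by rewrite /K divr_ge0 ?powR_ge0// mulr_ge0 ?sqr_ge0// exprn_ge0// mulr_ge0// ltW.
Qed.

Let shell (x y : E) : x != y -> `|x - y| <= M ->
  exists j, M * b ^+ j.+1 < `|x - y| <= M * b ^+ j.
Proof.
move=> xy xyM; have xy0 : 0 < `|x - y| by rewrite normr_gt0 subr_eq0.
have ex : exists n, M * b ^+ n.+1 < `|x - y|.
  have : b ^+ n @[n --> \oo] --> (0 : R).
    by apply: cvg_expr; rewrite ger0_norm ?ltW// invf_lt1// ltr1n.
  move=> /cvgr0_norm_lt/(_ _ (divr_gt0 xy0 M0))[n _ /(_ n.+1 (leqnSn n))/=].
  rewrite ger0_norm ?exprn_ge0 ?ltW// ltr_pdivlMr// => h; exists n.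
  by rewrite mulrC.
exists (ex_minn ex); case: ex_minnP => n -> nmin /=.
case: n nmin => [|n] nmin; first by rewrite expr0 mulr1.
by rewrite leNgt; apply/negP => /nmin; rewrite ltnn.
Qed.

(** Each dyadic shell around x lies in the cube of its outer radius, and the shells sum to a
    geometric series. The bound depends neither on [D] nor on x, so it can be integrated over a set
    of finite measure. *)
Lemma gagliardo_section_bound : exists2 K : R, 0 <= K & forall (D : set E) x,
  measurable D -> (forall y, D y -> `|x - y| <= M) ->
  (\int[leb]_(y in D) (`|psi x - psi y| ^+ 2 / enorm (x - y) `^ (d%:R + 2 * s))%:E
    <= K%:E)%E.
Proof.
have S0 : (0 <= \sum_(0 <= j <oo) (c j * (2 * (M * b ^+ j)) ^+ d)%:E)%E.
  apply: nneseries_ge0 => j _ _.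
  by rewrite lee_fin mulr_ge0// exprn_ge0// !mulr_ge0 ?exprn_ge0// ltW.
exists (fine (\sum_(0 <= j <oo) (c j * (2 * (M * b ^+ j)) ^+ d)%:E)%E); first exact: fine_ge0.
move=> D x mD DM; rewrite fineK ?ge0_fin_numE//.
pose h y := (\sum_(0 <= j <oo) (c j * \1_(cube x (M * b ^+ j)) y)%:E)%E.
have t0 j (y : E) : (0 <= (c j * \1_(cube x (M * b ^+ j)) y)%:E)%E.
  by rewrite lee_fin mulr_ge0.
have mt j : measurable_fun setT (fun y : E => (c j * \1_(cube x (M * b ^+ j)) y)%:E).
  apply/measurable_EFinP; apply: measurable_funM => //.
  by apply: measurable_indic; exact: measurable_cube.
have mh : measurable_fun setT h.
  by apply: ge0_emeasurable_sum => // *; exact: t0.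
have mq : measurable_fun setT (fun y : E =>
    (`|psi x - psi y| ^+ 2 / enorm (x - y) `^ (d%:R + 2 * s))%:E).
  apply/measurable_EFinP; apply: measurable_funM.
    apply: measurable_funX; apply: measurableT_comp => //.
    by apply: measurable_funB.
  have := measurableT_comp (measurable_gker (d := d) s) (measurable_pair1 x).
  exact.
apply: (@le_trans _ _ (\int[leb]_(y in D) h y)%E).
  apply: ge0_le_integral => //.
  - by move=> y _; rewrite lee_fin divr_ge0 ?sqr_ge0// powR_ge0.
  - exact: measurable_funTS.
  - exact: measurable_funTS.
  - move=> y Dy; have [->|xy] := eqVneq x y.
      by rewrite subrr normr0 expr0n mul0r; apply: nneseries_ge0 => j _ _.
    have [j /andP[j1 j2]] := shell xy (DM y Dy).
    apply: (@le_trans _ _ (\sum_(0 <= i < j.+1) (c i * \1_(cube x (M * b ^+ i)) y)%:E)%E);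
      last exact: nneseries_lim_ge.
    rewrite big_nat_recr//=; apply: (@le_trans _ _ (c j * \1_(cube x (M * b ^+ j)) y)%:E); last first.
      by rewrite leeDr// sume_ge0.
    have Mbj : 0 <= M * b ^+ j by rewrite mulr_ge0 ?exprn_ge0// ltW.
    rewrite indicE mem_set; last exact/cubeP.
    rewrite mulr1 lee_fin /c ler_pM ?sqr_ge0 ?invr_ge0 ?powR_ge0//.
      have LM : 0 <= L * (M * b ^+ j) by rewrite mulr_ge0.
      rewrite lerXn2r ?nnegrE//.
      by apply: (le_trans (psiL x y)); rewrite ler_wpM2l.
    have Mbj1 : 0 < M * b ^+ j.+1 by rewrite mulr_gt0 ?exprn_gt0.
    rewrite lef_pV2 ?posrE ?powR_gt0//; last first.
      exact: lt_le_trans (lt_trans Mbj1 j1) (norm_le_enorm _).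
    apply: ge0_ler_powR; rewrite ?nnegrE; rewrite ?(ltW al0) ?(ltW Mbj1) ?sqrtr_ge0//.
    exact: le_trans (ltW j1) (norm_le_enorm _).
apply: (@le_trans _ _ (\int[leb]_y h y)%E).
  by apply: ge0_subset_integral => // y _; apply: nneseries_ge0 => j _ _.
rewrite integral_nneseries//; apply: lee_nneseries => [j _ _|j _]; first exact: integral_ge0.
under eq_integral do rewrite EFinM.
rewrite ge0_integralZl_EFin//; last first.
  by apply/measurable_EFinP; apply: measurable_indic; exact: measurable_cube.
rewrite integral_indic ?setIT//; last exact: measurable_cube.
rewrite [leRHS]EFinM; apply: lee_wpmul2l; first by rewrite lee_fin.
rewrite le_eqVlt; apply/orP; left; apply/eqP; apply: leb_cube.
by rewrite mulr_ge0 ?exprn_ge0// ltW.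
Qed.

End singular_integral.

Lemma test_function_Hs (R : realType) (d : nat) (s : R) (Omega : lipschitz_domain R d) psi :
  0 < s < 1 -> test_function Omega psi -> in_Hs s (domain_open Omega) psi.
Proof.
move=> s01 tpsi; split; first exact: test_function_Lfun2.
have [L L0 psiL] := test_function_lipschitz tpsi.
have mO := open_measurable_mx (domain_open Omega).
have [M [_ OM]] := domain_bounded Omega.
have M0 : 0 < 2 * (`|M| + 1) by rewrite mulr_gt0// ltr_wpDl.
have MM : M < `|M| + 1 by rewrite (le_lt_trans (ler_norm _))// ltrDl.
have mpsi : measurable_fun setT psi.
  by apply: measurable_continuous_mx; exact: test_function_continuous tpsi.
have [K K0 KP] := gagliardo_section_bound s01 L0 M0 psiL mpsi.
apply: (@le_lt_trans _ _ (\int[lebesgue_measure_rV R d]_(x in Omega) K%:E)%E).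
  apply: ge0_le_integral => //.
  - move=> x _; apply: integral_ge0 => y _.
    by rewrite lee_fin divr_ge0 ?sqr_ge0// powR_ge0.
  - pose F z := (pdiff psi z ^+ 2 * gker s z)%:E.
    have mF : measurable_fun setT F.
      apply: measurable_wsq; [exact: measurable_gker|exact: measurable_pdiff].
    have F0 z : (0 <= F z)%E by rewrite lee_fin mulr_ge0 ?sqr_ge0// gker_ge0.
    have := measurable_section_integral (lebesgue_measure_rV R d) mO mO mF F0.
    apply: eq_measurable_fun => x _; apply: eq_integral => y _.
    by rewrite /F real_normK// num_real.
  - move=> x Ox; apply: KP => // y Oy.
    have := OM _ MM _ Ox; have := OM _ MM _ Oy => /= h1 h2.
    by apply: (le_trans (ler_normB _ _)); lra.
rewrite integral_cst//; apply: lte_mul_pinfty => //; exact: leb_domain_lty.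
Qed.

(** * Truncation in the closure of the test functions *)

Section fast_convergence.
Context d (T : measurableType d) (R : realType).
Variables (mu : {measure set T -> \bar R}) (D : set T) (mD : measurable D).
Variables (kap : T -> R) (a : T -> R) (a_ : nat -> T -> R).
Hypotheses (mkap : measurable_fun setT kap) (kap0 : forall x, 0 <= kap x).
Hypotheses (ma : measurable_fun setT a) (ma_ : forall j, measurable_fun setT (a_ j)).
Hypothesis fast : forall j,
  (wsq mu D kap (fun x => a x - a_ j x)%R <= (2 / (2 ^ j.+1)%:R)%:E)%E.

(** Dominates all squared errors at once. Its integrability, from the summable rates in [fast],
    yields convergence almost everywhere and a dominating function without extraction of
    subsequences. *)
Let tail x : \bar R := (\sum_(0 <= j <oo) ((a x - a_ j x) ^+ 2 * kap x)%:E)%E.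

Let t0 j x : (0 <= ((a x - a_ j x) ^+ 2 * kap x)%:E)%E.
Proof. by rewrite lee_fin mulr_ge0// sqr_ge0. Qed.

Let mt j : measurable_fun setT (fun x => ((a x - a_ j x) ^+ 2 * kap x)%:E).
Proof. by apply: measurable_wsq => //; exact: measurable_funB. Qed.

Let mtail : measurable_fun setT tail.
Proof. by apply: ge0_emeasurable_sum => // *; exact: t0. Qed.

Let tail0 x : (0 <= tail x)%E.
Proof. by apply: nneseries_ge0 => *; exact: t0. Qed.

Let itail : mu.-integrable D tail.
Proof.
apply/integrableP; split; first exact: measurable_funTS.
under eq_integral do rewrite gee0_abs//.
rewrite integral_nneseries//; last by move=> n; exact: measurable_funTS.
apply: (@le_lt_trans _ _ (2%:R%:E)%E); last exact: ltry.
apply: le_trans (epsilon_trick0 xpredT (ler0n R 2)).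
by apply: lee_nneseries => [j _ _|j _]; [by apply: integral_ge0|exact: fast].
Qed.

Lemma fast_ae_cvg : (forall x, 0 < kap x) ->
  {ae mu, forall x, D x -> a_ ^~ x @ \oo --> a x}.
Proof.
move=> kp; have := integrable_ae mD itail; apply: filterS => x h Dx.
have cs : cvgn (series (fun j => (a x - a_ j x) ^+ 2 * kap x)).
  apply: nnseries_is_cvg; first by move=> i; rewrite mulr_ge0// sqr_ge0.
  by have := h Dx; rewrite ge0_fin_numE.
have := cvg_series_cvg_0 cs => c0.
apply/cvgrPdist_le => e e0.
have k2 : 0 < e ^+ 2 * kap x by rewrite mulr_gt0 ?exprn_gt0.
move: c0 => /cvgr0_norm_le/(_ _ k2); apply: filterS => j /=.
have tj : 0 <= (a x - a_ j x) ^+ 2 * kap x by rewrite mulr_ge0// sqr_ge0.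
rewrite (ger0_norm tj) ler_pM2r// => le.
by rewrite -(@ler_pXn2r _ 2) ?nnegrE ?(ltW e0)// real_normK ?num_real.
Qed.

Variables (b : T -> R) (b_ : nat -> T -> R).
Hypotheses (mb : measurable_fun setT b) (mb_ : forall j, measurable_fun setT (b_ j)).
Hypothesis ba : forall x, `|b x| <= `|a x|.
Hypothesis ba_ : forall j x, `|b_ j x| <= `|a_ j x|.
Hypothesis cvgb : {ae mu, forall x, D x -> b_ ^~ x @ \oo --> b x}.
Hypothesis afin : (wsq mu D kap a < +oo)%E.

(** As |b - b_j| <= |a| + |a_j| <= 2 |a| + |a - a_j|, the squares are at most 8 a^2 + 2 [tail], and
    dominated convergence applies. *)
Lemma fast_contraction_cvg :
  (fun j => wsq mu D kap (fun x => b x - b_ j x)%R) @ \oo --> 0%E.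
Proof.
pose f j x := ((b x - b_ j x) ^+ 2 * kap x)%:E.
pose g x := (8%:E * (a x ^+ 2 * kap x)%:E + 2%:E * tail x)%E.
have mg1 : measurable_fun setT (fun x => (a x ^+ 2 * kap x)%:E).
  exact: measurable_wsq.
have mf j : measurable_fun D (f j).
  apply: measurable_funTS; apply: measurable_wsq => //.
  exact: measurable_funB.
have ig : mu.-integrable D g.
  apply: integrableD => //; last exact: integrableZl.
  apply: integrableZl => //; apply/integrableP; split; first exact: measurable_funTS.
  have aa0 x : (0 <= (a x ^+ 2 * kap x)%:E)%E by rewrite lee_fin mulr_ge0// sqr_ge0.
  under eq_integral do rewrite gee0_abs//.
  exact: afin.
have fc : {ae mu, forall x, D x -> f ^~ x @ \oo --> (cst 0%E) x}.
  apply: filterS cvgb => x cb Dx.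
  apply: cvg_EFin; first exact: nearW.
  have : b x - b_ j x @[j --> \oo] --> b x - b x.
    by apply: cvgB; [exact: cvg_cst|exact: cb].
  rewrite subrr => c0.
  rewrite -(mul0r (kap x)) -(mul0r 0).
  apply: cvgM; last exact: cvg_cst.
  exact: (cvgM c0 c0).
have fg : {ae mu, forall x j, D x -> (`|f j x| <= g x)%E}.
  apply: nearW => x j _; rewrite gee0_abs; last by rewrite lee_fin mulr_ge0// sqr_ge0.
  have tj : (((a x - a_ j x) ^+ 2 * kap x)%:E <= tail x)%E.
    apply: (@le_trans _ _ (\sum_(0 <= i < j.+1) ((a x - a_ i x) ^+ 2 * kap x)%:E)%E);
      last exact: nneseries_lim_ge.
    by rewrite big_nat_recr//= leeDr// sume_ge0.
  apply: (@le_trans _ _ (8%:E * (a x ^+ 2 * kap x)%:E +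
      2%:E * ((a x - a_ j x) ^+ 2 * kap x)%:E)%E); last first.
    by rewrite leeD2l// lee_wpmul2l.
  rewrite -!EFinM -EFinD lee_fin (mulrA 8) (mulrA 2) -mulrDl ler_wpM2r//.
  have h1 : `|b x - b_ j x| <= 2 * `|a x| + `|a x - a_ j x|.
    have := ler_normB (b x) (b_ j x); have := ba x; have := ba_ j x.
    have : `|a_ j x| <= `|a x| + `|a x - a_ j x|.
      by rewrite -[in leLHS](subKr (a x) (a_ j x)); exact: ler_normB.
    lra.
  have := sqr_ge0 (2 * `|a x| - `|a x - a_ j x|).
  rewrite -(real_normK (num_real (b x - _))) -(real_normK (num_real (a x))).
  rewrite -(real_normK (num_real (a x - _))).
  have := normr_ge0 (b x - b_ j x).
  move: h1; set B := `|b x - _|; set A := `|a x|; set C := `|a x - _|.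
  nra.
have [_ _ ] := dominated_convergence mD mf (@measurable_cst _ _ _ _ _ _) fc ig fg.
by rewrite integral0.
Qed.

End fast_convergence.

Section Hs_zero.
Context {R : realType} {d : nat} (s : R) (Omega : lipschitz_domain R d).
Hypothesis s01 : 0 < s < 1.
Local Notation E := 'rV[R]_d.
Local Notation leb := (lebesgue_measure_rV R d).
Local Notation oO := (domain_open Omega).

Let s0 : 0 < s. Proof. by case/andP: s01. Qed.

(** A null set N spoils only the pairs in N x R^d and R^d x N. The differences are handled through
    the functions because the kernel vanishes on the diagonal, so [fast_ae_cvg] does not apply to
    it. *)
Lemma ae_pdiff_cvg (u : E -> R) (u_ : nat -> E -> R) :
  {ae leb, forall x, domain Omega x -> u_ ^~ x @ \oo --> u x} ->
  {ae (leb \x leb)%E, forall z, (domain Omega `*` domain Omega) z ->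
    (fun j => pdiff (u_ j) z) @ \oo --> pdiff u z}.
Proof.
move=> [N [mN N0 uN]].
exists (N `*` setT `|` setT `*` N); split.
- by apply: measurableU; exact: measurableX.
- rewrite null_set_setU//; try exact: measurableX.
  + by apply: etrans (product_measure1E _ _ mN measurableT) _; apply/eqP; rewrite mule_eq0;
      apply/orP; left; apply/eqP; exact: N0.
  + by apply: etrans (product_measure1E _ _ measurableT mN) _; apply/eqP; rewrite mule_eq0;
      apply/orP; right; apply/eqP; exact: N0.
- move=> [x y] /= /not_implyP[[/= Ox Oy] h].
  have [Nx|Nx] := pselect (N x); first by left.
  have [Ny|Ny] := pselect (N y); first by right.
  have gx : u_ ^~ x @ \oo --> u x.
    by apply: contrapT => c; apply: Nx; apply: uN => /= /(_ Ox).
  have gy : u_ ^~ y @ \oo --> u y.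
    by apply: contrapT => c; apply: Ny; apply: uN => /= /(_ Oy).
  by exfalso; apply: h; exact: cvgB.
Qed.

(** Truncation is not linear: the differences of z - zeta are not controlled by those of w - psi, so
    no Lipschitz estimate carries the approximation over. Instead zeta_j = h_j o psi_j is a
    contraction of psi_j and converges almost everywhere, which permits dominated convergence in
    both parts of the norm. *)
Lemma Hs_zero_excess (k : R) (w : E -> R) : 0 <= k -> in_Hs s oO w ->
  (forall e, 0 < e -> exists2 psi, test_function Omega psi &
     Num.sqrt (dot_Hs s Omega (w \- psi) (w \- psi)) < e) ->
  let z := fun x => excess k (w x) in
  forall e, 0 < e -> exists2 psi, test_function Omega psi &
     Num.sqrt (dot_Hs s Omega (z \- psi) (z \- psi)) < e.
Proof.
move=> k0 Hw happ z e e0.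
have mO : measurable (domain Omega) := open_measurable_mx oO.
have /in_HsP[mw wy gw] := Hw.
have p2 j : 0 < (2 ^ j.+1)%:R^-1 :> R by rewrite invr_gt0 ltr0n expn_gt0.
pose psi j := projT1 (cid2 (happ _ (p2 j))).
have tpsi j : test_function Omega (psi j) by rewrite /psi; case: cid2.
have npsi j : Num.sqrt (dot_Hs s Omega (w \- psi j) (w \- psi j)) < (2 ^ j.+1)%:R^-1.
  by rewrite /psi; case: cid2.
have HsB u v : in_Hs s oO u -> in_Hs s oO v -> in_Hs s oO (u \- v).
  move=> Hu Hv; have := in_HsD Hu (in_HsZ (-1) Hv).
  by congr in_Hs; apply/funext => x /=; rewrite mulN1r.
have Hpsi j : in_Hs s oO (psi j) by exact: test_function_Hs.
have mpsi j : measurable_fun setT (psi j) by case/in_HsP: (Hpsi j).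
have HB j := HsB _ _ Hw (Hpsi j).
pose c : R := @c_ds R d s / 2.
have c0 : 0 <= c by rewrite mulr_ge0 ?c_ds_ge0.
have dotB j : dot_Hs s Omega (w \- psi j) (w \- psi j) <= 2 / (2 ^ j.+1)%:R.
  have x0 := dot_Hs_ge0 s0 (HB j).
  rewrite -[leLHS]sqr_sqrtr// expr2.
  have n0 := sqrtr_ge0 (dot_Hs s Omega (w \- psi j) (w \- psi j)).
  apply: (le_trans (ler_pM n0 n0 (ltW (npsi j)) (ltW (npsi j)))).
  rewrite ler_wpM2r ?(ltW (p2 j))//.
  by rewrite (@le_trans _ _ 1) ?ler1n// invf_le1 ?ltr0n ?expn_gt0// ler1n expn_gt0.
have [h_ hP] : exists h_ : nat -> nat -> R -> R, forall j,
   [/\ derivative_tower (h_ j), h_ j 0%N 0 = 0, forall x, 0 <= h_ j 1%N x <= 1 &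
      forall x, `|h_ j 0%N x - excess k x| <= (2 ^ j.+1)%:R^-1].
  exists (fun j => projT1 (cid (smooth_excess k0 (p2 j)))) => j.
  exact: (projT2 (cid (smooth_excess k0 (p2 j)))).
pose zeta j := h_ j 0%N \o psi j.
have tzeta j : test_function Omega (zeta j).
  by have [hh h0 _ _] := hP j; exact: test_function_comp.
have Hzeta j : in_Hs s oO (zeta j) by exact: test_function_Hs.
have mzeta j : measurable_fun setT (zeta j) by case/in_HsP: (Hzeta j).
have Hz : in_Hs s oO z by exact: in_Hs_excess.
have mz : measurable_fun setT z by case/in_HsP: Hz.
have ker0 x := @gker_ge0 R d s x.
have ker0' x : 0 <= c * @gker R d s x by rewrite mulr_ge0.
have mker : measurable_fun setT (fun x => c * @gker R d s x).
  by apply: measurable_funM => //; exact: measurable_gker.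
have mOO : measurable (domain Omega `*` domain Omega) by exact: measurableX.
(* The constant is put into the kernel: bounds on the scalar product then pass to this term without
   division by [c], of which only the sign is known here. *)
pose G u := wsq (leb \x leb)%E (Omega `*` Omega) (fun x => c * @gker R d s x) (pdiff u).
have GE u : in_Hs s oO u -> G u = (c * fine (gagl s Omega u))%:E.
  move=> Hu; have /in_HsP[mu uy gu] := Hu.
  rewrite EFinM (fineK (gagl_fin Hu)) /G /gagl /wsq -ge0_integralZl_EFin//.
  - by apply: eq_integral => x _; rewrite -EFinM; congr EFin; ring.
  - by move=> x _; rewrite lee_fin mulr_ge0// sqr_ge0.
  - apply: measurable_funTS; apply: measurable_wsq; first exact: measurable_gker.
    exact: measurable_pdiff.
have dotE u : in_Hs s oO u ->
    (dot_Hs s Omega u u)%:E = (sqnorm Omega u + G u)%E.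
  by move=> Hu; rewrite (dot_HsE Hu) EFinD (GE _ Hu) (fineK (sqnorm_fin Hu)).
have fast1 j : (sqnorm Omega (fun x => w x - psi j x)%R <= (2 / (2 ^ j.+1)%:R)%:E)%E.
  apply: (@le_trans _ _ (dot_Hs s Omega (w \- psi j) (w \- psi j))%:E); last by rewrite lee_fin.
  by rewrite (dotE _ (HB j)) leeDl//; apply: wsq_ge0.
have fast2 j : (wsq (leb \x leb)%E (Omega `*` Omega) (fun x => c * @gker R d s x)%R
    (fun x => pdiff w x - pdiff (psi j) x)%R <= (2 / (2 ^ j.+1)%:R)%:E)%E.
  apply: (@le_trans _ _ (dot_Hs s Omega (w \- psi j) (w \- psi j))%:E); last by rewrite lee_fin.
  rewrite (dotE _ (HB j)) (_ : (fun x => _ - _) = pdiff (w \- psi j)).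
    by rewrite leeDr//; apply: wsq_ge0.
  by apply/funext => x; rewrite /pdiff /=; ring.
have aec : {ae leb, forall x, domain Omega x -> psi ^~ x @ \oo --> w x}.
  by apply: (fast_ae_cvg mO _ _ _ _ fast1) => // x; exact: ltr01.
have zetac x : psi ^~ x @ \oo --> w x -> zeta ^~ x @ \oo --> z x.
  move=> cx; apply/cvgrPdist_le => e1 e10.
  have e2 : 0 < e1 / 2 by rewrite divr_gt0.
  have /cvgrPdist_le/(_ _ e2) := cx.
  have : (2 ^ j.+1)%:R^-1 @[j --> \oo] --> (0 : R).
    have : 2^-1 ^+ j.+1 @[j --> \oo] --> (0 : R).
      rewrite (cvg_shiftS (fun j => 2^-1 ^+ j : R)).
      by apply: cvg_expr; rewrite ger0_norm ?invr_ge0// invf_lt1// ltr1n.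
    by apply: cvg_trans; apply: near_eq_cvg; apply: nearW => j; rewrite exprVn natrX.
  move=> /cvgr0_norm_le/(_ _ e2); apply: filterS2 => j j1 j2.
  have [_ _ _ hj] := hP j.
  have := hj (psi j x); have := excess_lipschitz k (w x) (psi j x).
  rewrite (ger0_norm (ltW (p2 j))) in j1.
  rewrite /zeta /z /= => A1 A2.
  rewrite -[excess k (w x) - _](subrKA (excess k (psi j x))).
  apply: (le_trans (ler_normD _ _)); rewrite distrC in A2; lra.
have aez : {ae leb, forall x, domain Omega x -> zeta ^~ x @ \oo --> z x}.
  by apply: filterS aec => x cx Ox; apply: zetac; exact: cx.
have h00 j : h_ j 0%N 0 = 0 by case: (hP j).
have lipz j x y : `|zeta j x - zeta j y| <= `|psi j x - psi j y|.
  by have [hh _ h1 _] := hP j; exact: tower_lipschitz.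
have cv1 : (fun j => sqnorm Omega (fun x => z x - zeta j x)%R) @ \oo --> 0%E.
  apply: (fast_contraction_cvg mO _ _ _ _ fast1) => //.
  - by move=> x; rewrite ger0_norm ?excess_ge0// excess_le_norm.
  - move=> j x; have [hh _ h1 _] := hP j.
    by have := tower_lipschitz (psi j x) 0 hh h1; rewrite h00 !subr0.
have cv2 : (fun j => wsq (leb \x leb)%E (Omega `*` Omega) (fun x => c * @gker R d s x)%R
    (fun x => pdiff z x - pdiff (zeta j) x)%R) @ \oo --> 0%E.
  apply: (fast_contraction_cvg mOO _ _ _ _ fast2) => //; try by move=> *; exact: measurable_pdiff.
  - by move=> x; exact: excess_lipschitz.
  - by move=> j x; exact: lipz.
  - exact: ae_pdiff_cvg.
  - by have := GE _ Hw; rewrite /G => ->; rewrite ltry.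
have e4 : 0 < e ^+ 2 / 2 by rewrite divr_gt0// exprn_gt0.
have small (f : nat -> \bar R) : (forall j, (0 <= f j)%E) -> f @ \oo --> 0%E ->
    \forall j \near \oo, (f j < (e ^+ 2 / 2)%:E)%E.
  move=> f0 /fine_cvgP[ffin fc].
  move: fc => /cvgr0_norm_lt/(_ _ e4); apply: filterS2 ffin => j fj.
  by rewrite /= ger0_norm ?fine_ge0// -lte_fin fineK.
have n1 j : (0 <= sqnorm Omega (fun x => z x - zeta j x)%R)%E by apply: wsq_ge0.
have n2 j : (0 <= wsq (leb \x leb)%E (Omega `*` Omega) (fun x => c * @gker R d s x)%R
    (fun x => pdiff z x - pdiff (zeta j) x)%R)%E by apply: wsq_ge0.
have near1 := small _ n1 cv1; have near2 := small _ n2 cv2.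
have [j [J1 J2]] : exists j, (sqnorm Omega (fun x => z x - zeta j x)%R < (e ^+ 2 / 2)%:E)%E /\
   (wsq (leb \x leb)%E (Omega `*` Omega) (fun x => c * @gker R d s x)%R
    (fun x => pdiff z x - pdiff (zeta j) x)%R < (e ^+ 2 / 2)%:E)%E.
  have [N _ HN] := filterI near1 near2.
  by exists N; have := HN N (leqnn N).
exists (zeta j) => //.
rewrite -(ger0_norm (ltW e0)) -sqrtr_sqr ltr_sqrt ?exprn_gt0//.
rewrite -lte_fin (dotE _ (HsB _ _ Hz (Hzeta j))) [e ^+ 2]splitr EFinD.
apply: lteD; first exact: J1.
rewrite /G (_ : pdiff _ = (fun x => pdiff z x - pdiff (zeta j) x)) ?J2//.
by apply/funext => x; rewrite /pdiff /=; ring.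
Qed.

End Hs_zero.

(** * The four spaces W together *)

Lemma nneseries_le_fin (R : realType) (a : nat -> R) (B : R) :
  (forall n, 0 <= a n) -> (forall M, \sum_(m < M) a m <= B) ->
  (\sum_(0 <= n <oo) (a n)%:E <= B%:E)%E.
Proof.
move=> a0 aB; apply: lime_le; first by apply: is_cvg_nneseries => n _ _; rewrite lee_fin.
by apply: nearW => n; rewrite sumEFin lee_fin big_mkord.
Qed.

Lemma limn_nnseries_le (R : realType) (a : nat -> R) (B : R) :
  (forall n, 0 <= a n) -> (forall M, \sum_(m < M) a m <= B) ->
  cvgn (series a) /\ limn (series a) <= B.
Proof.
move=> a0 aB; have ay := nneseries_le_fin a0 aB.
have ca : cvgn (series a) by apply: nnseries_is_cvg => //; apply: le_lt_trans ay (ltry _).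
by split => //; apply: limr_le => //; apply: nearW => n; rewrite /series/= big_mkord.
Qed.

Lemma quarter_sum (R : realType) (t e x y : R) : 0 <= t <= 1 -> 0 <= y -> 0 < e ->
  x <= (e / 4) ^+ 2 -> y <= (e / 4) ^+ 2 -> 2 * (x + t ^+ 2 * y) < e ^+ 2.
Proof.
move=> /andP[t0 t1] y0 e0 xe ye.
have ty : t ^+ 2 * y <= y by rewrite ler_piMl// expr_le1.
have ee : 0 < e ^+ 2 by rewrite exprn_gt0.
move: xe ye; rewrite expr_div_n; lra.
Qed.

Section frac_spaces.
Context {R : realType} {d : nat} (s : R) (Omega : lipschitz_domain R d).
Hypothesis s01 : 0 < s < 1.
Local Notation E := 'rV[R]_d.
Local Notation leb := (lebesgue_measure_rV R d).
Local Notation oO := (domain_open Omega).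
Variable W : frac_space R d.
Hypothesis Wwf : frac_space_wf Omega W.
Implicit Types w : E -> R.

Let s0 : 0 < s. Proof. by case/andP: s01. Qed.

Lemma in_W_Lfun2 w : in_W s Omega W w -> w \in Lfun (leb_on oO) 2%:E.
Proof.
case: W => [[]//|[[]]//|[[wL _] _]|phi lam []//].
have /Lfun2E[mw wy] := wL; apply/Lfun2E; split => //.
have mw2 : measurable_fun setT (fun x => (w x ^+ 2)%:E).
  by apply/measurable_EFinP; exact: measurable_funX.
move: wy; rewrite !integral_mrestr//; apply: le_lt_trans.
apply: ge0_subset_integral => //; first exact: open_measurable_mx oO.
by move=> x _; rewrite lee_fin sqr_ge0.
Qed.

Section spectral_case.
Variables (phi : nat -> E -> R) (lam : nat -> R).
Hypothesis basis : dirichlet_eigenbasis oO phi lam.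

Let term w n := lam n `^ s * coef Omega phi w n * coef Omega phi w n.

Let termE w n : term w n = lam n `^ s * coef Omega phi w n ^+ 2.
Proof. by rewrite /term expr2 mulrA. Qed.

Let term_ge0 w n : 0 <= term w n.
Proof. by rewrite termE mulr_ge0 ?powR_ge0 ?sqr_ge0. Qed.

Let series_bound w B : (forall M, \sum_(m < M) term w m <= B) ->
  (\sum_(0 <= n <oo) (lam n `^ s * coef Omega phi w n ^+ 2)%:E < +oo)%E.
Proof.
move=> tB; apply: (@le_lt_trans _ _ B%:E); last exact: ltry.
apply: nneseries_le_fin => [n|N]; first by rewrite -termE.
by under eq_bigr do rewrite -termE.
Qed.

Lemma coefZ c w n : w \in Lfun (leb_on oO) 2%:E ->
  coef Omega phi (fun x => c * w x) n = c * coef Omega phi w n.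
Proof.
move=> wL; have [phiV [_ [phiE _ _ _ _]]] := eigenbasis_data basis.
pose wV : LfunType (leb_on oO) (lee1n 2) := Lfun_Sub (lee1n 2) wL.
have -> : coef Omega phi w n = L2ip (leb_on oO) wV (phiV n) by exact: (coef_L2ip wV (phiE n)).
by rewrite -sipZl; exact: (coef_L2ip (c *: wV) (phiE n)).
Qed.

Lemma spectral_excess k t w : 0 <= k -> 0 <= t <= 1 ->
  in_W s Omega (Hs_spectral phi lam) w ->
  let z := fun x => excess k (w x) in
  let w1 := w \- (fun x => t * z x) in
  [/\ in_W s Omega (Hs_spectral phi lam) z, in_W s Omega (Hs_spectral phi lam) w1 &
    dotW s Omega (Hs_spectral phi lam) w1 w1 +
    (2 * t - t ^+ 2) * dotW s Omega (Hs_spectral phi lam) z z <=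
    dotW s Omega (Hs_spectral phi lam) w w].
Proof.
move=> k0 t01 [wL wy] z w1.
have zL : z \in Lfun (leb_on oO) 2%:E by exact: excess_Lfun2.
have w1L : w1 \in Lfun (leb_on oO) 2%:E.
  pose wV : LfunType (leb_on oO) (lee1n 2) := Lfun_Sub (lee1n 2) wL.
  pose zV : LfunType (leb_on oO) (lee1n 2) := Lfun_Sub (lee1n 2) zL.
  exact: LfunP (wV - t *: zV).
have cw : cvgn (series (term w)).
  apply: nnseries_is_cvg => //.
  by under eq_eseriesr do rewrite termE.
have lw : (\sum_(0 <= n <oo) (lam n `^ s * coef Omega phi w n ^+ 2)%:E =
    (limn (series (term w)))%:E)%E.
  under eq_eseriesr do rewrite -termE.
  rewrite -EFin_lim//; congr (limn _).
  by apply/funext => n; rewrite /series /= sumEFin.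
have tau (r : R) : 0 <= r <= 1 -> 0 <= 2 * r - r ^+ 2 by move=> /andP[]; nra.
have key r M : 0 <= r <= 1 ->
    \sum_(m < M) term (w \- (fun x => r * z x)) m +
    (2 * r - r ^+ 2) * \sum_(m < M) term z m <= limn (series (term w)).
  move=> r01.
  have := spectral_bound s01 basis M k0 r01 wL (erefl z).
  rewrite lw lee_fin; apply: le_trans; rewrite mulr_sumr -big_split/=.
  by apply: ler_sum => m _; rewrite !termE; rewrite le_eqVlt; apply/orP; left; apply/eqP; ring.
(* For r = 1 the coefficient 2r - r^2 is 1, and dropping the first sum leaves the bound for z. *)
have bz M : \sum_(m < M) term z m <= limn (series (term w)).
  have := key 1 M; rewrite ler01 lexx => /(_ isT); apply: le_trans.
  by rewrite mulr1 expr1n mulr2n addrK mul1r lerDr sumr_ge0.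
have b1 M : \sum_(m < M) term w1 m <= limn (series (term w)).
  by apply: le_trans (key t M t01); rewrite lerDl mulr_ge0 ?tau// sumr_ge0.
split; [by split; [exact: zL|exact: series_bound bz]|
  by split; [exact: w1L|exact: series_bound b1]|].
rewrite /= -/(term w1) -/(term z) -/(term w).
have [cz _] := limn_nnseries_le (term_ge0 z) bz.
have [c1 _] := limn_nnseries_le (term_ge0 w1) b1.
have cc : series (term w1) n + (2 * t - t ^+ 2) * series (term z) n @[n --> \oo] -->
    limn (series (term w1)) + (2 * t - t ^+ 2) * limn (series (term z)).
  by apply: cvgD; [exact: c1|apply: cvgMr; exact: cz].
rewrite -(cvg_lim _ cc)//; apply: limr_le; first by apply/cvg_ex; eexists; exact: cc.
by apply: nearW => n; rewrite /series /= !big_mkord; exact: key.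
Qed.

Lemma spectral_dotZ c w : in_W s Omega (Hs_spectral phi lam) w ->
  dotW s Omega (Hs_spectral phi lam) (fun x => c * w x) (fun x => c * w x) =
  c ^+ 2 * dotW s Omega (Hs_spectral phi lam) w w.
Proof.
move=> [wL wy] /=; rewrite -/(term w).
have cw : cvgn (series (term w)).
  apply: nnseries_is_cvg => //.
  by under eq_eseriesr do rewrite termE.
apply: cvg_lim => //.
rewrite (_ : series _ = (fun n => c ^+ 2 * series (term w) n)).
  exact: cvgMr.
apply/funext => n; rewrite /series /= mulr_sumr; apply: eq_bigr => i _.
by rewrite (coefZ _ _ wL) /term; ring.
Qed.

Lemma spectral_dot_ge0 w : 0 <= dotW s Omega (Hs_spectral phi lam) w w \/
  ~ in_W s Omega (Hs_spectral phi lam) w.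
Proof.
have [[wL wy]|] := pselect (in_W s Omega (Hs_spectral phi lam) w); last by right.
left; rewrite /= -/(term w); apply: limr_ge.
  apply: nnseries_is_cvg => //.
  by under eq_eseriesr do rewrite termE.
by apply: nearW => n; rewrite /series/=; apply: sumr_ge0.
Qed.

End spectral_case.

Lemma dotW_ge0 w : in_W s Omega W w -> 0 <= dotW s Omega W w w.
Proof.
move: Wwf; case: W => [|||phi lam] wf.
- exact: dot_Hs_ge0.
- by case => Hw _; exact: dot_Hs_ge0 Hw.
- by case => Hw _; exact: dot_Hs_ge0 Hw.
- by case: (spectral_dot_ge0 phi lam w).
Qed.

Lemma normW_sqr w : in_W s Omega W w -> normW s Omega W w ^+ 2 = dotW s Omega W w w.
Proof. by move=> Hw; rewrite sqr_sqrtr// dotW_ge0. Qed.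

Lemma normWZ c w : in_W s Omega W w ->
  normW s Omega W (fun x => c * w x) = `|c| * normW s Omega W w.
Proof.
move=> Hw; rewrite /normW.
suff -> : dotW s Omega W (fun x => c * w x) (fun x => c * w x) = c ^+ 2 * dotW s Omega W w w.
  by rewrite sqrtrM ?sqr_ge0// sqrtr_sqr.
move: Wwf Hw; case: W => [|||phi lam] wf.
- exact: dot_HsZ.
- by case => Hw _; exact: dot_HsZ Hw.
- by case => Hw _; exact: dot_HsZ Hw.
- exact: spectral_dotZ.
Qed.

(* Truncation from above is a contraction for the quadratic form of each of the
   spaces, in the strengthened form needed for the variational inequality. *)
Lemma in_W_excess k t w : 0 <= k -> 0 <= t <= 1 -> in_W s Omega W w ->
  let z := fun x => excess k (w x) in
  let w1 := w \- (fun x => t * z x) in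
  [/\ in_W s Omega W z, in_W s Omega W w1 &
    normW s Omega W w1 ^+ 2 + (2 * t - t ^+ 2) * normW s Omega W z ^+ 2 <=
    normW s Omega W w ^+ 2].
Proof.
move=> k0 t01 Hw z w1.
suff [Hz H1 le] : [/\ in_W s Omega W z, in_W s Omega W w1 &
    dotW s Omega W w1 w1 + (2 * t - t ^+ 2) * dotW s Omega W z z <= dotW s Omega W w w].
  split; [exact: Hz|exact: H1|].
  have sub (a b c a' b' c' r : R) : a = a' -> b = b' -> c = c' ->
      a' + r * b' <= c' -> a + r * b <= c by move=> -> -> ->.
  exact: (sub _ _ _ _ _ _ _ (normW_sqr H1) (normW_sqr Hz) (normW_sqr Hw) le).
move: Wwf Hw; case: W => [|||phi lam] wf.
- move=> Hw; split; [exact: in_Hs_excess|exact: (in_Hs_sub_excess t k0 Hw)|exact: (dot_Hs_excess k0 t01 s0 Hw)].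
- move=> [Hw happ].
  have hz := Hs_zero_excess s01 k0 Hw happ.
  have HsB u v : in_Hs s oO u -> in_Hs s oO v -> in_Hs s oO (u \- v).
    move=> Hu Hv; have := in_HsD Hu (in_HsZ (-1) Hv).
    by congr in_Hs; apply/funext => x /=; rewrite mulN1r.
  have Hz : in_Hs s oO z by exact: in_Hs_excess.
  split; [by split|split; first exact: (in_Hs_sub_excess t k0 Hw)|exact: (dot_Hs_excess k0 t01 s0 Hw)].
  move=> e e0; have e4 : 0 < e / 4 by rewrite divr_gt0.
  have [psi tpsi ppsi] := happ _ e4; have [zeta tzeta pzeta] := hz _ e4.
  (* psi - t zeta approximates w1 when psi approximates w and zeta approximates z; with errors below
     e/4, [dot_HsD] keeps the total below e. *)
  have tx : test_function Omega (psi \+ (linear_tower (- t) 0%N \o zeta)).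
    apply: test_functionD => //; apply: test_function_comp => //.
      exact: linear_towerP.
    by rewrite /= mulr0.
  exists (psi \+ (linear_tower (- t) 0%N \o zeta)) => //.
  have Hpsi := test_function_Hs s01 tpsi; have Hzeta := test_function_Hs s01 tzeta.
  have HA := HsB _ _ Hw Hpsi; have HB := HsB _ _ Hz Hzeta.
  have := dot_HsD s0 HA (in_HsZ (- t) HB).
  rewrite (dot_HsZ _ HB) sqrrN => le2.
  rewrite /normW /= -(ger0_norm (ltW e0)) -sqrtr_sqr ltr_sqrt ?exprn_gt0//.
  rewrite (_ : w1 \- _ = (fun x => (w \- psi) x + - t * (z \- zeta) x)); last first.
    by apply/funext => x; rewrite /w1 /=; ring.
  apply: (le_lt_trans le2).
  have sq (u : E -> R) : in_Hs s oO u -> Num.sqrt (dot_Hs s Omega u u) < e / 4 ->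
      dot_Hs s Omega u u <= (e / 4) ^+ 2.
    move=> Hu; move: (dot_Hs_ge0 s0 Hu); move: (dot_Hs s Omega u u) => x x0 xe.
    by rewrite -[leLHS]sqr_sqrtr// lerXn2r ?nnegrE ?sqrtr_ge0 ?(ltW e4)// ltW.
  have q1 := sq _ HA ppsi; have q2 := sq _ HB pzeta.
  exact: (quarter_sum t01 (dot_Hs_ge0 s0 HB) e0 q1 q2).
- move=> [Hw w0]; split.
  + split; first exact: in_Hs_excess.
    apply: filterS w0 => x wx /wx; rewrite /z => ->.
    by rewrite /excess sub0r; apply/max_idPr; rewrite oppr_le0.
  + split; first exact: (in_Hs_sub_excess t k0 Hw).
    apply: filterS w0 => x wx /wx; rewrite /w1 /= /z => ->.
    have -> : excess k 0 = 0 :> R by rewrite /excess sub0r; apply/max_idPr; rewrite oppr_le0.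
    by rewrite mulr0 subrr.
  + exact: (dot_Hs_excess k0 t01 s0 Hw).
- exact: spectral_excess.
Qed.

End frac_spaces.

(** * The iteration lemma and inequalities for functions supported on a set *)

(** Along the levels k_j = M (1 - 2^-j) the gaps are halved at each step. As b > 1, a geometric
    bound A th^j on y(k_j) reproduces itself once th^b gains over th the factor 1/2 that the gap
    loses. *)
Lemma stampacchia (R : realType) (y : R -> R) (C b : R) :
  (forall k, 0 <= y k) -> 0 <= C -> 1 < b ->
  (forall k h, 0 <= k -> k < h -> (h - k) * y h <= C * y k `^ b) ->
  exists2 M, 0 < M & y M = 0.
Proof.
move=> y0 C0 b1 hy.
pose A := y 0 + 1.
have A0 : 0 < A by rewrite ltr_wpDl.
have bb : 0 < b - 1 by rewrite subr_gt0.
pose th : R := 2 `^ (- (b - 1)^-1).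
have th0 : 0 < th by rewrite powR_gt0.
have th1 : th < 1.
  rewrite /th /powR gt_eqF// -[ltRHS]expR0 ltr_expR nmulr_rlt0 ?oppr_lt0 ?invr_gt0//.
  by rewrite ln_gt0// ltr1n.
(* the ratio is chosen so that [2 * th ^ b = th] *)
have thb : 2 * th `^ b = th.
  rewrite /th -powRrM.
  have {1}-> : (2 : R) = 2 `^ 1 by rewrite powRr1.
  rewrite -powRD; last by apply/implyP => _; rewrite pnatr_eq0.
  by congr (_ `^ _); field; rewrite gt_eqF.
pose K := 2 * C * A `^ b.
have K0 : 0 <= K by rewrite mulr_ge0 ?powR_ge0// mulr_ge0.
(* Large enough for K <= M A th, which is what the induction step asks; the factor 2 in [K] comes
   from the gap M 2^-(j+1). *)
pose M := K / (A * th) + 1.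
have At0 : 0 <= A * th by rewrite mulr_ge0 ?(ltW A0) ?(ltW th0).
have KAt : 0 <= K / (A * th) := divr_ge0 K0 At0.
have M0 : 0 < M by apply: ltr_wpDl KAt ltr01.
have KM : K <= M * (A * th).
  by rewrite -ler_pdivrMr ?mulr_gt0// lerDl.
pose k j : R := M * (1 - 2^-1 ^+ j).
have p2 j : 0 < (2^-1 ^+ j : R) by rewrite exprn_gt0// invr_gt0.
have k0 j : 0 <= k j.
  rewrite mulr_ge0 ?(ltW M0)// subr_ge0 exprn_ile1 ?invr_ge0//.
  by rewrite invf_le1// ler1n.
have thj j : th `^ b ^+ j = 2^-1 ^+ j * th ^+ j.
  have -> : th `^ b = 2^-1 * th by rewrite -[in RHS]thb mulKf.
  by rewrite exprMn.
have powj j : (A * th ^+ j) `^ b = A `^ b * (2^-1 ^+ j * th ^+ j).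
  rewrite powRM ?exprn_ge0 ?(ltW A0) ?(ltW th0)//; congr (_ * _).
  have -> : th ^+ j = th `^ j%:R by rewrite powR_mulrn// ltW.
  by rewrite powRAC powR_mulrn ?powR_ge0// thj powR_mulrn// ltW.
have yj j : y (k j) <= A * th ^+ j.
  elim: j => [|j IH].
    by rewrite /k !expr0 subrr !mulr0 mulr1 lerDl.
  have kk : k j.+1 - k j = M * 2^-1 ^+ j.+1.
    by rewrite /k exprS; field.
  have kj : k j < k j.+1 by rewrite -subr_gt0 kk mulr_gt0.
  have := hy _ _ (k0 j) kj; rewrite kk => h.
  have h2 : y (k j) `^ b <= (A * th ^+ j) `^ b.
    apply: ge0_ler_powR; rewrite ?nnegrE//; first by rewrite (le_trans ler01)// ltW.
    by rewrite mulr_ge0 ?exprn_ge0 ?(ltW A0) ?(ltW th0).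
  have h3 := le_trans h (ler_wpM2l C0 h2).
  have e1 : 0 < M * 2^-1 ^+ j.+1 by rewrite mulr_gt0.
  rewrite -(ler_pM2l e1); apply: (le_trans h3); rewrite powj.
  have -> : C * (A `^ b * (2^-1 ^+ j * th ^+ j)) = K * (2^-1 ^+ j.+1 * th ^+ j).
    by rewrite /K exprS; field.
  have -> : M * 2^-1 ^+ j.+1 * (A * th ^+ j.+1) =
      M * (A * th) * (2^-1 ^+ j.+1 * th ^+ j) by rewrite (exprS th); ring.
  by rewrite ler_wpM2r// mulr_ge0 ?exprn_ge0 ?(ltW th0)// invr_ge0.
exists M => //; apply/eqP; rewrite eq_le y0 andbT.
(* The hypothesis is used once more, from [k j] straight to [M] at distance M 2^-j, which bounds y M
   by a null sequence. *)
have lim j : y M <= K / M * th ^+ j.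
  have kM : k j < M by rewrite /k gtr_pMr// gtrBl.
  have := hy _ _ (k0 j) kM.
  have -> : M - k j = M * 2^-1 ^+ j by rewrite /k; ring.
  move=> h.
  have h2 : y (k j) `^ b <= (A * th ^+ j) `^ b.
    apply: ge0_ler_powR; rewrite ?nnegrE//; first by rewrite (le_trans ler01)// ltW.
    by rewrite mulr_ge0 ?exprn_ge0 ?(ltW A0) ?(ltW th0).
  have := le_trans h (ler_wpM2l C0 h2); rewrite powj => h3.
  have e1 : 0 < M * 2^-1 ^+ j by rewrite mulr_gt0.
  rewrite -(ler_pM2l e1); apply: (le_trans h3).
  have -> : M * 2^-1 ^+ j * (K / M * th ^+ j) = K * (2^-1 ^+ j * th ^+ j).
    by field; rewrite gt_eqF.
  have -> : C * (A `^ b * (2^-1 ^+ j * th ^+ j)) = C * A `^ b * (2^-1 ^+ j * th ^+ j) by ring.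
  have e0 : 0 <= (2^-1 : R) ^+ j * th ^+ j by rewrite mulr_ge0 ?exprn_ge0 ?(ltW th0)// invr_ge0.
  apply: (ler_wpM2r e0).
  have : 0 <= C * A `^ b by rewrite mulr_ge0 ?powR_ge0.
  by rewrite /K; lra.
have c0 : K / M * th ^+ j @[j --> \oo] --> (0 : R).
  rewrite -(mulr0 (K / M)); apply: cvgM; first exact: cvg_cst.
  by apply: cvg_expr; rewrite ger0_norm// ltW.
rewrite -(cvg_lim _ c0)//; apply: limr_ge; first by apply/cvg_ex; exists 0.
exact: nearW.
Qed.

Section hoelder_support.
Context d (T : measurableType d) (R : realType).
Variable mu : {measure set T -> \bar R}.
Local Open Scope ereal_scope.

Lemma LnormE (p : R) (f : T -> R) :
  'N[mu]_p%:E[EFin \o f] = (\int[mu]_x (`|f x| `^ p)%:E) `^ p^-1.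
Proof. by rewrite unlock. Qed.

(** Hoelder's inequality for |f|^p times the indicator of [A], with exponent q/p and its conjugate 1
    / (1 - p/q), followed by the p-th root. *)
Lemma Lnorm_support (f : T -> R) (A : set T) (p q : R) : measurable_fun setT f ->
  measurable A -> (forall x, ~ A x -> f x = 0%R) -> (0 < p)%R -> (p < q)%R ->
  'N[mu]_p%:E[EFin \o f] <= 'N[mu]_q%:E[EFin \o f] * mu A `^ (p^-1 - q^-1).
Proof.
move=> mf mA fA p0 pq.
have q0 : (0 < q)%R := lt_trans p0 pq.
have pq1 : (p / q < 1)%R by rewrite ltr_pdivrMr// mul1r.
have P0 : (0 < q / p)%R by rewrite divr_gt0.
have P'0 : (0 < (1 - p / q)^-1)%R by rewrite invr_gt0 subr_gt0.
have mfp : measurable_fun setT (fun x => `|f x| `^ p)%R.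
  apply: (measurableT_comp (measurable_powR p)); exact: measurableT_comp.
have m1 : measurable_fun setT (\1_A : T -> R) by exact: measurable_indic.
have conj : ((q / p)^-1 + ((1 - p / q)^-1)^-1 = 1)%R.
  by rewrite invrK invf_div addrCA subrr addr0.
have := @hoelder _ _ _ mu (fun x => `|f x| `^ p)%R \1_A _ _ mfp m1 P0 P'0 conj.
have E1 : 'N[mu]_1[EFin \o ((fun x => `|f x| `^ p) \* \1_A)%R] = 'N[mu]_p%:E[EFin \o f] `^ p.
  rewrite Lnorm1 poweR_Lnorm ?gt_eqF//; apply: eq_integral => x _ /=.
  congr EFin; have [Ax|Ax] := pselect (A x).
    by rewrite indicE mem_set// mulr1 ger0_norm// powR_ge0.
  by rewrite indicE memNset// mulr0 normr0 fA// normr0 powR0// gt_eqF.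
have E2 : 'N[mu]_(q / p)%:E[EFin \o (fun x => `|f x| `^ p)%R] = 'N[mu]_q%:E[EFin \o f] `^ p.
  rewrite 2!LnormE -poweRrM.
  have -> : ((q / p)^-1 = q^-1 * p)%R by rewrite invf_div mulrC.
  apply: (congr1 (fun z => poweR z _)); apply: eq_integral => x _ /=; congr EFin.
  rewrite ger0_norm ?powR_ge0// -powRrM mulrCA divff ?gt_eqF// mulr1//.
have E3 : 'N[mu]_((1 - p / q)^-1)%:E[EFin \o \1_A] = mu A `^ (1 - p / q).
  rewrite LnormE invrK; congr (poweR _ _).
  rewrite -[X in _ = mu X]setIT -integral_indic//; apply: eq_integral => x _ /=.
  rewrite indicE; case: (x \in A); first by rewrite normr1 powR1.
  by rewrite normr0 powR0// gt_eqF.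
rewrite E1 E2 E3 => h.
have pi0 : (0 <= p^-1)%R by rewrite invr_ge0 ltW.
have N0 r : 0 <= 'N[mu]_r[EFin \o f] by exact: Lnorm_ge0.
have h2 : ('N[mu]_p%:E[EFin \o f] `^ p) `^ p^-1 <=
   ('N[mu]_q%:E[EFin \o f] `^ p * mu A `^ (1 - p / q)) `^ p^-1.
  apply: gt0_ler_poweR => //.
  - by rewrite in_itv/= leey poweR_ge0.
  - by rewrite in_itv/= leey mule_ge0 ?poweR_ge0.
move: h2; rewrite poweRM ?poweR_ge0// -!poweRrM divff ?gt_eqF// !poweRe1//.
by congr (_ <= _ * _ `^ _); field; rewrite !gt_eqF.
Qed.

(** Hoelder with r and its conjugate r', then [Lnorm_support] from r' up to q; r' < q is the
    condition 1/r + 1/q < 1. *)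
Lemma hoelder_support (f g : T -> R) (A : set T) (r q : R) :
  measurable_fun setT f -> measurable_fun setT g ->
  measurable A -> (forall x, ~ A x -> f x = 0%R) -> (1 < r)%R -> (1 < q)%R ->
  (r^-1 + q^-1 < 1)%R ->
  'N[mu]_1[EFin \o (g \* f)%R] <=
  'N[mu]_r%:E[EFin \o g] * ('N[mu]_q%:E[EFin \o f] * mu A `^ (1 - r^-1 - q^-1)).
Proof.
move=> mf mg mA fA r1 q1 rq.
have r0 : (0 < r)%R by rewrite (lt_trans ltr01).
have q0 : (0 < q)%R by rewrite (lt_trans ltr01).
have ri : (r^-1 < 1)%R by rewrite invf_lt1.
have s0 : (0 < (1 - r^-1)^-1)%R by rewrite invr_gt0 subr_gt0.
have conj : (r^-1 + ((1 - r^-1)^-1)^-1 = 1)%R by rewrite invrK addrCA subrr addr0.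
apply: (le_trans (hoelder mu mg mf r0 s0 conj)).
apply: lee_wpmul2l; first exact: Lnorm_ge0.
have sq : ((1 - r^-1)^-1 < q)%R.
  by rewrite -[ltRHS]invrK ltf_pV2 ?posrE ?invr_gt0 ?subr_gt0//; lra.
by have := Lnorm_support mf mA fA s0 sq; rewrite invrK.
Qed.

Lemma chebyshev_Lnorm (f : T -> R) (A : set T) (q c : R) : measurable_fun setT f ->
  measurable A -> (0 < q)%R -> (0 <= c)%R -> (forall x, A x -> (c <= `|f x|)%R) ->
  c%:E * mu A `^ q^-1 <= 'N[mu]_q%:E[EFin \o f].
Proof.
move=> mf mA q0 c0 cf.
have h : (c `^ q)%:E * mu A <= \int[mu]_x (`|f x| `^ q)%:E.
  rewrite -[X in mu X]setIT -integral_indic// -ge0_integralZl_EFin ?powR_ge0//; last first.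
    by apply/measurable_EFinP; exact: measurable_indic.
  apply: ge0_le_integral => //.
  - by move=> x _; rewrite -EFinM lee_fin mulr_ge0 ?powR_ge0.
  - by apply: measurable_funeM; apply/measurable_EFinP; exact: measurable_indic.
  - apply/measurable_EFinP; apply: (measurableT_comp (measurable_powR q)).
    exact: measurableT_comp.
  - move=> x _; rewrite -EFinM lee_fin indicE.
    have [Ax|Ax] := pselect (A x); last by rewrite memNset// mulr0 powR_ge0.
    rewrite mem_set// mulr1; apply: ge0_ler_powR; rewrite ?nnegrE ?(ltW q0)//.
    exact: cf.
have qi : (0 <= q^-1)%R by rewrite invr_ge0 ltW.
have : ((c `^ q)%:E * mu A) `^ q^-1 <= (\int[mu]_x (`|f x| `^ q)%:E) `^ q^-1.
  apply: gt0_ler_poweR => //.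
  - by rewrite in_itv/= leey mule_ge0// lee_fin powR_ge0.
  - by rewrite in_itv/= leey integral_ge0// => x _; rewrite lee_fin powR_ge0.
rewrite poweRM ?lee_fin ?powR_ge0// poweR_EFin -powRrM divff ?gt_eqF// powRr1//.
move=> /le_trans; apply; rewrite unlock le_eqVlt; apply/orP; left; apply/eqP.
by congr (_ `^ _); apply: eq_integral => x _ /=.
Qed.

End hoelder_support.

(* This is [(x - k)^+ / x], and [0] for [x <= k] whatever the value of [x `^ (-1)]. *)
Definition excess_ratio {R : realType} (k x : R) : R := excess k x * x `^ (-1).

Section excess_ratio.
Context {R : realType}.
Implicit Types k x t : R.

Lemma excess_ratioP k x : 0 <= k ->
  0 <= excess_ratio k x <= 1 /\ x * excess_ratio k x = excess k x.
Proof.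
move=> k0; rewrite /excess_ratio; have [xk|kx] := leP x k.
  have -> : excess k x = 0 by apply/max_idPr; rewrite subr_le0.
  by rewrite !mul0r mulr0 lexx ler01.
have x0 : 0 < x := le_lt_trans k0 kx.
have -> : excess k x = x - k by apply/max_idPl; rewrite subr_ge0 ltW.
rewrite powR_inv1 ?(ltW x0)//; split; last by rewrite mulrCA divff ?gt_eqF// mulr1.
by rewrite divr_ge0 ?subr_ge0 ?(ltW kx) ?(ltW x0)//= ler_pdivrMr// mul1r gerBl.
Qed.

Lemma measurable_excess_ratio d (T : measurableType d) k (f : T -> R) :
  measurable_fun setT f -> measurable_fun setT (fun z => excess_ratio k (f z)).
Proof.
move=> mf; apply: measurable_funM; first exact: measurable_excess.
exact: (measurableT_comp (measurable_powR (-1))).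
Qed.

Lemma excess_sub_norm_le k t x : 0 <= k -> 0 <= t <= 1 ->
  `|x - t * excess k x| <= `|x|.
Proof.
move=> k0 /andP[t0 t1]; have [/andP[r0 r1] <-] := excess_ratioP x k0.
rewrite mulrCA -[X in X - _]mulr1 -mulrBr normrM ler_piMr//.
by rewrite ler_norml; apply/andP; split; nra.
Qed.

Lemma scale_exists (a x y : R) : 0 < a -> 0 <= x -> 0 <= y ->
  exists t, [/\ 0 < t, t <= 1, t * x <= a & t * y <= a].
Proof.
move=> a0 x0 y0; have s0 : 0 < a + x + y by lra.
exists (a / (a + x + y)); split.
- exact: divr_gt0.
- by rewrite ler_pdivrMr//; lra.
- by rewrite mulrAC ler_pdivrMr// ler_pM2l//; lra.
- by rewrite mulrAC ler_pdivrMr// ler_pM2l//; lra.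
Qed.

End excess_ratio.

(** * The comparison argument at a local solution *)

Section control_norm.
Context {R : realType} {d : nat} (T : R) (Omega : lipschitz_domain R d).
Local Notation U := (L2U T Omega).
Local Notation ip := (L2ip (leb_IO T Omega)).
Implicit Types u v : U.

Lemma normU_ge0 u : 0 <= normU u.
Proof. by rewrite /normU fine_ge0// Lnorm_ge0. Qed.

Lemma normU_sqr u : normU u ^+ 2 = ip u u.
Proof.
have Nf : ('N[leb_IO T Omega]_2%:E[EFin \o u] = (normU u)%:E)%E.
  by rewrite /normU; apply/esym; exact: (finite_norm_fine u).
have := Lnorm2_sqr (leb_IO T Omega) u; rewrite Nf -L2ip_sqr poweR_EFin => -[<-].
by rewrite powR_mulrn// normU_ge0.
Qed.

Lemma normUZ a u : normU (a *: u) = `|a| * normU u.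
Proof.
apply/eqP; rewrite -(@eqrXn2 _ 2)// ?mulr_ge0 ?normU_ge0//.
by rewrite exprMn !normU_sqr sipZl sipZr real_normK ?num_real// expr2 mulrA.
Qed.

Lemma le_normU u v : (forall z, `|u z| <= `|v z|) -> normU u <= normU v.
Proof.
move=> uv; rewrite -(@ler_pXn2r _ 2)// ?nnegrE ?normU_ge0// !normU_sqr.
have := @L2ip_le _ _ _ (leb_IO T Omega) 0 1 0 u u v v.
rewrite !mul0r !addr0 mul1r; apply => z.
rewrite !mul0r !addr0 mul1r -(real_normK (num_real (u z))) -(real_normK (num_real (v z))).
by rewrite lerXn2r ?nnegrE.
Qed.

End control_norm.

(** Index 0 is the solution and 1 the competitor: [N0], [N1] are squared control norms, [w0], [w1]
    squared W-norms, [P0], [P1] the integrals of |w|^p, [n] is |z|_W^2, [D] the derivative of f in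
    direction -v, and [m] the norm of v. The terms in N and P drop by monotonicity, 2t - t^2 >= t,
    and t cancels. *)
Lemma comparison_slope (R : realType) (F0 F1 a N0 N1 b w0 w1 n g P0 P1 D e t m : R) :
  0 < a -> 0 < b -> 0 < g -> 0 < t -> t <= 1 -> 0 <= n ->
  F0 + a / 2 * N0 + b / 2 * w0 + g * P0 <= F1 + a / 2 * N1 + b / 2 * w1 + g * P1 ->
  N1 <= N0 -> P1 <= P0 -> w1 + (2 * t - t ^+ 2) * n <= w0 ->
  `|F1 - F0 - t * D| <= e * (t * m) ->
  b / 2 * n <= `|D| + e * m.
Proof.
move=> a0 b0 g0 t0 t1 n0 opt N10 P10 w10.
rewrite ler_norml => /andP[_ Fle].
have e1 : a / 2 * N1 <= a / 2 * N0 by rewrite ler_pM2l// divr_gt0.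
have e2 : g * P1 <= g * P0 by rewrite ler_pM2l.
have e3 : b / 2 * (w1 + (2 * t - t ^+ 2) * n) <= b / 2 * w0 by rewrite ler_pM2l// divr_gt0.
have e4 : b / 2 * (t * n) <= b / 2 * ((2 * t - t ^+ 2) * n).
  by rewrite ler_pM2l ?divr_gt0// ler_wpM2r//; nra.
have e5 : t * D <= t * `|D| by rewrite ler_pM2l// ler_norm.
rewrite -(ler_pM2l t0) mulrDr.
have -> : t * (b / 2 * n) = b / 2 * (t * n) by ring.
have -> : t * (e * m) = e * (t * m) by ring.
move: opt; rewrite mulrDr in e3; lra.
Qed.

Lemma one_sub_mul01 (R : realDomainType) (a b : R) : 0 <= a <= 1 -> 0 <= b <= 1 ->
  0 <= 1 - a * b <= 1.
Proof.
move=> /andP[a0 a1] /andP[b0 b1].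
by rewrite subr_ge0 mulr_ile1//= gerBl mulr_ge0.
Qed.

Section optimality.
Context {R : realType} {d : nat} (Omega : lipschitz_domain R d) (T s : R).
Hypothesis s01 : 0 < s < 1.
Variable W : frac_space R d.
Hypothesis Wwf : frac_space_wf Omega W.
Local Notation E := 'rV[R]_d.
Local Notation U := (L2U T Omega).
Local Notation leb := (lebesgue_measure_rV R d).
Local Notation oO := (domain_open Omega).

(** A real-valued integral is monotone only where it is finite. Finiteness comes from |w|^p <= 1 +
    w^2 for 0 < p < 1 and the finite measure of the domain. *)
Lemma integral_powR_le (p : R) (w1 w : E -> R) : 0 < p < 1 ->
  measurable_fun setT w1 -> w \in Lfun (leb_on oO) 2%:E ->
  (forall x, `|w1 x| <= `|w x|) ->
  \int[leb]_(x in Omega) (`|w1 x| `^ p) <= \int[leb]_(x in Omega) (`|w x| `^ p).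
Proof.
move=> /andP[p0 p1] mw1 wL w1w.
have mO : measurable (domain Omega) := open_measurable_mx oO.
have /Lfun2E[mw w2y] := wL.
have mp (g : E -> R) : measurable_fun setT g ->
    measurable_fun setT (fun x => (`|g x| `^ p)%:E).
  move=> mg; apply/measurable_EFinP; apply: (measurableT_comp (measurable_powR p)).
  exact: measurableT_comp.
have fin (g : E -> R) : measurable_fun setT g -> (forall x, `|g x| <= `|w x|) ->
    (\int[leb]_(x in Omega) (`|g x| `^ p)%:E \is a fin_num)%E.
  move=> mg gw; rewrite ge0_fin_numE; last first.
    by apply: integral_ge0 => x _; rewrite lee_fin powR_ge0.
  have -> : (\int[leb]_(x in Omega) (`|g x| `^ p)%:E = \int[leb_on oO]_x (`|g x| `^ p)%:E)%E.
    by apply/esym; exact: (integral_mrestr leb mO (mp _ mg)).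
  apply: (@le_lt_trans _ _ (\int[leb_on oO]_x (1 + w x ^+ 2)%:E)%E).
    apply: ge0_le_integral => //; [exact: mp| |].
      by apply/measurable_EFinP; apply: measurable_funD => //; exact: measurable_funX.
    move=> x _; rewrite lee_fin.
    have [g1|g1] := leP `|g x| 1.
      have gp : `|g x| `^ p <= 1 `^ p by apply: ge0_ler_powR; rewrite ?nnegrE// ltW.
      by move: gp; rewrite powR1; have := sqr_ge0 (w x); lra.
    have h1 : `|g x| `^ p <= `|g x| `^ 2 by apply: ler_powR; [exact: ltW|lra].
    have h2 : `|g x| ^+ 2 <= `|w x| ^+ 2 by rewrite lerXn2r ?nnegrE.
    move: h1 h2; rewrite powR_mulrn// (real_normK (num_real (w x))); lra.
  under eq_integral do rewrite EFinD.
  rewrite ge0_integralD//; last 2 first.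
  - by move=> x _; rewrite lee_fin sqr_ge0.
  - by apply/measurable_EFinP; exact: measurable_funX.
  rewrite integral_cst// mul1e lte_add_pinfty//; exact: leb_on_lty.
apply: fine_le; [exact: fin|exact: fin|].
apply: ge0_le_integral => //; try by move=> x _; rewrite lee_fin powR_ge0.
- by apply: measurable_funTS; exact: mp.
- by apply: measurable_funTS; exact: mp.
- move=> x _; rewrite lee_fin; apply: ge0_ler_powR; rewrite ?nnegrE ?(ltW p0)//.
Qed.

Variables (f : U -> R) (f' : U -> U) (alpha beta gamma p : R).
Hypotheses (f_C1 : frechet_C1 f f') (a0 : 0 < alpha) (b0 : 0 < beta) (g0 : 0 < gamma).
Hypothesis p01 : 0 < p < 1.
Variables (ubar : U) (wbar : E -> R).
Hypothesis sol : local_solution s W f alpha beta gamma p ubar wbar.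

(** No limit in t is taken: for each error e one sufficiently small t gives the inequality up to e,
    and e is arbitrary. *)
Lemma variational_excess k : 0 <= k -> exists v : U,
  {ae leb_IO T Omega, forall z, `|v z| <= excess k (wbar z.2)} /\
  beta / 2 * normW s Omega W (fun x => excess k (wbar x)) ^+ 2 <= `|dotU (f' ubar) v|.
Proof.
move=> k0; have [[Hw uw] [rho rho0 opt]] := sol.
have wL := in_W_Lfun2 Hw; have /Lfun2E[mw _] := wL.
pose vf (z : measurableTypeR R * E) : R := ubar z * excess_ratio k (wbar z.2).
have mvf : measurable_fun setT vf.
  apply: measurable_funM; first exact: L2_measurable.
  by apply: measurable_excess_ratio; exact: (measurableT_comp mw measurable_snd).
have ratio z : 0 <= excess_ratio k (wbar z) <= 1 by case: (excess_ratioP (wbar z) k0).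
have vu z : `|vf z| <= `|ubar z|.
  have /andP[r0 r1] := ratio z.2.
  by rewrite /vf normrM (ger0_norm r0) ler_piMr.
have vL : vf \in Lfun (leb_IO T Omega) 2%:E.
  have /Lfun2E[_ uy] := LfunP ubar.
  apply/Lfun2E; split => //; apply: le_lt_trans uy; apply: ge0_le_integral => //.
  - by move=> z _; rewrite lee_fin sqr_ge0.
  - by apply/measurable_EFinP; exact: measurable_funX.
  - by apply/measurable_EFinP; apply: measurable_funX; exact: L2_measurable.
  - move=> z _; rewrite lee_fin -(real_normK (num_real (vf z))) -(real_normK (num_real (ubar z))).
    by rewrite lerXn2r ?nnegrE.
pose v : U := Lfun_Sub (lee1n 2) vL; exists v; split.
  apply: filterS uw => z uz; have [/andP[r0 r1] <-] := excess_ratioP (wbar z.2) k0.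
  by rewrite /= normrM (ger0_norm r0) ler_wpM2r.
set z := (fun x => excess k (wbar x)).
have zW : in_W s Omega W z.
  have le01 : 0 <= (1 : R) <= 1 by rewrite ler01 lexx.
  have [zW _ _] := in_W_excess s01 Wwf k0 le01 Hw; exact: zW.
apply/ler_addgt0Pr => e e0.
(* The remainder per unit of t is this number times |v|, hence at most e; adding 1 covers v = 0. *)
have e'0 : 0 < e / (normU v + 1) by rewrite divr_gt0// ltr_wpDl ?normU_ge0.
have [dlt dlt0 fdlt] := f_C1.1 ubar _ e'0.
have ed0 : 0 < Num.min dlt rho by rewrite lt_min dlt0.
have nz0 : 0 <= normW s Omega W z by exact: sqrtr_ge0.
have [t [t0 t1 tv tz]] := scale_exists ed0 (normU_ge0 v) nz0.
have t01 : 0 <= t <= 1 by rewrite t1 ltW.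
have [_ w1W w1le] := in_W_excess s01 Wwf k0 t01 Hw.
rewrite -/z in w1W w1le.
pose h : U := (- t) *: v.
have nh : normU h = t * normU v by rewrite normUZ normrN gtr0_norm.
(* The control is multiplied by 1 - t z/wbar, the same factor that turns wbar into wbar - t z; being
   nonnegative, it preserves |u| <= w. *)
have uhE y : (ubar + h) y = ubar y * (1 - t * excess_ratio k (wbar y.2)).
  by rewrite /h /=; rewrite mulrBr mulr1 mulrCA scaleNr; congr (_ - _); rewrite mulrA.
have scale y : 0 <= 1 - t * excess_ratio k (wbar y) <= 1.
  exact: one_sub_mul01.
have uhle y : `|(ubar + h) y| <= `|ubar y|.
  have /andP[q0 q1] := scale y.2.
  by rewrite uhE normrM (ger0_norm q0) ler_piMr.
have adm : admissible s W (ubar + h) (wbar \- (fun x => t * z x)).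
  split; first exact: w1W.
  apply: filterS uw => y uy; have /andP[q0 q1] := scale y.2.
  rewrite uhE normrM (ger0_norm q0) /= /z.
  have [_ <-] := excess_ratioP (wbar y.2) k0.
  have -> : wbar y.2 - t * (wbar y.2 * excess_ratio k (wbar y.2)) =
      wbar y.2 * (1 - t * excess_ratio k (wbar y.2)) by ring.
  by rewrite ler_wpM2r.
have nW : normW s Omega W ((wbar \- (fun x => t * z x)) \- wbar) = t * normW s Omega W z.
  have := normWZ Wwf (- t) zW; rewrite normrN (gtr0_norm t0) => <-; congr normW.
  by apply/funext => x /=; ring.
move: tv tz; rewrite !le_min => /andP[tvd tvr] /andP[tzd tzr].
have hub : ubar + h - ubar = h by rewrite addrAC subrr add0r.
have := opt _ _ adm; rewrite hub nh nW => /(_ tvr tzr) cmp.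
have := fdlt h; rewrite nh => /(_ tvd) fr.
have Dh : dotU (f' ubar) h = t * dotU (f' ubar) (- v).
  rewrite /h scaleNr -scalerN; exact: (sipZr (L2ip (leb_IO T Omega)) t (- v) (f' ubar)).
have DN : `|dotU (f' ubar) (- v)| = `|dotU (f' ubar) v|.
  have : dotU (f' ubar) (- v) = - dotU (f' ubar) v.
    have := sipZr (L2ip (leb_IO T Omega)) (-1) v (f' ubar).
    by rewrite scaleN1r mulN1r; apply.
  by move=> ->; rewrite normrN.
rewrite Dh in fr.
have := comparison_slope a0 b0 g0 t0 t1 (sqr_ge0 _) cmp _ _ w1le fr.
rewrite DN => le1; apply: (le_trans (le1 _ _)).
- by rewrite lerXn2r ?nnegrE ?normU_ge0//; exact: le_normU.
- apply: integral_powR_le => //; last by move=> x; exact: excess_sub_norm_le.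
  by have /Lfun2E[] := in_W_Lfun2 w1W.
- rewrite lerD2l mulrAC ler_pdivrMr ?ltr_wpDl ?normU_ge0// ler_wpM2l ?(ltW e0)// lerDl.
  exact: ler01.
Qed.

End optimality.

(** * Decay of the superlevel sets *)

Section level_sets.
Context d (X : measurableType d) (R : realType).
Variable mu : {measure set X -> \bar R}.
Hypothesis mu_fin : (mu setT < +oo)%E.

Lemma measurable_superlevel (w : X -> R) k : measurable_fun setT w ->
  measurable [set x | k < w x].
Proof.
move=> mw; have := mw measurableT _ (measurable_itv `]k, +oo[); rewrite setTI.
by congr measurable; apply/seteqP; split => x /=; rewrite in_itv/= andbT.
Qed.

Lemma finite_measure_fin_num A : measurable A -> mu A \is a fin_num.
Proof.
move=> mA; rewrite ge0_fin_numE//; apply: le_lt_trans mu_fin.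
by apply: le_measure; rewrite ?inE.
Qed.

(** [G] may be infinite at some points; its finite L^r norm makes that a null set, so it can be
    replaced by a real function. The excess lives on the superlevel set, which supplies the measure
    factor. *)
Lemma integral_excess_hoelder (w : X -> R) (G : X -> \bar R) (r q k : R) :
  measurable_fun setT w -> measurable_fun setT G -> (forall x, 0 <= G x)%E ->
  1 < r -> 1 < q -> r^-1 + q^-1 < 1 -> ('N[mu]_r%:E[G] < +oo)%E ->
  (\int[mu]_x ((excess k (w x))%:E * G x) <= 'N[mu]_r%:E[G] *
    ('N[mu]_q%:E[EFin \o (fun x => excess k (w x))] *
     mu [set x | k < w x]%R `^ (1 - r^-1 - q^-1)))%E.
Proof.
move=> mw mG G0 r1 q1 rq Gy.
have r0 : 0 < r by rewrite (lt_trans ltr01).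
pose g x := fine (G x).
have mg : measurable_fun setT g by exact: measurableT_comp.
have mz := measurable_excess k mw.
have gG x : ((g x)%:E <= G x)%E.
  by rewrite /g; have := G0 x; case: (G x) => [a||]//=; rewrite leey.
have g0 x : 0 <= g x by exact: fine_ge0.
have mGr : measurable_fun setT (fun x => `|G x| `^ r)%E.
  apply: (measurableT_comp (measurable_poweR r)); exact: measurableT_comp.
have Gae : {ae mu, forall x, G x \is a fin_num}.
  have iG : mu.-integrable setT (fun x => `|G x| `^ r)%E.
    apply/integrableP; split => //.
    under eq_integral do rewrite gee0_abs ?poweR_ge0//.
    by rewrite -poweR_Lnorm ?gt_eqF// poweR_lty.
  have := integrable_ae measurableT iG; apply: filterS => x /(_ I).
  by have := G0 x; case: (G x) => [a||]//=; rewrite gt_eqF.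
have ez : (\int[mu]_x ((excess k (w x))%:E * G x) =
    'N[mu]_1[EFin \o (g \* (fun x => excess k (w x)))%R])%E.
  rewrite Lnorm1; apply: ae_eq_integral => //.
  - by apply: emeasurable_funM => //; apply/measurable_EFinP.
  - by apply: measurableT_comp => //; apply/measurable_EFinP; exact: measurable_funM.
  - apply: filterS Gae => x Gx _ /=.
    rewrite ger0_norm ?mulr_ge0 ?excess_ge0// mulrC EFinM.
    by congr (_ * _)%E; rewrite /g fineK.
rewrite ez.
have supp x : ~ [set x | k < w x] x -> excess k (w x) = 0.
  by move=> /negP; rewrite -leNgt => wk; apply/max_idPr; rewrite subr_le0.
apply: (le_trans (hoelder_support mu mz mg (measurable_superlevel k mw) supp r1 q1 rq)).
apply: lee_wpmul2r; first by rewrite mule_ge0 ?Lnorm_ge0 ?poweR_ge0.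
rewrite unlock; apply: gt0_ler_poweR.
- by rewrite invr_ge0 ltW.
- by rewrite in_itv/= leey integral_ge0// => x _; exact: poweR_ge0.
- by rewrite in_itv/= leey integral_ge0// => x _; exact: poweR_ge0.
- apply: ge0_le_integral => //.
  + by move=> x _; exact: poweR_ge0.
  + apply: (measurableT_comp (measurable_poweR r)); apply: measurableT_comp => //.
    by apply/measurable_EFinP.
  + move=> x _; apply: gt0_ler_poweR; rewrite ?(ltW r0) ?in_itv/= ?leey ?andbT//.
    by rewrite ger0_norm// gee0_abs.
Qed.

(** [n k] stands for the W-norm of the excess at level k; the last two hypotheses are the embedding
    and the tested optimality condition. *)
Lemma bounded_of_excess (w : X -> R) (G : X -> \bar R) (n : R -> R) (r q c C : R) :
  measurable_fun setT w -> measurable_fun setT G -> (forall x, 0 <= G x)%E ->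
  1 < r -> 2 < q -> r^-1 + 2 / q < 1 -> ('N[mu]_r%:E[G] < +oo)%E -> 0 < c -> 0 <= C ->
  (forall k, 0 <= k -> 0 <= n k) ->
  (forall k, 0 <= k ->
    ('N[mu]_q%:E[EFin \o (fun x => excess k (w x))] <= (C * n k)%:E)%E) ->
  (forall k, 0 <= k ->
    ((c * n k ^+ 2)%:E <= \int[mu]_x ((excess k (w x))%:E * G x))%E) ->
  exists2 M, 0 < M & mu [set x | M < w x] = 0.
Proof.
move=> mw mG G0 r1 q2 rq Gy c0 C0 n0 emb var.
have q0 : 0 < q by lra.
have q1 : 1 < q by lra.
have qi : 0 < q^-1 by rewrite invr_gt0.
have rq1 : r^-1 + q^-1 < 1 by lra.
pose th : R := 1 - r^-1 - q^-1.
have th0 : 0 < th by rewrite /th; lra.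
(* This says 1 - 1/r - 1/q > 1/q, where the right side is the Chebyshev exponent; here the full
   hypothesis on r and q enters. *)
have b1 : 1 < q * th.
  by rewrite /th mulrBr divff ?gt_eqF// ltrBrDr -(ltr_pM2r qi) mulrAC divff ?gt_eqF//; lra.
pose A k := [set x | k < w x].
have mA k : measurable (A k) by exact: measurable_superlevel.
pose y k := fine (mu (A k)) `^ q^-1.
have muA k : mu (A k) = (fine (mu (A k)))%:E by rewrite fineK// finite_measure_fin_num.
have [K NK] : exists K : R, ('N[mu]_r%:E[G] = K%:E)%E.
  by exists (fine 'N[mu]_r%:E[G]%E); rewrite fineK// ge0_fin_numE// Lnorm_ge0.
have K0 : 0 <= K by rewrite -lee_fin -NK Lnorm_ge0.
pose N k := fine 'N[mu]_q%:E[EFin \o (fun x => excess k (w x))]%E.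
have NE k : 0 <= k -> ('N[mu]_q%:E[EFin \o (fun x => excess k (w x))] = (N k)%:E)%E.
  move=> k0; rewrite fineK// ge0_fin_numE ?Lnorm_ge0//.
  by apply: le_lt_trans (emb _ k0) (ltry _).
have N0 k : 0 <= N k by rewrite fine_ge0// Lnorm_ge0.
have Nn k : 0 <= k -> N k <= C * n k by move=> k0; rewrite -lee_fin -NE// emb.
have cn k : 0 <= k -> c * n k ^+ 2 <= K * (N k * fine (mu (A k)) `^ th).
  move=> k0; rewrite -lee_fin; apply: (le_trans (var _ k0)).
  have := integral_excess_hoelder k mw mG G0 r1 q1 rq1 Gy.
  by rewrite NK NE// -/(A k) -/th muA poweR_EFin -!EFinM.
pose C1 := C ^+ 2 * K / c.
have C10 : 0 <= C1 by rewrite divr_ge0 ?(ltW c0)// mulr_ge0 ?sqr_ge0.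
have NC k : 0 <= k -> N k <= C1 * fine (mu (A k)) `^ th.
  move=> k0; have := N0 k; rewrite le_eqVlt => /predU1P[<-|Nk0].
    by rewrite mulr_ge0 ?powR_ge0.
  (* Embedding and [cn] give N^2 <= C^2 n^2 <= C1 N m^th with m the measure of {w > k}; one factor N
     > 0 is cancelled. *)
  rewrite -(ler_pM2l Nk0) -expr2.
  have s1 : N k ^+ 2 <= (C * n k) ^+ 2.
    by rewrite lerXn2r ?nnegrE ?N0 ?mulr_ge0 ?n0// Nn.
  apply: (le_trans s1); rewrite exprMn.
  have -> : N k * (C1 * fine (mu (A k)) `^ th) =
      C ^+ 2 * (K * (N k * fine (mu (A k)) `^ th) / c) by rewrite /C1; ring.
  rewrite ler_wpM2l ?sqr_ge0// ler_pdivlMr// mulrC; exact: cn.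
have [M M0 yM] : exists2 M, 0 < M & y M = 0.
  apply: (@stampacchia _ y C1 (q * th)) => // [k|k h k0 kh]; first exact: powR_ge0.
  have hk : 0 <= h - k by rewrite subr_ge0 ltW.
  have ch : (((h - k) * y h)%:E <= (N k)%:E)%E.
    have zh x : A h x -> h - k <= `|excess k (w x)|.
      move=> /= hx; rewrite ger0_norm ?excess_ge0//.
      by rewrite /excess le_max lerD2r ltW.
    have := chebyshev_Lnorm mu (measurable_excess k mw) (mA h) q0 hk zh.
    by rewrite NE// muA poweR_EFin -EFinM.
  rewrite lee_fin in ch; apply: (le_trans ch); apply: (le_trans (NC _ k0)).
  by rewrite /y -powRrM mulrA mulVf ?gt_eqF// mul1r.
exists M => //; rewrite -/(A M) muA; congr EFin.
by move: yM; rewrite /y => /powR_eq0_eq0.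
Qed.

End level_sets.

(** * Space-time integrals *)

Section iterated_swap.
Context d1 d2 (T1 : measurableType d1) (T2 : measurableType d2) (R : realType).
Variable m1 : {sigma_finite_measure set T1 -> \bar R}.
Variable m2 : {sigma_finite_measure set T2 -> \bar R}.
Variables (A : set T1) (B : set T2) (mA : measurable A) (mB : measurable B).
Variable h : T1 * T2 -> \bar R.
Hypotheses (mh : measurable_fun setT h) (h0 : forall z, (0 <= h z)%E).
Local Open Scope ereal_scope.

Lemma measurable_integral_mrestr :
  measurable_fun setT (fun y => \int[mrestr m1 mA]_x h (x, y)).
Proof.
pose g := h \_ (A `*` setT).
have mg : measurable_fun setT g.
  by apply/(measurable_restrictT _ (measurableX mA measurableT)); exact: measurable_funTS.
have g0 z : 0 <= g z by rewrite /g patchE; case: ifPn.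
rewrite [X in measurable_fun _ X](_ : _ = fubini_G m1 g).
  exact: measurable_fun_fubini_tonelli_G.
apply/funext => y; rewrite /fubini_G integral_mrestr; last exact: measurableT_comp.
rewrite integral_mkcond; apply: eq_integral => x _.
by rewrite /g !patchE in_setX in_setT andbT.
Qed.

(** The measure on I x Omega is a restricted product, not a product of restrictions, so Tonelli is
    applied to [h] extended by zero; the time integral comes out innermost. *)
Lemma integral_mrestr_prod : \int[mrestr (m1 \x m2) (measurableX mA mB)]_z h z =
  \int[mrestr m2 mB]_y \int[mrestr m1 mA]_x h (x, y).
Proof.
pose g := h \_ (A `*` B).
have mg : measurable_fun setT g.
  by apply/(measurable_restrictT _ (measurableX mA mB)); exact: measurable_funTS.
have g0 z : 0 <= g z by rewrite /g patchE; case: ifPn.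
rewrite integral_mrestr// integral_mkcond -/g.
rewrite (fubini_tonelli2 _ mg g0) /fubini_G.
rewrite integral_mrestr; last exact: measurable_integral_mrestr.
rewrite [RHS]integral_mkcond; apply: eq_integral => y _.
rewrite [RHS]patchE; case: ifPn => yB.
  rewrite integral_mrestr; last exact: measurableT_comp.
  rewrite [RHS]integral_mkcond; apply: eq_integral => x _.
  by rewrite /g !patchE in_setX yB andbT.
by apply: integral0_eq => x _; rewrite /g patchE in_setX (negbTE yB) andbF.
Qed.

End iterated_swap.

Section space_time.
Context {R : realType} {d : nat} (T : R) (Omega : lipschitz_domain R d).
Local Notation E := 'rV[R]_d.
Local Notation U := (L2U T Omega).
Local Notation leb := (lebesgue_measure_rV R d).
Local Notation oO := (domain_open Omega).
Implicit Types g v : U.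

(** As T > 0, a set of points in space is null exactly when its cylinder over the time interval is
    null. *)
Lemma leb_IO_snd (N : set E) : 0 < T -> measurable N ->
  leb_IO T Omega (snd @^-1` N) = (T%:E * leb_on oO N)%E.
Proof.
move=> T0 mN; rewrite /leb_IO /= /mrestr.
have -> : snd @^-1` N `&` `]0, T[ `*` Omega = `]0, T[ `*` (N `&` Omega).
  by apply/seteqP; split => -[t x] /= [] // ? [].
rewrite product_measure1E//; last by apply: measurableI => //; exact: open_measurable_mx oO.
congr (_ * _)%E; apply: etrans (lebesgue_measure_itv _) _.
by rewrite /= lte_fin T0 sube0.
Qed.

(** The bound [z] on |v| does not depend on time, so it leaves the time integral, and the L^1(I)
    norm of [g] remains. *)
Lemma dotU_le g v (z : E -> R) : measurable_fun setT z -> (forall x, 0 <= z x) ->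
  {ae leb_IO T Omega, forall y, `|v y| <= z y.2} ->
  (`|dotU g v|%:E <= \int[leb_on oO]_x
     ((z x)%:E * 'N[leb_I T]_1[(fun t => (g (t, x))%:E)]))%E.
Proof.
move=> mz z0 vz.
have mg : measurable_fun setT g := L2_measurable g.
have mv : measurable_fun setT v := L2_measurable v.
pose h (y : measurableTypeR R * E) : \bar R := ((z y.2)%:E * `|(g y)%:E|)%E.
have mz2 : measurable_fun setT (fun y : measurableTypeR R * E => z y.2).
  exact: measurableT_comp.
have mh : measurable_fun setT h.
  apply: emeasurable_funM; first exact/measurable_EFinP.
  by apply: measurableT_comp => //; exact/measurable_EFinP.
have h0 y : (0 <= h y)%E by rewrite mule_ge0// lee_fin.
have -> : (\int[leb_on oO]_x ((z x)%:E * 'N[leb_I T]_1[(fun t => (g (t, x))%:E)]) =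
    \int[leb_IO T Omega]_y h y)%E.
  have := integral_mrestr_prod lebesgue_measure leb (measurable_itv `]0, T[)
    (open_measurable_mx oO) mh h0.
  move=> hh; rewrite {}[RHS]hh; apply: eq_integral => x _.
  rewrite Lnorm1 -ge0_integralZl ?lee_fin//.
  apply: measurableT_comp => //; apply/measurable_EFinP.
  exact: (measurable_fun_pair1 x mg).
have igv := L2_integrableM g v.
have -> : (`|dotU g v|%:E = `|\int[leb_IO T Omega]_y (g y * v y)%:E|)%E.
  by rewrite /dotU /Rintegral -abse_EFin fineK//; exact: integrable_fin_num igv.
have mgv : measurable_fun setT (fun y => (g y * v y)%:E) by case/integrableP: igv.
apply: (le_trans (le_abse_integral _ measurableT mgv)).
apply: ae_ge0_le_integral => //; first exact: measurableT_comp.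
apply: filterS vz => y vy _.
by rewrite /h /= -EFinM lee_fin normrM mulrC ler_wpM2r.
Qed.

Lemma measurable_timeL1 g :
  measurable_fun setT (fun x => 'N[leb_I T]_1[(fun t => (g (t, x))%:E)]%E).
Proof.
have mg : measurable_fun setT g := L2_measurable g.
under eq_fun do rewrite Lnorm1.
apply: (@measurable_integral_mrestr _ _ _ _ _ _ _ _ (fun z => `|(g z)%:E|%E)) => //.
by apply: measurableT_comp => //; exact/measurable_EFinP.
Qed.

End space_time.

(** * Essential bounds from a null superlevel set *)

Lemma Lfun_pinfty d (T : measurableType d) (R : realType)
    (mu : {measure set T -> \bar R}) (f : T -> R) (M : R) :
  measurable_fun setT f -> {ae mu, forall x, `|f x| <= M} -> f \in Lfun mu +oo%E.
Proof.
move=> mf fM; rewrite inE /=; apply/andP; split; rewrite inE//=.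
rewrite /finite_norm unlock /=; case: ifPn => // _.
apply: (@le_lt_trans _ _ M%:E); last exact: ltry.
by apply/ess_supP; apply: filterS fM => x /= xM; rewrite lee_fin.
Qed.

Theorem theorem4p11 (R : realType) (d : nat) (hd : (0 < d)%N)
    (Omega : lipschitz_domain R d) (T : R) (hT : 0 < T)
    (s : R) (hs : 0 < s < 1)
    (W : frac_space R d) (hW : frac_space_wf Omega W)
    (f : L2U T Omega -> R) (f' : L2U T Omega -> L2U T Omega)
    (f_ae : ae_invariant f) (f_wlsc : weakly_lsc f)
    (f_bound : affinely_minorized f) (f_C1 : frechet_C1 f f')
    (alpha beta gamma p : R)
    (halpha : 0 < alpha) (hbeta : 0 < beta) (hgamma : 0 < gamma)
    (hp : 0 < p < 1)
    (r q : R) (hr : 1 < r) (hq : 2 < q) (hrq : r^-1 + 2 / q < 1)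
    (hWq : embedded_in_Lq s Omega W q)
    (ubar : L2U T Omega) (wbar : 'rV[R]_d -> R)
    (hsol : local_solution s W f alpha beta gamma p ubar wbar)
    (hf' : ('N[leb_on (domain_open Omega)]_r%:E[
              (fun x => 'N[leb_I T]_1[(fun t => (f' ubar (t, x))%:E)])] < +oo)%E) :
  wbar \in Lfun (leb_on (domain_open Omega)) +oo%E /\
  (ubar : _ -> _) \in Lfun (leb_IO T Omega) +oo%E.
Proof.
have [[Hw uw] _] := hsol.
have /Lfun2E[mw _] := in_W_Lfun2 Hw.
have [C emb] := hWq.
have excW k : 0 <= k -> in_W s Omega W (fun x => excess k (wbar x)).
  move=> k0; have le01 : 0 <= (1 : R) <= 1 by rewrite ler01 lexx.
  by have [zW _ _] := in_W_excess hs hW k0 le01 Hw; exact: zW.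
have b2 : 0 < beta / 2 by rewrite divr_gt0.
(* The constant in the optimality condition is beta/2. The embedding constant has no prescribed
   sign, hence |C|. *)
have [|k k0|k k0|M M0 muM] := bounded_of_excess (leb_on_lty Omega)
    (n := fun k => normW s Omega W (fun x => excess k (wbar x))) (C := `|C|)
    mw (measurable_timeL1 (f' ubar)) _ hr hq hrq hf' b2 (normr_ge0 C)
    (fun k _ => sqrtr_ge0 _).
- by move=> x; exact: Lnorm_ge0.
- have [_ le1] := emb _ (excW _ k0); apply: (le_trans le1).
  by rewrite lee_fin ler_wpM2r ?sqrtr_ge0// ler_norm.
- have [v [vz le1]] := variational_excess hs hW f_C1 halpha hbeta hgamma hp hsol k0.
  apply: (@le_trans _ _ `|dotU (f' ubar) v|%:E); first by rewrite lee_fin.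
  by apply: dotU_le vz; [exact: measurable_excess|move=> x; exact: excess_ge0].
have wM : {ae leb_on (domain_open Omega), forall x, wbar x <= M}.
  exists [set x | M < wbar x]; split; [exact: measurable_superlevel|exact: muM|].
  by move=> x /= /negP; rewrite -ltNge.
have msnd (N : set 'rV[R]_d) : measurable N ->
    measurable (snd @^-1` N : set (measurableTypeR R * 'rV[R]_d)).
  by move=> mN; rewrite -[X in measurable X]setTI; exact: measurable_snd.
have lift (N : set 'rV[R]_d) : measurable N ->
    leb_IO T Omega (snd @^-1` N) = 0%E <-> leb_on (domain_open Omega) N = 0%E.
  move=> mN; rewrite leb_IO_snd//; split => [/eqP|->]; last by rewrite mule0.
  by rewrite mule_eq0 eqe gt_eqF//= => /eqP.
(* The constraint gives 0 <= |ubar| <= wbar almost everywhere on I x Omega only. The cylinder over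
   {wbar < 0} is thus null, and so is its base. *)
have w0 : {ae leb_on (domain_open Omega), forall x, 0 <= wbar x}.
  have mN : measurable [set x | 0 < - wbar x].
    by apply: measurable_superlevel; exact: measurable_funN.
  exists [set x | 0 < - wbar x]; split => //.
    apply/lift => //; have [N [mN' N0 uN]] := uw.
    apply: (subset_measure0 _ _ _ N0) => //.
      exact: msnd.
    move=> z /= wz; apply: uN => /= uz; have := normr_ge0 (ubar z); lra.
  by move=> x /= /negP; rewrite -ltNge oppr_gt0.
split.
  apply: (Lfun_pinfty (M := M) mw).
  by apply: filterS2 w0 wM => x w0 wM; rewrite ger0_norm.
have wM2 : {ae leb_IO T Omega, forall z, wbar z.2 <= M}.
  have mN : measurable [set x | M < wbar x] by exact: measurable_superlevel.
  exists (snd @^-1` [set x | M < wbar x]); split.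
  - exact: msnd.
  - exact/lift.
  - by move=> z /= /negP; rewrite -ltNge.
(* The control inherits its bound from the constraint: |ubar| <= wbar <= M. *)
apply: (Lfun_pinfty (M := M) (L2_measurable ubar)).
by apply: filterS2 uw wM2 => z; exact: le_trans.
Qed.
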